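(* Assume that the following two conditions hold. (1) The limit $$\bar k(t,s)=\lim_{\varepsilon\to0}\frac{\mathrm{Cov}(X_{T_n+\varepsilon t}-X_{T_n},\,X_{T_n+\varepsilon s}-X_{T_n})}{\gamma_\varepsilon^2}$$ exists uniformly in $(t,s)\in[0,1]\times[0,1]$. (2) For every fixed $T>0$ the limit $$\bar\rho(t,T)=\lim_{\varepsilon\to0}\frac{k(T_n+\varepsilon t,T)-k(T_n,T)}{\gamma_\varepsilon}$$ exists uniformly in $t\in[0,1]$. Let $Y^n$ be the bridge of the $n$-fold conditional process $X^n$ with final value $y$ at time $T_n+\varepsilon$. Then the family of processes $\{(Y^n_{T_n+\varepsilon t})_{t\in[0,1]}\}_\varepsilon$ satisfies a large deviation principle on $C([0,1])$ as $\varepsilon\to0$, with inverse speed $\gamma_\varepsilon^2$ and good rate function $$J_Y(h)=\begin{cases}\frac12\|h-\bar m\|^2_{\bar{\mathscr H}_Y}&\text{if }h_0=x_n,\ h_1=y,\ h-\bar m\in\bar{\mathscr H}_Y,\\+\infty&\text{otherwise,}\end{cases}$$ where $\bar m_t=x_n+\bar\beta_t(y-x_n)$ with $\bar\beta_t=\bar k_n(t,1)/\bar k_n(1,1)$, and $\bar{\mathscr H}_Y$ is the reproducing kernel Hilbert space associated to the covariance function $$\bar k_Y(t,s)=\bar k_n(t,s)-\bar\beta_s\,\bar k_n(t,1)=\bar k_n(t,s)-\frac{\bar k_n(t,1)\,\bar k_n(s,1)}{\bar k_n(1,1)}.$$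
   Context: Let $X=(X_t)_{t\ge0}$ be a continuous centered Gaussian process with continuous covariance function $k(t,s)=\mathrm{Cov}(X_t,X_s)$. Fix $n\in\mathbb N$, $n\ge1$, times $0<T_1<\dots<T_n$ and real numbers $x_1,\dots,x_n$, $y$. Set $X^0=X$, $k_0=k$ and, for $j=1,\dots,n$, $$\alpha_j(t)=\frac{k_{j-1}(t,T_j)}{k_{j-1}(T_j,T_j)},\qquad X^j_t=X^{j-1}_t-\alpha_j(t)(X^{j-1}_{T_j}-x_j),\qquad k_j(t,s)=k_{j-1}(t,s)-\alpha_j(t)k_{j-1}(s,T_j),$$ where it is assumed that $k_{j-1}(T_j,T_j)>0$. Then $k_j$ is the covariance function of $X^j$, and $X^n$ (the $n$-fold conditional process) has the law of $X$ conditioned on $X_{T_1}=x_1,\dots,X_{T_n}=x_n$. Let $\gamma_\varepsilon>0$ with $\gamma_\varepsilon\to0$ as $\varepsilon\to0$. The bridge $Y^n$ (which depends on $\varepsilon$) is $X^n$ conditioned to be at $y$ at time $T_n+\varepsilon$; in law, $$Y^n_{T_n+\varepsilon t}=X^n_{T_n+\varepsilon t}-\beta^\varepsilon_{T_n+\varepsilon t}(X^n_{T_n+\varepsilon}-y),\qquad \beta^\varepsilon_{T_n+\varepsilon t}=\frac{k_n(T_n+\varepsilon t,T_n+\varepsilon)}{k_n(T_n+\varepsilon,T_n+\varepsilon)},\quad t\in[0,1].$$ Put $\bar\rho_0=\bar\rho$ and recursively, for $j=1,\dots,n$, $\bar\alpha_j(t)=\bar\rho_{j-1}(t,T_j)/k_{j-1}(T_j,T_j)$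 and $\bar\rho_j(t,T)=\bar\rho_{j-1}(t,T)-\alpha_j(T)\bar\rho_{j-1}(t,T_j)$; set $$\bar k_n(t,s)=\bar k(t,s)-\sum_{j=1}^nk_{j-1}(T_j,T_j)\bar\alpha_j(t)\bar\alpha_j(s),$$ and assume $\bar k_n(1,1)>0$. $C([0,1])$ is the space of continuous real paths on $[0,1]$ with the sup-norm. A family $\{U^\varepsilon\}_\varepsilon$ of $C([0,1])$-valued random variables satisfies a large deviation principle with inverse speed $\gamma_\varepsilon^2$ and good rate function $I$ if $\gamma_\varepsilon\to0$, the set $\{I\le a\}$ is compact for every real $a$, $\liminf_{\varepsilon\to0}\gamma_\varepsilon^2\log\mathbb P(U^\varepsilon\in G)\ge-\inf_GI$ for every open $G$, and $\limsup_{\varepsilon\to0}\gamma_\varepsilon^2\log\mathbb P(U^\varepsilon\in F)\le-\inf_FI$ for every closed $F$. The reproducing kernel Hilbert space of a continuous, symmetric, positive (semi)definite kernel $q$ on $[0,1]^2$ is the completion, inside $C([0,1])$, of the paths $h_t=\int_0^1q(t,s)\lambda(ds)$, $\lambda$ a signed Borel measure on $[0,1]$, with $\|h\|^2=\int_0^1\int_0^1q(t,s)\lambda(dt)\lambda(ds)$. *)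

(* Defs.v *)
From HB Require Import structures.
From mathcomp Require Import all_boot all_order all_algebra.
From mathcomp Require Import all_classical all_reals all_analysis.

Set Implicit Arguments.
Unset Strict Implicit.
Unset Printing Implicit Defensive.

Import Order.TTheory GRing.Theory Num.Theory.
Import numFieldNormedType.Exports.

Local Open Scope classical_set_scope.
Local Open Scope ring_scope.

Definition I01 (R : realType) : Type := set_type (`[0, 1]%classic : set R).

Definition val01 (R : realType) (t : I01 R) : R := set_val t.

Lemma mem01_0 (R : realType) : (0 : R) \in (`[0, 1]%classic : set R).
Proof. by rewrite inE /= in_itv /= lexx ler01. Qed.

Lemma mem01_1 (R : realType) : (1 : R) \in (`[0, 1]%classic : set R).
Proof. by rewrite inE /= in_itv /= lexx ler01. Qed.

Definition zero01 (R : realType) : I01 R := exist _ 0 (mem01_0 R).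
Definition one01 (R : realType) : I01 R := exist _ 1 (mem01_1 R).

HB.instance Definition _ (R : realType) := PseudoMetric.copy (I01 R)
  (set_type (`[0, 1]%classic : set R)).
HB.instance Definition _ (R : realType) := isPointed.Build (I01 R) (zero01 R).

Definition C01 (R : realType) : Type := continuousType (I01 R) R.

(* [arrow_uniform_type] carries the topology of uniform convergence, which on
   continuous paths is the topology of the sup-norm. *)
HB.instance Definition _ (R : realType) :=
  Choice.copy (C01 R) (continuousType (I01 R) R).
HB.instance Definition _ (R : realType) := PseudoMetric.copy (C01 R)
  (initial_topology ((fun f => f : I01 R -> R)
    : continuousType (I01 R) R -> arrow_uniform_type (I01 R) R)).
HB.instance Definition _ (R : realType) :=
  isPointed.Build (C01 R) (cst (0 : R)).

Definition borel (S : ptopologicalType) := g_sigma_algebraType (@open S).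

Section large_deviations.
Variables (R : realType) (S : ptopologicalType).
Variables (d : R -> measure_display) (T : forall e, measurableType (d e)).
Variables (P : forall e, probability (T e) R).

(* The parameter tends to 0 from the right. *)
Definition LDP (gamma : R -> R) (U : forall e, {RV (P e) >-> borel S})
    (I : S -> \bar R) : Prop :=
  [/\ gamma e @[e --> 0^'+] --> (0 : R),
      (forall a : R, compact [set s | (I s <= a%:E)%E]),
      (forall G : set S, open G ->
        (- ereal_inf [set I s | s in G] <=
         limf_einf (fun e => (gamma e ^+ 2)%:E * lne (P e (U e @^-1` G)))
                   (0^'+))%E) &
      (forall F : set S, closed F ->
        (limf_esup (fun e => (gamma e ^+ 2)%:E * lne (P e (U e @^-1` F)))
                   (0^'+) <=
         - ereal_inf [set I s | s in F])%E)].

End large_deviations.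

Section signed_integral.
Variables (d : measure_display) (T : measurableType d) (R : realType).
Variable nu : {charge set T -> \bar R}.

Let posnu : set T := projT1 (cid (Hahn_decomposition nu)).
Let negnu : set T := projT1 (cid (projT2 (cid (Hahn_decomposition nu)))).
Let hahnu : hahn_decomposition nu posnu negnu :=
  projT2 (cid (projT2 (cid (Hahn_decomposition nu)))).

Definition charge_integral (f : T -> R) : R :=
  \int[jordan_pos hahnu]_x f x - \int[jordan_neg hahnu]_x f x.

End signed_integral.

Section rkhs.
Variables (R : realType) (q : I01 R -> I01 R -> R).

Definition signed01 := {charge set (borel (I01 R)) -> \bar R}.

Definition potential (l : signed01) (t : I01 R) : R :=
  charge_integral l (fun s => q t s).

Definition energy (l : signed01) : R :=
  charge_integral l (fun s => charge_integral l (fun t => q t s)).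

(* [h] is the element of the completion represented by the sequence of paths
   [potential (l i)], Cauchy for the norm whose square is [energy]. *)
Definition rkhs_repr (l : nat -> signed01) (h : I01 R -> R) : Prop :=
  (forall r : R, 0 < r -> exists N, forall i j, (N <= i)%N -> (N <= j)%N ->
     energy (cadd (l i) (copp (l j))) < r) /\
  {uniform, (fun i => potential (l i)) @ \oo --> h}.

Definition rkhs : set (I01 R -> R) :=
  [set h | continuous h /\ exists l, rkhs_repr l h].

(* The limit does not depend on the representing sequence. *)
Definition rkhs_sqnorm (h : I01 R -> R) : R :=
  xget 0 [set r | exists2 l, rkhs_repr l h & energy (l i) @[i --> \oo] --> r].

End rkhs.

Section gaussian.
Variables (d : measure_display) (T : measurableType d) (R : realType).
Variable P : probability T R.

(* [normal_prob m 0] is not the Dirac mass at [m], so the degenerate case is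
   treated apart. *)
Definition gaussian_law (m s : R) (A : set R) : \bar R :=
  if s == 0 then dirac m A else normal_prob m s A.

Definition gaussian_rv (Z : T -> R) : Prop :=
  exists m s : R, 0 <= s /\
    forall A : set R, measurable A -> P (Z @^-1` A) = gaussian_law m s A.

Definition gaussian_process (X : R -> T -> R) : Prop :=
  forall (N : nat) (a t : 'I_N -> R), (forall i, 0 <= t i) ->
    gaussian_rv (fun w => \sum_(i < N) a i * X (t i) w).

End gaussian.

Definition same_fdd (R : realType) (I : Type)
    (d1 d2 : measure_display) (T1 : measurableType d1) (T2 : measurableType d2)
    (P1 : probability T1 R) (P2 : probability T2 R)
    (U1 : I -> T1 -> R) (U2 : I -> T2 -> R) : Prop :=
  forall (N : nat) (t : 'I_N -> I) (A : 'I_N -> set R),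
    (forall i, measurable (A i)) ->
    P1 [set w | forall i, A i (U1 (t i) w)] =
    P2 [set w | forall i, A i (U2 (t i) w)].

(* The times [T 1, ..., T n] and the values [x 1, ..., x n] are given by
   sequences indexed by [nat], of which only these terms matter. *)
Section conditioning.
Variables (R : realType) (k : R -> R -> R) (T : nat -> R).

Fixpoint cond_cov (j : nat) (t s : R) : R :=
  if j is i.+1 then
    cond_cov i t s
    - cond_cov i t (T j) / cond_cov i (T j) (T j) * cond_cov i s (T j)
  else k t s.

Definition alpha (j : nat) (t : R) : R :=
  cond_cov j.-1 t (T j) / cond_cov j.-1 (T j) (T j).

Fixpoint cond_proc (W : Type) (X : R -> W -> R) (x : nat -> R) (j : nat)
    (t : R) (w : W) : R :=
  if j is i.+1 then
    cond_proc X x i t w - alpha j t * (cond_proc X x i (T j) w - x j)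
  else X t w.

(* [e] is the length of the bridge, whose end time is [T n + e]; [t] is an
   absolute time. *)
Definition beta (n : nat) (e t : R) : R :=
  cond_cov n t (T n + e) / cond_cov n (T n + e) (T n + e).

Definition bridge (W : Type) (X : R -> W -> R) (x : nat -> R) (n : nat) (y : R)
    (e t : R) (w : W) : R :=
  cond_proc X x n t w - beta n e t * (cond_proc X x n (T n + e) w - y).

Variables (kbar rhobar : R -> R -> R).

Fixpoint rhobar_cond (j : nat) (t u : R) : R :=
  if j is i.+1 then rhobar_cond i t u - alpha j u * rhobar_cond i t (T j)
  else rhobar t u.

Definition alphabar (j : nat) (t : R) : R :=
  rhobar_cond j.-1 t (T j) / cond_cov j.-1 (T j) (T j).

Definition kbar_cond (n : nat) (t s : R) : R :=
  kbar t s - \sum_(1 <= j < n.+1)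
    cond_cov j.-1 (T j) (T j) * alphabar j t * alphabar j s.

Definition betabar (n : nat) (t : R) : R :=
  kbar_cond n t 1 / kbar_cond n 1 1.

Definition mbar (xn : R) (n : nat) (y t : R) : R :=
  xn + betabar n t * (y - xn).

Definition kbarY (n : nat) (t s : R) : R :=
  kbar_cond n t s - betabar n s * kbar_cond n t 1.

Definition rateY (xn : R) (n : nat) (y : R) (h : C01 R) : \bar R :=
  let q := fun t s : I01 R => kbarY n (val01 t) (val01 s) in
  let g := fun t : I01 R => h t - mbar xn n y (val01 t) in
  if `[< [/\ h (zero01 R) = xn, h (one01 R) = y & rkhs q g] >]
  then (2^-1 * rkhs_sqnorm q g)%:E else +oo%E.

End conditioning.

(* Main.v *)
(* On the window [T n, T n + e] the centered bridge tends to 0, and its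
   covariance divided by [gamma e ^ 2] tends uniformly to [kbarY]: each
   conditioning subtracts a rank one kernel, the product of two increments of
   order [gamma e].  The theorem is thus a large deviation principle for Gaussian
   paths with small noise, whose three ingredients are the following.

   Exponential equicontinuity comes from Fernique's rotation trick: if U and V
   are independent copies of a centered Gaussian vector, so are
   (U - V) / sqrt 2 and (U + V) / sqrt 2, hence
   P(max |U| > r) P(max |U| <= m) <= exp (- (r - 3 m) ^ 2 / (4 sigma ^ 2)).

   For the upper bound, the sets whose complement in the closed set has
   probability of rate larger than [a] form a filter; an ultrafilter finer than
   it converges by Ascoli, and the exponential Markov inequality at its limit
   [h] contradicts the assumption that the rate of [h] exceeds [a].

   For the lower bound, tilting by the exponential of a linear combination of
   evaluations moves the mass to a path of the form [m + \sum_i a_i q(., t_i)],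
   and such paths approximate every path of finite rate.

   The rate function is read as the supremum over finite combinations of
   [\sum_i a_i g t_i - (\sum_i \sum_j a_i a_j q t_i t_j) / 2], which is half the
   squared norm of [g]: maximizing sequences of discrete measures are Cauchy
   for the energy. *)

(* A Gaussian family is known only through the laws of its linear combinations, and [Y] only through
   finite-dimensional laws, on probability spaces that change with the parameter. The probability
   estimates are therefore made at finitely many times, with constants that do not depend on how
   many, and reach whole paths by increasing unions over a countable dense set of times. A union
   bound over the times would break this; the rotation trick does not, because the events that
   locate the maximum of the rotated sum are disjoint and independent of the rotated difference. The
   factor P(max |U| <= m) only has to be at least 1/2, which comes from the continuity of the paths
   of [X] at [T n]; no metric entropy enters. Invariance under rotation concerns joint laws, while
   the data are laws of linear combinations: integrals of cosines agree, hence those of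
   trigonometric polynomials, hence those of indicators of intersections of half-spaces. *)
Require Import Defs.
From HB Require Import structures.
From mathcomp Require Import all_boot all_order all_algebra.
From mathcomp Require Import all_classical all_reals all_analysis.
From mathcomp Require Import measurable_realfun ring lra.

Set Implicit Arguments.
Unset Strict Implicit.
Unset Printing Implicit Defensive.

Import Order.TTheory GRing.Theory Num.Theory.
Import numFieldNormedType.Exports.

Local Open Scope classical_set_scope.
Local Open Scope ring_scope.

(** * Normal laws *)

Section normal_integrals.
Variable R : realType.
Local Notation mu := (@lebesgue_measure R).
Implicit Types (m s : R).

(** The Radon-Nikodym derivative and the explicit density have the same integral over every
    measurable set, hence agree almost everywhere. *)
Lemma ge0_integral_normal_prob m s (f : R -> \bar R) :
    measurable_fun [set: R] f -> (forall x, (0 <= f x)%E) ->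
  (\int[normal_prob m s]_x f x = \int[mu]_x (f x * (normal_pdf m s x)%:E))%E.
Proof.
move=> mf f0.
have dom := normal_prob_dominates m s.
have mpdf : measurable_fun [set: R] (fun x => (normal_pdf m s x)%:E).
  by apply/measurable_EFinP; exact: measurable_normal_pdf.
rewrite -(Radon_Nikodym_SigmaFinite.change_of_variables dom)//.
have fint := Radon_Nikodym_SigmaFinite.f_integrable dom.
apply: ae_eq_integral => //.
- by apply: emeasurable_funM => //; exact: (measurable_int mu).
- exact: emeasurable_funM.
- apply: ae_eqe_mul2l.
  apply: integral_ae_eq => //.
  by move=> E _ mE; rewrite -Radon_Nikodym_SigmaFinite.f_integral.
Qed.

Lemma normal_peakM s c : 0 < c ->
  normal_peak (c * s) = c^-1 * normal_peak s.
Proof.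
move=> c0; rewrite /normal_peak -invfM; congr (_^-1).
rewrite exprMn -mulrA -mulrnAr sqrtrM ?sqr_ge0//.
by rewrite sqrtr_sqr gtr0_norm.
Qed.

(** Completing the square: an exponential weight of slope [t] moves the mean by [t * s ^+ 2], and
    the factor that comes out is the moment generating function at [t]. *)
Lemma expR_normal_pdf m s t x : s != 0 ->
  expR (t * x) * normal_pdf m s x =
  expR (t * m + t ^+ 2 * s ^+ 2 / 2) * normal_pdf (m + t * s ^+ 2) s x.
Proof.
move=> s0; rewrite !normal_pdfE// mulrCA -expRD mulrCA -expRD; congr (_ * expR _).
by field.
Qed.

(** The coefficient is the one for which the quadratic weight turns a normal density of deviation
    [s] into one of deviation [c * s]. The mass [c] that comes out is the expectation of exp (h
    Z^2), the source of the second moment in [gaussian_sqr]. *)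
Lemma expR_sqr_normal_pdf s c x : s != 0 -> 0 < c ->
  expR ((1 - c ^- 2) / (s ^+ 2 *+ 2) * x ^+ 2) * normal_pdf 0 s x =
  c * normal_pdf 0 (c * s) x.
Proof.
move=> s0 c_gt0; have c0 : c != 0 by rewrite gt_eqF.
rewrite !normal_pdfE ?mulf_neq0// normal_peakM// -[c^-1 * _ * _]mulrA mulVKf//.
rewrite mulrCA -expRD; congr (_ * expR _).
by field; rewrite s0.
Qed.

(** Disintegration of the joint density of a first variable and a sum: the right-hand side is the
    density of the sum at [z] times the conditional density of the first variable given that
    value. *)
Lemma normal_pdf_conv s1 s2 s x z : s1 != 0 -> s2 != 0 -> 0 < s ->
    s1 ^+ 2 + s2 ^+ 2 = s ^+ 2 ->
  normal_pdf 0 s1 x * normal_pdf x s2 z =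
  normal_pdf 0 s z * normal_pdf (s1 ^+ 2 / s ^+ 2 * z) (s1 * s2 / s) x.
Proof.
move=> s10 s20 s_gt0 ss.
have s0 : s != 0 by rewrite gt_eqF.
rewrite !normal_pdfE ?mulf_neq0 ?invr_eq0//.
rewrite mulrACA [RHS]mulrACA -!expRD; congr (_ * expR _).
- rewrite /normal_peak -!invfM -!sqrtrM; last 2 first.
  + by rewrite mulrn_wge0// mulr_ge0 ?sqr_ge0 ?pi_ge0.
  + by rewrite mulrn_wge0// mulr_ge0 ?sqr_ge0 ?pi_ge0.
  by congr (Num.sqrt _)^-1; field.
- have s2E : s2 ^+ 2 = s ^+ 2 - s1 ^+ 2 by rewrite -ss addrC addKr.
  have ds : s ^+ 2 - s1 ^+ 2 != 0.
    by rewrite -ss addrC addKr sqrf_eq0.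
  have -> : (s1 * s2 / s) ^+ 2 = s1 ^+ 2 * (s ^+ 2 - s1 ^+ 2) / s ^+ 2.
    by rewrite -s2E; field.
  rewrite s2E.
  by field; rewrite s0 s10 ds.
Qed.

(* Translation invariance of Lebesgue measure is only available through
   substitution, hence the continuity of [g]. *)
Lemma integral_normal_pdf_shift m s c (g : R -> R) : s != 0 ->
    continuous g -> (forall x, 0 <= g x) ->
  (\int[mu]_x (g (c + x) * normal_pdf m s x)%:E =
   \int[mu]_x (g x * normal_pdf (c + m) s x)%:E)%E.
Proof.
move=> s0 cg g0.
have dF : (fun x : R => c + x)^`()%classic = cst 1.
  apply/funext => x; rewrite derive1E deriveD// derive_cst derive_id.
  by rewrite add0r.
rewrite [RHS](@increasing_ge0_integration_by_substitutionT _ (fun x => c + x)).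
- apply: eq_integral => x _; rewrite dF/= !fctE/= mulr1; congr (_ * _)%:E.
  rewrite !normal_pdfE//; congr (_ * expR _); congr (- _ ^+ 2 / _).
  by rewrite opprD addrACA subrr add0r.
- by move=> x y; rewrite ltrD2l.
- by rewrite dF => ?; exact: cvg_cst.
- by rewrite dF; exact: is_cvg_cst.
- by rewrite dF; exact: is_cvg_cst.
- by move=> x; exact: derivableD.
- exact: cvg_addrl_Ny.
- exact: cvg_addrl.
- move=> x; apply: cvgM; first exact: cg.
  exact: continuous_normal_pdf.
- by move=> x; rewrite mulr_ge0 ?normal_pdf_ge0.
Qed.

Lemma measurable_normal_pdf2 s : measurable_fun [set: R * R]
  (fun p : R * R => normal_pdf p.1 s p.2).
Proof.
rewrite /normal_pdf; case: eqVneq => [s0|s0].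
  by apply: (measurableT_comp (measurable_indic _)) => //; exact: measurable_itv.
apply: measurable_funM => //; apply: measurableT_comp => //.
apply: measurable_funM => //; apply: measurableT_comp => //.
apply: measurable_funX; apply: measurable_funB => //.
Qed.

(** Once the inner variable is recentered, Tonelli integrates the first variable out; by
    [normal_pdf_conv] this only removes a conditional density of mass 1. *)
Lemma integral_normal_conv s1 s2 s (g : R -> R) : s1 != 0 -> s2 != 0 -> 0 < s ->
    s1 ^+ 2 + s2 ^+ 2 = s ^+ 2 ->
    continuous g -> (forall x, 0 <= g x) ->
  (\int[mu]_x ((normal_pdf 0 s1 x)%:E *
      \int[mu]_y (g (x + y) * normal_pdf 0 s2 y)%:E) =
   \int[mu]_x (g x * normal_pdf 0 s x)%:E)%E.
Proof.
move=> s10 s20 s0 ss cg g0.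
have mg : measurable_fun setT g by exact: continuous_measurable_fun.
have mpdf (m t : R) := measurable_normal_pdf m t.
under eq_integral => x _.
  rewrite integral_normal_pdf_shift// addr0 -ge0_integralZl//; last 3 first.
  - apply/measurable_EFinP; apply: measurable_funM; [exact: mg|exact: mpdf].
  - by move=> y _; rewrite lee_fin mulr_ge0 ?normal_pdf_ge0.
  - by rewrite lee_fin normal_pdf_ge0.
  over.
pose F (p : R * R) := ((normal_pdf 0 s1 p.1)%:E *
  (g p.2 * normal_pdf p.1 s2 p.2)%:E)%E.
transitivity (\int[mu]_y \int[mu]_x F (x, y))%E.
  apply: (@fubini_tonelli _ _ _ _ _ mu mu F); last first.
    by move=> p; rewrite /F mule_ge0 ?lee_fin ?mulr_ge0 ?normal_pdf_ge0.
  apply: emeasurable_funM; apply/measurable_EFinP.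
    exact: measurableT_comp.
  apply: measurable_funM; first exact: measurableT_comp.
  exact: measurable_normal_pdf2.
rewrite /F/=.
apply: eq_integral => z _.
under eq_integral => x _.
  rewrite -EFinM mulrCA (normal_pdf_conv _ _ s10 s20 s0 ss) mulrA EFinM.
  over.
rewrite ge0_integralZl//.
- by rewrite integral_normal_pdf mule1.
- by apply/measurable_EFinP; exact: mpdf.
- by move=> x _; rewrite lee_fin normal_pdf_ge0.
- by rewrite lee_fin mulr_ge0 ?normal_pdf_ge0.
Qed.

End normal_integrals.

(** Parametrized by the variance [v], so that quadratic forms of a covariance can be used as they
    are; [v = 0] is the Dirac mass, through [gaussian_law]. *)
Definition gaussian d (T : measurableType d) (R : realType)
    (P : probability T R) (Z : T -> R) (m v : R) : Prop :=
  [/\ measurable_fun [set: T] Z, 0 <= v &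
    forall A : set R, measurable A ->
      P (Z @^-1` A) = gaussian_law m (Num.sqrt v) A].

(** The expectation of [f] under the normal law of mean [m] and variance [v], which has a density
    only if [v] is nonzero. *)
Definition normal_mean (R : realType) (m v : R) (f : R -> R) : \bar R :=
  if v == 0 then (f m)%:E
  else (\int[lebesgue_measure]_x (f x * normal_pdf m (Num.sqrt v) x)%:E)%E.

Lemma integrable_affine d (T : measurableType d) (R : realType)
    (P : probability T R) (Z : T -> R) (a b : R) :
  P.-integrable setT (EFin \o Z) ->
  P.-integrable setT (fun w => (a + b * Z w)%:E).
Proof.
move=> iZ.
have -> : (fun w => (a + b * Z w)%:E) =
    (cst a%:E \+ (fun w => b%:E * (EFin \o Z) w))%E by [].
apply: integrableD => //; first exact: finite_measure_integrable_cst.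
exact: integrableZl.
Qed.

Lemma integral_affine d (T : measurableType d) (R : realType)
    (P : probability T R) (Z : T -> R) (a b mu : R) :
  P.-integrable setT (EFin \o Z) -> (\int[P]_w (Z w)%:E = mu%:E)%E ->
  (\int[P]_w (a + b * Z w)%:E = (a + b * mu)%:E)%E.
Proof.
move=> iZ EZ.
have -> : (fun w => (a + b * Z w)%:E) =
    (cst a%:E \+ (fun w => b%:E * (EFin \o Z) w))%E by [].
rewrite integralD//=; last 2 first.
- exact: finite_measure_integrable_cst.
- exact: integrableZl.
by rewrite integral_cst//= probability_setT mule1 integralZl// EZ.
Qed.

Section gaussian_moments.
Context d (T : measurableType d) (R : realType) (P : probability T R).
Variables (Z : T -> R) (m v : R).
Hypothesis gZ : gaussian P Z m v.

Let mZ : measurable_fun [set: T] Z. Proof. by case: gZ. Qed.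
Let v0 : 0 <= v. Proof. by case: gZ. Qed.
Let lawZ : forall A : set R, measurable A ->
      P (Z @^-1` A) = gaussian_law m (Num.sqrt v) A.
Proof. by case: gZ. Qed.

Let s0 : v != 0 -> Num.sqrt v != 0.
Proof. by move=> vN0; rewrite sqrtr_eq0 -ltNge lt_neqAle eq_sym vN0. Qed.

Lemma gaussian_integral (f : R -> R) : measurable_fun [set: R] f ->
    (forall x, 0 <= f x) ->
  (\int[P]_w (f (Z w))%:E = normal_mean m v f)%E.
Proof.
move=> mf f0.
have mEf : measurable_fun [set: measurableTypeR R] (fun x => (f x)%:E).
  exact/measurable_EFinP.
have mZ' : @measurable_fun _ _ T (measurableTypeR R) setT Z by exact: mZ.
pose X : {RV P >-> measurableTypeR R} := @mfun_Sub _ _ T (measurableTypeR R) Z (mem_set mZ').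
have f0E x : (0 <= (f x)%:E)%E by rewrite lee_fin.
rewrite -[LHS](ge0_integral_distribution X mEf f0E).
rewrite /normal_mean; case: eqVneq => [v_eq0|vN0].
  transitivity (\int[@dirac _ (measurableTypeR R) m R]_y (f y)%:E)%E.
    apply: eq_measure_integral => A mA _; have := lawZ mA.
    by rewrite v_eq0 sqrtr0 /gaussian_law eqxx.
  by rewrite integral_dirac//= diracT mul1e.
transitivity (\int[normal_prob m (Num.sqrt v)]_y (f y)%:E)%E.
  apply: eq_measure_integral => A mA _; have := lawZ mA.
  by rewrite /gaussian_law (negbTE (s0 _)).
by rewrite ge0_integral_normal_prob.
Qed.

Lemma gaussian_mgf (t : R) :
  (\int[P]_w (expR (t * Z w))%:E = (expR (t * m + t ^+ 2 * v / 2))%:E)%E.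
Proof.
rewrite (@gaussian_integral (fun x => expR (t * x))).
- rewrite /normal_mean; case: eqVneq => [->|vN0].
    by rewrite mulr0 mul0r addr0.
  under eq_integral => x _.
    rewrite (expR_normal_pdf _ _ _ (s0 vN0)) sqr_sqrtr// EFinM.
    over.
  rewrite ge0_integralZl//.
  + by rewrite integral_normal_pdf mule1.
  + by apply/measurable_EFinP; exact: measurable_normal_pdf.
  + by move=> x _; rewrite lee_fin normal_pdf_ge0.
- by apply: measurableT_comp => //; exact: measurable_funM.
- by move=> x; rewrite expR_ge0.
Qed.

Lemma gaussian_exp_markov (t a : R) : 0 < t ->
  (P [set w | (a <= Z w)%R] <= (expR (t * m + t ^+ 2 * v / 2 - t * a))%:E)%E.
Proof.
move=> t0; pose X : {mfun T >-> R} := mfun_Sub (mem_set mZ).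
have := @chernoff _ _ _ P X t a t0.
rewrite /mmt_gen_fun unlock /=.
under eq_integral do rewrite mulrC.
by rewrite gaussian_mgf -EFinM -expRD.
Qed.

Lemma gaussian_chernoff (a V : R) : 0 <= a -> 0 < V -> v <= V -> m = 0 ->
  (P [set w | (a <= Z w)%R] <= (expR (- (a ^+ 2 / (2 * V))))%:E)%E.
Proof.
(* The optimal slope [a / V] vanishes with [a], whereas the exponential Markov inequality asks for a
   positive one. *)
move=> a0 V_gt0 vV m0; have [->|aN0] := eqVneq a 0.
  rewrite expr0n mul0r oppr0 expR0 probability_le1//.
  have -> : [set w | 0 <= Z w] = [set: T] `&` Z @^-1` `[0, +oo[.
    by rewrite setTI; apply/seteqP; split=> w /=; rewrite in_itv/= andbT.
  exact: mZ.
have t0 : 0 < a / V by rewrite divr_gt0// lt_neqAle eq_sym aN0.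
apply: (le_trans (gaussian_exp_markov a t0)); rewrite lee_fin ler_expR m0 mulr0 add0r.
have -> : - (a ^+ 2 / (2 * V)) = (a / V) ^+ 2 * V / 2 - a / V * a.
  by field; rewrite gt_eqF.
by rewrite lerD2r ler_wpM2r// ler_wpM2l// sqr_ge0.
Qed.

(** From exp x >= 1 + x and the moment generating function, 1 + t (mu - m) <= exp (t^2 v / 2) for
    every real t; for small t of the sign of mu - m this fails unless mu = m. The first moment of
    the normal law is thus never computed. *)
Lemma gaussian_mean_eq (mu : R) : P.-integrable setT (EFin \o Z) ->
  (\int[P]_w (Z w)%:E = mu%:E)%E -> mu = m.
Proof.
move=> iZ EZ.
have step (t : R) : 1 + t * (mu - m) <= expR (t ^+ 2 * v / 2).
  have mexp : measurable_fun [set: T] (fun w => (expR (t * Z w))%:E).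
    by apply/measurable_EFinP/measurableT_comp => //; exact: measurable_funM.
  have iexp : P.-integrable setT (fun w => (expR (t * Z w))%:E).
    apply/integrableP; split => //.
    under eq_integral do rewrite /= ger0_norm ?expR_ge0//.
    by rewrite gaussian_mgf ltry.
  have := @integral_affine _ _ _ P Z (1 - t * m) t _ iZ EZ.
  rewrite -addrA [- _ + _]addrC -mulrBr => Eaff.
  rewrite -lee_fin -Eaff.
  apply: (@le_trans _ _ (\int[P]_w (expR (- (t * m)) * expR (t * Z w))%:E)%E).
    apply: le_integral => //=.
    - exact: integrable_affine.
    - exact: (@integrableZl _ _ _ P setT measurableT (expR (- (t * m)))
        (fun w => (expR (t * Z w))%:E)).
    - move=> w _; rewrite lee_fin -expRD.
      by rewrite (le_trans _ (expR_ge1Dx _))// addrA.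
  under eq_integral do rewrite EFinM.
  rewrite ge0_integralZl//.
  by rewrite gaussian_mgf -EFinM -expRD lee_fin ler_expR addrA addNr add0r.
apply/eqP; rewrite -subr_eq0; apply/negPn/negP => dN0.
set del := mu - m in step dN0.
have d2 : 0 < del ^+ 2 by rewrite exprn_even_gt0.
(* The slope will be t = c (mu - m). This [c] makes c v < 1 and t^2 v <= 1, small enough for exp x
   <= 1 / (1 - x) to contradict [step]. *)
pose c := (1 + v + v * del ^+ 2)^-1.
have v_ge0 := v0.
have vd0 : 0 <= v * del ^+ 2 by rewrite mulr_ge0// ltW.
have den : 0 < 1 + v + v * del ^+ 2 by lra.
have c0 : 0 < c by rewrite invr_gt0.
have c1 : c * (1 + v + v * del ^+ 2) = 1 by rewrite mulVf// gt_eqF.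
have := step (c * del).
pose x := (c * del) ^+ 2 * v / 2; rewrite -/x.
have cv1 : c * v < 1.
  by rewrite -c1 ltr_pM2l//; lra.
have cv0 : 0 <= c * v by rewrite mulr_ge0// ltW.
have cvd1 : c * v * (c * del ^+ 2) <= 1.
  have c_le1 : c <= 1.
    by rewrite invf_le1//; lra.
  have : c * (v * del ^+ 2) <= 1.
    by rewrite -c1 ler_pM2l//; lra.
  nra.
have xE : x = c * v * (c * del ^+ 2) / 2 by rewrite /x; ring.
have ex : expR x * (1 - x) <= 1.
  rewrite -[leRHS]mulr1 -[X in _ <= 1 * X](mulrV (_ : expR x \is a GRing.unit)) ?unitfE ?gt_eqF ?expR_gt0//.
  by rewrite mul1r ler_pM2l ?expR_gt0// -expRN expR_ge1Dx.
have cd0 : 0 < c * del ^+ 2 by rewrite mulr_gt0.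
have -> : c * del * del = c * del ^+ 2 by ring.
have x1 : 0 < 1 - x by rewrite xE; lra.
move=> h.
have : (1 + c * del ^+ 2) * (1 - x) <= 1.
  by rewrite (le_trans _ ex)// ler_wpM2r// ltW.
rewrite xE; move: cd0 cvd1 cv1 cv0.
move: (c * del ^+ 2) (c * v) => p q p0 pq q1 q0.
have -> : (1 + p) * (1 - q * p / 2) = 1 + p * (1 - (q + q * p) / 2) by field.
apply/negP; rewrite -ltNge ltrDl mulr_gt0//; lra.
Qed.

(** With h = (1 - c^-2) / (2 v) the expectation of exp (h Z^2) is c, and it is at least 1 + h
    E(Z^2). Values c > 1 thus bound the second moment from above and values c < 1, where h < 0, from
    below; both bounds tend to [v] as c tends to 1. *)
Lemma gaussian_sqr : m = 0 -> (\int[P]_w (Z w ^+ 2)%:E = v%:E)%E.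
Proof.
move=> m0.
have mZ2 : measurable_fun [set: T] (fun w => (Z w ^+ 2)%:E).
  by apply/measurable_EFinP; exact: measurable_funX.
have [v_eq0|vN0] := eqVneq v 0.
  rewrite (@gaussian_integral (fun x => x ^+ 2)).
  - by rewrite /normal_mean v_eq0 eqxx m0 expr0n.
  - exact: measurable_funX.
  - by move=> x; exact: sqr_ge0.
pose s := Num.sqrt v.
have s_neq0 : s != 0 := s0 vN0.
have s2 : s ^+ 2 = v by rewrite sqr_sqrtr.
have v_gt0 : 0 < v by rewrite lt_neqAle eq_sym vN0.
have Eexp c : 0 < c ->
    (\int[P]_w (expR ((1 - c ^- 2) / (v *+ 2) * Z w ^+ 2))%:E = c%:E)%E.
  move=> c0; rewrite (@gaussian_integral
    (fun x => expR ((1 - c ^- 2) / (v *+ 2) * x ^+ 2))).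
  - rewrite /normal_mean (negbTE vN0) m0.
    under eq_integral => x _.
      rewrite -[in X in expR X]s2 (expR_sqr_normal_pdf _ s_neq0 c0) EFinM; over.
    rewrite ge0_integralZl//.
    + by rewrite integral_normal_pdf mule1.
    + by apply/measurable_EFinP; exact: measurable_normal_pdf.
    + by move=> x _; rewrite lee_fin normal_pdf_ge0.
    + by rewrite lee_fin ltW.
  - apply: measurableT_comp => //; apply: measurable_funM => //.
  - by move=> x; exact: expR_ge0.
have mexp c : measurable_fun [set: T]
    (fun w => (expR ((1 - c ^- 2) / (v *+ 2) * Z w ^+ 2))%:E).
  apply/measurable_EFinP/measurableT_comp => //; apply: measurable_funM => //.
  exact: measurable_funX.
pose I := (\int[P]_w (Z w ^+ 2)%:E)%E.
have I0 : (0 <= I)%E by apply: integral_ge0 => w _; rewrite lee_fin sqr_ge0.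
have up c : 1 < c -> (1 + ((1 - c ^- 2) / (v *+ 2))%:E * I <= c%:E)%E.
  move=> c1; have c0 : 0 < c by rewrite (lt_trans _ c1).
  have h0 : 0 <= (1 - c ^- 2) / (v *+ 2).
    rewrite divr_ge0 ?mulrn_wge0// subr_ge0 invf_le1 ?exprn_gt0//.
    by rewrite exprn_ege1// ltW.
  rewrite -(Eexp _ c0) -ge0_integralZl//; last by move=> w _; rewrite lee_fin sqr_ge0.
  rewrite -[X in (X + _)%E](_ : \int[P]_w (1%E) = 1)%E; last first.
    by rewrite integral_cst//= probability_setT mule1.
  rewrite -ge0_integralD//=.
  - apply: ge0_le_integral => //=.
    + by move=> w _; rewrite adde_ge0// mule_ge0 ?lee_fin ?sqr_ge0.
    + by apply: emeasurable_funD => //; exact: measurable_funeM.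
    + by move=> w _; rewrite lee_fin expR_ge1Dx.
  - by move=> w _; rewrite mule_ge0 ?lee_fin ?sqr_ge0.
  - exact: measurable_funeM.
have lo c : 0 < c -> c < 1 -> (1 <= c%:E + (- ((1 - c ^- 2) / (v *+ 2)))%:E * I)%E.
  move=> c0 c1.
  have h0 : 0 <= - ((1 - c ^- 2) / (v *+ 2)).
    rewrite -mulNr opprB divr_ge0 ?mulrn_wge0// subr_ge0 invf_ge1 ?exprn_gt0//.
    by rewrite exprn_ile1// ltW.
  rewrite -(Eexp _ c0) -ge0_integralZl//; last by move=> w _; rewrite lee_fin sqr_ge0.
  rewrite -[X in (X <= _)%E](_ : \int[P]_w (1%E) = 1)%E; last first.
    by rewrite integral_cst//= probability_setT mule1.
  rewrite -ge0_integralD//=.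
  - apply: ge0_le_integral => //=.
    + by apply: emeasurable_funD => //; exact: measurable_funeM.
    + move=> w _; rewrite -EFinM -EFinD lee_fin mulNr lerBrDr.
      exact: expR_ge1Dx.
  - by move=> w _; rewrite mule_ge0 ?lee_fin ?sqr_ge0.
  - exact: measurable_funeM.
have Ifin : I \is a fin_num.
  rewrite ge0_fin_numE//; have := up 2 (ltr1n _ 2); rewrite ltey.
  have h : 0 < (1 - 2 ^- 2) / (v *+ 2) :> R.
    by rewrite divr_gt0 ?mulrn_wgt0// subr_gt0 invf_lt1 ?exprn_gt0// exprn_egt1// ltr1n.
  apply: contraTN => /eqP ->.
  by rewrite gt0_muley ?lte_fin// addey// -ltNge ltry.
rewrite -/I -(fineK Ifin); congr (_%:E).
set J := fine I.
have IJ : I = J%:E by rewrite fineK.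
apply/eqP; rewrite eq_le; apply/andP; split.
- apply/ler_addgt0Pr => e e0.
  (* The bound at c = 1 + eta is at most v (1 + 2 eta), that is v + e. *)
  pose eta := e / (2 * v).
  have eta0 : 0 < eta by rewrite divr_gt0// mulr_gt0.
  have := up (1 + eta); rewrite ltrDl => /(_ eta0).
  rewrite IJ -EFinM -EFinD lee_fin.
  have c0 : 0 < 1 + eta by rewrite addr_gt0.
  have -> : e = 2 * eta * v by rewrite /eta; field; rewrite gt_eqF.
  move=> h.
  have : (2 * v * (1 + eta) ^+ 2) * (1 + (1 - (1 + eta) ^- 2) / (v *+ 2) * J)
     <= (2 * v * (1 + eta) ^+ 2) * (1 + eta).
    by rewrite ler_pM2l// mulr_gt0 ?mulr_gt0 ?exprn_gt0.
  have -> : (2 * v * (1 + eta) ^+ 2) * (1 + (1 - (1 + eta) ^- 2) / (v *+ 2) * J)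
    = 2 * v * (1 + eta) ^+ 2 + eta * (2 + eta) * J.
    by field; rewrite !gt_eqF.
  move=> {}h.
  have : eta * ((2 + eta) * J) <= eta * (2 * v * (1 + eta) ^+ 2) by nra.
  rewrite ler_pM2l// => {}h.
  have : (2 + eta) * J <= (2 + eta) * (v + 2 * eta * v) by nra.
  by rewrite ler_pM2l// addr_gt0.
- apply/ler_addgt0Pr => e e0.
  (* The cap 1/2 keeps c = 1 - eta positive. *)
  pose eta := Num.min (e / (2 * v)) 2^-1.
  have eta0 : 0 < eta by rewrite lt_min divr_gt0 ?mulr_gt0//= invr_gt0.
  have eta2 : eta <= 2^-1 by rewrite ge_min lexx orbT.
  have etae : 2 * eta * v <= e.
    have : eta <= e / (2 * v) by rewrite ge_min lexx.
    by rewrite ler_pdivlMr ?mulr_gt0// mulrCA mulrA.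
  have c0 : 0 < 1 - eta by lra.
  have := lo (1 - eta) c0; rewrite gtrBl => /(_ eta0).
  rewrite IJ -EFinM -EFinD lee_fin => h.
  have : (2 * v * (1 - eta) ^+ 2) * 1
     <= (2 * v * (1 - eta) ^+ 2) * (1 - eta + - ((1 - (1 - eta) ^- 2) / (v *+ 2)) * J).
    by rewrite ler_pM2l// mulr_gt0 ?mulr_gt0 ?exprn_gt0.
  have -> : (2 * v * (1 - eta) ^+ 2) * (1 - eta + - ((1 - (1 - eta) ^- 2) / (v *+ 2)) * J)
    = 2 * v * (1 - eta) ^+ 2 * (1 - eta) + eta * (2 - eta) * J.
    by field; rewrite !gt_eqF.
  move=> {}h.
  have : eta * (2 * v * (1 - eta) ^+ 2) <= eta * ((2 - eta) * J) by nra.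
  rewrite ler_pM2l// => {}h.
  have : (2 - eta) * v <= (2 - eta) * (J + 2 * eta * v) by nra.
  by rewrite ler_pM2l//; lra.
Qed.

End gaussian_moments.

(** * Powers that approximate a threshold *)

Section power_limits.
Variable R : realType.

Lemma bernoulli_ge (y : R) n : y <= 1 -> 1 - n%:R * y <= (1 - y) ^+ n.
Proof.
move=> y1; elim: n => [|n ih]; first by rewrite mul0r subr0 expr0.
have [ny|ny] := lerP (1 - n.+1%:R * y) 0.
  by rewrite (le_trans ny)// exprn_ge0// subr_ge0.
rewrite exprS; have [y0|y0] := lerP 0 y.
  have : (1 - y) * (1 - n%:R * y) <= (1 - y) * (1 - y) ^+ n.
    by rewrite ler_wpM2l// subr_ge0.
  apply: le_trans.
  have : 0 <= n%:R * y ^+ 2 by rewrite mulr_ge0// sqr_ge0.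
  by rewrite -natr1; nra.
have : (1 - y) * (1 - n%:R * y) <= (1 - y) * (1 - y) ^+ n.
  by rewrite ler_wpM2l// subr_ge0.
apply: le_trans.
have : 0 <= n%:R * y ^+ 2 by rewrite mulr_ge0// sqr_ge0.
by rewrite -natr1; nra.
Qed.

Lemma cvg_natr_geometric (r : R) : 0 <= r < 1 ->
  (fun n => n%:R * r ^+ n) @ \oo --> (0 : R).
Proof.
move=> /andP[r0 r1].
(* Since r <= s^2 with s < 1, one factor s^n absorbs [n] by Bernoulli's inequality and the other
   tends to 0. *)
pose s := (1 + Num.sqrt r) / 2.
have sr0 : 0 <= Num.sqrt r by exact: sqrtr_ge0.
have sr1 : Num.sqrt r < 1 by rewrite -[ltRHS]sqrtr1 ltr_sqrt.
have s0 : 0 < s by rewrite /s; lra.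
have s1 : s < 1 by rewrite /s; lra.
pose h := s^-1 - 1.
have h0 : 0 < h by rewrite subr_gt0 invf_gt1.
have rs : r <= s ^+ 2.
  rewrite -[r]sqr_sqrtr// lerXn2r ?nnegrE ?(ltW s0)//; rewrite /s; lra.
apply: (@squeeze_cvgr _ _ _ _ (cst 0) (fun n => h^-1 * s ^+ n)).
- near=> n; rewrite mulr_ge0 ?exprn_ge0//=.
  have : n%:R * s ^+ n <= h^-1.
    have := @bernoulli_ge (- h) n; rewrite opprK mulrN opprK.
    have -> : 1 + h = s^-1 by rewrite /h; ring.
    have h1 : - h <= 1 by lra.
    move=> /(_ h1); rewrite exprVn => bh.
    have sn0 : 0 < s ^+ n by rewrite exprn_gt0.
    have : (1 + n%:R * h) * s ^+ n <= 1.
      by rewrite -ler_pdivlMr// mul1r.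
    move=> bs; rewrite -(ler_pM2l h0) mulfV ?gt_eqF//.
    by rewrite (le_trans _ bs)//; nra.
  move=> nh; apply: (@le_trans _ _ (n%:R * s ^+ n * s ^+ n)).
    by rewrite -mulrA ler_wpM2l// -exprD addnn -mul2n exprM lerXn2r ?nnegrE ?exprn_ge0// ltW.
  by rewrite ler_wpM2r// exprn_ge0// ltW.
- exact: cvg_cst.
- rewrite -[X in _ --> X](mulr0 h^-1); apply: cvgMr; apply: cvg_expr.
  by rewrite ger0_norm// ltW.
Unshelve. all: by end_near. Qed.

(** Below 1/2, Bernoulli's inequality gives at least 1 - n (2 x)^n; from 1/2 on, the power is at
    most exp (- n (2 x)^n) <= exp (- n). The factor [n] in the exponent settles the threshold
    itself: with 2^n alone the limit at 1/2 would be 1/e. *)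
Lemma cvg_threshold (x : R) : 0 <= x <= 1 ->
  (fun n => (1 - x ^+ n) ^+ (n * 2 ^ n)) @ \oo --> (if x < 2^-1 then 1 else 0 : R).
Proof.
move=> /andP[x0 x1].
have xn0 n : 0 <= x ^+ n by rewrite exprn_ge0.
have xn1 n : x ^+ n <= 1 by rewrite exprn_ile1.
have y0 n : 0 <= 1 - x ^+ n by rewrite subr_ge0.
have y1 n : 1 - x ^+ n <= 1 by rewrite gerBl.
have [xlt|xge] := ltrP x (2^-1).
  apply: (@squeeze_cvgr _ _ _ _ (fun n => 1 - n%:R * (2 * x) ^+ n) (cst 1)).
  - near=> n; rewrite exprn_ile1// andbT.
    rewrite (le_trans _ (bernoulli_ge _ _))//.
    by rewrite natrM natrX exprMn mulrA.
  - rewrite -[X in _ --> X]subr0; apply: cvgB; first exact: cvg_cst.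
    by apply: cvg_natr_geometric; apply/andP; split; lra.
  - exact: cvg_cst.
have e1 : 0 <= expR (- 1 : R) < 1.
  by rewrite expR_ge0 -[ltRHS]expR0 ltr_expR ltrN10.
apply: (@squeeze_cvgr _ _ _ _ (cst 0) (fun n => (expR (- 1)) ^+ n)).
- near=> n; rewrite exprn_ge0//=.
  apply: (@le_trans _ _ (expR (- x ^+ n) ^+ (n * 2 ^ n))).
    rewrite lerXn2r ?nnegrE ?expR_ge0//.
    exact: expR_ge1Dx.
  rewrite mulnC exprM lerXn2r ?nnegrE ?exprn_ge0 ?expR_ge0//.
  rewrite -expRM_natl ler_expR mulrN lerN2 natrX -exprMn exprn_ege1//; lra.
- exact: cvg_cst.
- by apply: cvg_expr; rewrite ger0_norm; case/andP: e1.
Unshelve. all: by end_near. Qed.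

End power_limits.

(** The law of a sum of two independent centered Gaussians, tested against bounded functions.
    Boundedness makes the inner integral finite, so that, as a real function of the first variable,
    it can be integrated by [gaussian_integral] again; a null variance on either side is treated
    apart. *)
Lemma gaussian_indep_integral d1 d2 (T1 : measurableType d1)
    (T2 : measurableType d2) (R : realType)
    (P1 : probability T1 R) (P2 : probability T2 R)
    (A : T1 -> R) (B : T2 -> R) (v1 v2 M : R) (g : R -> R) :
    gaussian P1 A 0 v1 -> gaussian P2 B 0 v2 ->
    continuous g -> (forall x, 0 <= g x <= M) ->
  (\int[P1 \x P2]_w (g (A w.1 + B w.2))%:E = normal_mean 0 (v1 + v2) g)%E.
Proof.
move=> gA gB cg gM.
have [mA v10 _] := gA; have [mB v20 _] := gB.
have g0 x : 0 <= g x by case/andP: (gM x).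
have mg : measurable_fun [set: R] g by exact: continuous_measurable_fun.
rewrite fubini_tonelli1/=; last 2 first.
- apply/measurable_EFinP/measurableT_comp => //.
  by apply: measurable_funD; exact: measurableT_comp.
- by move=> w; rewrite lee_fin.
rewrite /fubini_F/=.
have cgc c : continuous (fun y => g (c + y)).
  by move=> y; apply: continuous_comp; [exact: cvgD (cvg_cst _) cvg_id|exact: cg].
have mgc c : measurable_fun [set: R] (fun y => g (c + y)).
  exact: continuous_measurable_fun.
under eq_integral => x _.
  rewrite (gaussian_integral gB (mgc (A x)))//; over.
pose psi c := normal_mean 0 v2 (fun y => g (c + y)).
have psi0 c : (0 <= psi c)%E.
  rewrite /psi/normal_mean; case: ifP => _; rewrite ?lee_fin//.
  by apply: integral_ge0 => y _; rewrite lee_fin mulr_ge0 ?normal_pdf_ge0.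
have psiM c : (psi c <= M%:E)%E.
  rewrite /psi -(gaussian_integral gB (mgc c))//.
  apply: (@le_trans _ _ (\int[P2]_w M%:E)%E).
    apply: ge0_le_integral => //=.
    - by move=> w _; rewrite lee_fin.
    - by apply/measurable_EFinP; exact: (measurableT_comp (mgc c) mB).
    - by move=> w _; rewrite lee_fin; case/andP: (gM (c + B w)).
  by rewrite integral_cst//= probability_setT mule1.
have psifin c : psi c \is a fin_num.
  by rewrite ge0_fin_numE// (le_lt_trans (psiM c))// ltry.
have mpsi : measurable_fun [set: R] psi.
  have [v2E|v2N] := eqVneq v2 0.
    have -> : psi = (fun c => (g (c + 0))%:E).
      by apply/funext => c; rewrite /psi/normal_mean v2E eqxx.
    apply/measurable_EFinP; apply: continuous_measurable_fun => c.
    by apply: continuous_comp; [exact: cvgD cvg_id (cvg_cst _)|exact: cg].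
  have -> : psi = (fun c => \int[lebesgue_measure]_y
      (g (c + y) * normal_pdf 0 (Num.sqrt v2) y)%:E)%E.
    by apply/funext => c; rewrite /psi/normal_mean (negbTE v2N).
  apply: (@measurable_fun_fubini_tonelli_F _ _ _ _ _ lebesgue_measure
    (fun p : R * R => (g (p.1 + p.2) * normal_pdf 0 (Num.sqrt v2) p.2)%:E)).
  - apply/measurable_EFinP; apply: measurable_funM.
      apply: measurableT_comp => //; apply: measurable_funD => //.
    apply: measurableT_comp => //; exact: measurable_normal_pdf.
  - by move=> p; rewrite lee_fin mulr_ge0 ?normal_pdf_ge0.
have mfpsi : measurable_fun [set: R] (fine \o psi) by exact: measurableT_comp.
transitivity (\int[P1]_w ((fine \o psi) (A w))%:E)%E.
  by apply: eq_integral => w _; rewrite /= fineK.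
rewrite (gaussian_integral gA mfpsi); last by move=> x /=; rewrite fine_ge0.
rewrite /normal_mean; case: (eqVneq v1 0) => [->|v1N0].
  rewrite add0r /= fineK// /psi/normal_mean; case: ifP => _.
    by rewrite addr0.
  by under eq_integral do rewrite add0r.
have s1N0 : Num.sqrt v1 != 0.
  by rewrite sqrtr_eq0 -ltNge lt_neqAle eq_sym v1N0.
have -> : (v1 + v2 == 0) = false.
  by rewrite paddr_eq0// (negbTE v1N0).
under eq_integral => x _ do rewrite EFinM /= fineK//.
rewrite /psi/normal_mean; case: (eqVneq v2 0) => [->|v2N0].
  by under eq_integral do rewrite addr0 -EFinM; rewrite addr0.
have s2N0 : Num.sqrt v2 != 0.
  by rewrite sqrtr_eq0 -ltNge lt_neqAle eq_sym v2N0.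
rewrite -(@integral_normal_conv _ (Num.sqrt v1) (Num.sqrt v2))//.
- by apply: eq_integral => x _; rewrite muleC.
- by rewrite sqrtr_gt0 ltr_pwDl// lt_neqAle eq_sym v1N0.
- by rewrite !sqr_sqrtr// addr_ge0.
Qed.

(** * Cramer-Wold and Fernique *)

Section equal_trigonometric_moments.
Context d1 d2 (T1 : measurableType d1) (T2 : measurableType d2) (R : realType).
Variables (P1 : probability T1 R) (P2 : probability T2 R).
Variables (I : finType) (xi : I -> T1 -> R) (eta : I -> T2 -> R).
Hypothesis mxi : forall i, measurable_fun [set: T1] (xi i).
Hypothesis meta : forall i, measurable_fun [set: T2] (eta i).
Hypothesis cos_eq : forall (a : I -> R) (c : R),
  (\int[P1]_w (cos (\sum_i a i * xi i w + c))%:E =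
   \int[P2]_w (cos (\sum_i a i * eta i w + c))%:E)%E.

Local Notation lin a z := (\sum_i a i * z i).

(** Boundedness is part of the definition so that the functions are integrable on both spaces and
    sums can be integrated termwise. *)
Definition agree (F : (I -> R) -> R) : Prop :=
  [/\ exists M, forall z, `|F z| <= M,
      measurable_fun [set: T1] (fun w => F (xi ^~ w)),
      measurable_fun [set: T2] (fun w => F (eta ^~ w)) &
      (\int[P1]_w (F (xi ^~ w))%:E = \int[P2]_w (F (eta ^~ w))%:E)%E].

Lemma bounded_integrable d (T : measurableType d) (P : probability T R)
    (f : T -> R) (M : R) : measurable_fun [set: T] f ->
  (forall w, `|f w| <= M) -> P.-integrable setT (fun w => (f w)%:E).
Proof.
move=> mf fM.
apply: (@le_integrable _ _ _ P setT measurableT (fun w => (f w)%:E) (cst M%:E)) => //=.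
- exact/measurable_EFinP.
- by move=> w _; rewrite lee_fin (le_trans (fM w))// ler_norm.
- exact: finite_measure_integrable_cst.
Qed.

Lemma agreeD F G a : agree F -> agree G -> agree (fun z => F z + a * G z).
Proof.
move=> [[M FM] F1 F2 FE] [[N GN] G1 G2 GE].
have FM1 w : `|F (xi^~ w)| <= M by [].
have FM2 w : `|F (eta^~ w)| <= M by [].
have GM1 w : `|G (xi^~ w)| <= N by [].
have GM2 w : `|G (eta^~ w)| <= N by [].
split.
- exists (M + `|a| * N) => z; rewrite (le_trans (ler_normD _ _))// lerD//.
  by rewrite normrM ler_wpM2l.
- by apply: measurable_funD => //; exact: measurable_funM.
- by apply: measurable_funD => //; exact: measurable_funM.
- under eq_integral do rewrite EFinD EFinM.
  under [RHS]eq_integral do rewrite EFinD EFinM.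
  have iF1 := bounded_integrable P1 F1 FM1.
  have iF2 := bounded_integrable P2 F2 FM2.
  have iG1 := bounded_integrable P1 G1 GM1.
  have iG2 := bounded_integrable P2 G2 GM2.
  rewrite integralD//=; last exact: integrableZl.
  rewrite integralD//=; last exact: integrableZl.
  by rewrite !integralZl// FE GE.
Qed.

Lemma agree_lim (Fn : nat -> (I -> R) -> R) F M : (forall n, agree (Fn n)) ->
  (forall n z, `|Fn n z| <= M) -> (forall z, Fn ^~ z @ \oo --> F z) -> agree F.
Proof.
move=> aF FnM cF.
have FM z : `|F z| <= M.
  apply: (@closed_cvg _ _ _ eventually_filter (Fn^~ z) [set x | `|x| <= M]
    _ _ (F z)) => //.
  - have -> : [set x : R | `|x| <= M] = `[- M, M]%classic.
      by apply/seteqP; split=> x /=; rewrite in_itv/= ler_norml.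
    exact: itv_closed.
  - by near=> n => /=.
have dct d (T : measurableType d) (P : probability T R) (z : T -> I -> R) :
    (forall n, measurable_fun setT (fun w => Fn n (z w))) ->
    measurable_fun setT (fun w => F (z w)) /\
    (fun n => \int[P]_w (Fn n (z w))%:E)%E @ \oo -->
      (\int[P]_w (F (z w))%:E)%E.
  move=> mFn.
  have mF : measurable_fun setT (fun w => F (z w)).
    by apply: (measurable_fun_cvg mFn) => w _; exact: cF.
  split => //.
  have H1 n : measurable_fun setT (fun w => (Fn n (z w))%:E).
    exact/measurable_EFinP.
  have H2 : measurable_fun setT (fun w => (F (z w))%:E).
    exact/measurable_EFinP.
  have H3 : {ae P, forall w, setT w -> (Fn n (z w))%:E @[n --> \oo] --> (F (z w))%:E}.
    by apply: aeW => w _; apply: cvg_EFin; [near=> n|exact: cF].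
  have H4 : P.-integrable setT (cst M%:E).
    exact: finite_measure_integrable_cst.
  have H5 : {ae P, forall w, forall n, setT w -> (`|(Fn n (z w))%:E| <= cst M%:E w)%E}.
    by apply: aeW => w n _; rewrite /= lee_fin.
  by have [] := dominated_convergence measurableT H1 H2 H3 H4 H5.
have [m1 c1] := dct _ _ P1 (fun w i => xi i w)
  (fun n => let: And4 _ h _ _ := aF n in h).
have [m2 c2] := dct _ _ P2 (fun w i => eta i w)
  (fun n => let: And4 _ _ h _ := aF n in h).
split => //; first by exists M.
move/cvg_lim : c1 => <-//; move/cvg_lim : c2 => <-//.
congr (lim (_ @ \oo)); apply/funext => n.
by case: (aF n).
Unshelve. all: by end_near. Qed.

Definition pcos (s : seq ((I -> R) * R)) (z : I -> R) : R :=
  \prod_(p <- s) cos (lin p.1 z + p.2).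

Lemma pcos_le1 s z : `|pcos s z| <= 1.
Proof.
rewrite /pcos; elim: s => [|p s ih]; first by rewrite big_nil normr1.
by rewrite big_cons normrM mulr_ile1// cos_max.
Qed.

(** Product-to-sum: cos A cos B is half the sum of cos (A + B) and cos (A - B), so a product of
    cosines reduces to single cosines. The induction carries one free cosine, into which each new
    factor is merged. *)
Lemma agree_pcos s : agree (pcos s).
Proof.
suff h : forall a c, agree (fun z => pcos s z * cos (lin a z + c)).
  have := h (fun=> 0) 0.
  suff -> : (fun z => pcos s z * cos (lin (fun=> 0) z + 0)) = pcos s by [].
  apply/funext => z; rewrite big1 ?addr0 ?cos0 ?mulr1// => i _.
  by rewrite mul0r.
elim: s => [|[b e] s ih] a c.
  have mlin d (T : measurableType d) (z : I -> T -> R) :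
      (forall i, measurable_fun setT (z i)) ->
      measurable_fun setT (fun w => pcos [::] (z ^~ w) * cos (lin a (z ^~ w) + c)).
    move=> mz.
    have -> : (fun w => pcos [::] (z ^~ w) * cos (lin a (z ^~ w) + c)) =
        (fun w => cos (lin a (z ^~ w) + c)).
      by apply/funext => w; rewrite /pcos big_nil mul1r.
    apply: measurableT_comp; first exact: (continuous_measurable_fun (@continuous_cos R)).
    by apply: measurable_funD => //; apply: measurable_sum => i; exact: measurable_funM.
  split; [|exact: mlin|exact: mlin|].
  - exists 1 => z; rewrite normrM mulr_ile1// ?pcos_le1//.
    exact: cos_max.
  - by under eq_integral do rewrite /pcos big_nil mul1r;
      under [RHS]eq_integral do rewrite /pcos big_nil mul1r.
(* [agreeD] scales only its second argument, so each half is obtained as F - F / 2. *)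
have := agreeD 1 (agreeD (- 2^-1) (ih (fun i => b i + a i) (e + c))
  (ih (fun i => b i + a i) (e + c))) (agreeD (- 2^-1) (ih (fun i => b i - a i) (e - c))
  (ih (fun i => b i - a i) (e - c))).
congr agree; apply/funext => z.
have linD : lin (fun i => b i + a i) z = lin b z + lin a z.
  by rewrite -big_split; apply: eq_bigr => i _; rewrite mulrDl.
have linB : lin (fun i => b i - a i) z = lin b z - lin a z.
  by rewrite -sumrB; apply: eq_bigr => i _; rewrite mulrBl.
rewrite linD linB /pcos big_cons/=.
have -> : lin b z + lin a z + (e + c) = (lin b z + e) + (lin a z + c) by ring.
have -> : lin b z - lin a z + (e - c) = (lin b z + e) - (lin a z + c) by ring.
by rewrite cosD cosB; field.
Qed.

(** Agreement of integrals is not preserved by products. Asking for it against every product of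
    cosines makes the multipliers below closed under sums, products and bounded limits, hence rich
    enough to contain indicators of half-spaces. *)
Definition tagree (F : (I -> R) -> R) : Prop :=
  forall s, agree (fun z => pcos s z * F z).

Definition multiplier (h : (I -> R) -> R) : Prop :=
  forall F, tagree F -> tagree (fun z => h z * F z).

Lemma tagree1 : tagree (fun=> 1).
Proof.
move=> s; have -> : (fun z => pcos s z * 1) = pcos s.
  by apply/funext => z; rewrite mulr1.
exact: agree_pcos.
Qed.

Lemma tagree_bounded F : tagree F -> exists M, forall z, `|F z| <= M.
Proof.
move=> /(_ [::])[[M FM] _ _ _]; exists M => z.
by have := FM z; rewrite /pcos big_nil mul1r.
Qed.

Lemma multiplierD h k a : multiplier h -> multiplier k ->
  multiplier (fun z => h z + a * k z).
Proof.
move=> mh mk F tF s; have := agreeD a (mh F tF s) (mk F tF s).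
by congr agree; apply/funext => z; ring.
Qed.

Lemma multiplier1 : multiplier (fun=> 1).
Proof.
move=> F tF; have -> : (fun z => 1 * F z) = F by apply/funext => z; rewrite mul1r.
exact: tF.
Qed.

Lemma multiplierM h k : multiplier h -> multiplier k ->
  multiplier (fun z => h z * k z).
Proof.
move=> mh mk F tF; have := mh _ (mk F tF).
by congr tagree; apply/funext => z; rewrite mulrA.
Qed.

Lemma multiplierX h n : multiplier h -> multiplier (fun z => h z ^+ n).
Proof.
move=> mh; elim: n => [|n ih].
  by under eq_fun do rewrite expr0; exact: multiplier1.
by under eq_fun do rewrite exprS; exact: multiplierM.
Qed.

Lemma multiplier_cos a c : multiplier (fun z => cos (lin a z + c)).
Proof.
move=> F tF s; have := tF ((a, c) :: s).
by congr agree; apply/funext => z; rewrite /pcos big_cons/=; ring.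
Qed.

Lemma multiplier_lim (hn : nat -> (I -> R) -> R) h :
  (forall n, multiplier (hn n)) -> (forall n z, `|hn n z| <= 1) ->
  (forall z, hn ^~ z @ \oo --> h z) -> multiplier h.
Proof.
move=> mh h1 ch F tF s.
have [M FM] := tagree_bounded tF.
apply: (@agree_lim (fun n z => pcos s z * (hn n z * F z)) _ M).
- by move=> n; exact: mh.
- move=> n z; rewrite !normrM -[leRHS]mul1r -[X in _ <= X * _]mulr1 -mulrA.
  by rewrite ler_pM ?mulr_ge0 ?pcos_le1// ler_pM.
- by move=> z; apply: cvgMr; apply: cvgMl; exact: ch.
Qed.

(* [(1 - u ^+ n) ^+ (n * 2 ^ n)] with [u = (1 + cos th) / (2 * (1 + cos w))]
   converges to the indicator of [cos th < cos w]. *)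
Lemma multiplier_cos_lt a c w : 0 <= w <= pi / 2 ->
  multiplier (fun z => if cos (lin a z + c) < cos w then 1 else 0).
Proof.
move=> /andP[w0 wpi].
have cw0 : 0 <= cos w.
  rewrite cos_ge0_pihalf// wpi andbT (le_trans _ w0)// oppr_le0.
  by rewrite divr_ge0// pi_ge0.
pose u z := (1 + cos (lin a z + c)) / (2 * (1 + cos w)).
have d0 : 0 < 2 * (1 + cos w) by lra.
have u0 z : 0 <= u z by rewrite divr_ge0 ?(ltW d0)// -lerBlDl sub0r cos_geN1.
have u1 z : u z <= 1.
  by rewrite ler_pdivrMr// mul1r; have := cos_le1 (lin a z + c); lra.
have mu : multiplier u.
  have := multiplierD (2 * (1 + cos w))^-1
    (multiplierD (- 1) multiplier1 multiplier1)
    (multiplierD 1 multiplier1 (multiplier_cos a c)).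
  by congr multiplier; apply/funext => z; rewrite /u mulrC; ring.
apply: (@multiplier_lim (fun n z => (1 - u z ^+ n) ^+ (n * 2 ^ n))).
- move=> n; apply: multiplierX.
  have := multiplierD (- 1) multiplier1 (multiplierX n mu).
  by congr multiplier; apply/funext => z; rewrite mulN1r.
- move=> n z; have h : 0 <= 1 - u z ^+ n <= 1.
    by rewrite subr_ge0 exprn_ile1//= gerBl exprn_ge0.
  case/andP: h => h0 h1.
  by rewrite ger0_norm ?exprn_ge0// exprn_ile1.
- move=> z; have := @cvg_threshold R (u z); rewrite u0 u1 => /(_ isT).
  suff -> : (u z < 2^-1) = (cos (lin a z + c) < cos w) by [].
  by rewrite ltr_pdivrMr// mulrA mulVf// mul1r ltrD2l.
Qed.

(** For large n, both the distance and [w], divided by [L n], lie in [0, pi], where the cosine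
    decreases: comparing cosines then compares the distance with [w]. The choice of [L n] keeps w /
    L n at most pi / 2. *)
Lemma multiplier_far a c w : 0 <= w ->
  multiplier (fun z => if w < `|lin a z - c| then 1 else 0).
Proof.
move=> w0.
pose L n : R := n.+1%:R + w.
have L0 n : 0 < L n by rewrite ltr_wpDr.
have wL n : 0 <= w / L n <= pi / 2.
  rewrite divr_ge0 ?(ltW (L0 n))//= ler_pdivrMr//.
  have : 1 <= pi / 2 :> R by rewrite ler_pdivlMr// mul1r pi_ge2.
  have : w <= L n by rewrite /L lerDr.
  have := L0 n; nra.
apply: (@multiplier_lim (fun n z =>
  if cos ((lin a z - c) / L n) < cos (w / L n) then 1 else 0)).
- move=> n; have := multiplier_cos_lt (fun i => a i / L n) (- c / L n) (wL n).
  congr multiplier; apply/funext => z.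
  have -> : lin (fun i => a i / L n) z + - c / L n = (lin a z - c) / L n.
    rewrite mulrBl mulr_suml mulNr; congr (_ - _).
    by apply: eq_bigr => i _; rewrite mulrAC.
  by [].
- by move=> n z; case: ifP; rewrite ?normr1 ?normr0.
- move=> z; apply: cvg_near_cst; near=> n.
  have nz : `|lin a z - c| <= n%:R.
    near: n; exact: nbhs_infty_ger.
  have xL : 0 <= `|lin a z - c| / L n <= pi.
    rewrite divr_ge0 ?(ltW (L0 n))//= ler_pdivrMr//.
    have : 2 <= pi :> R by exact: pi_ge2.
    have : `|lin a z - c| <= L n.
      by rewrite (le_trans nz)// /L -natr1 -addrA lerDl addr_ge0.
    have := L0 n; nra.
  have wLpi : 0 <= w / L n <= pi.
    case/andP: (wL n) => -> h /=; rewrite (le_trans h)//.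
    by rewrite ler_pdivrMr// ler_peMr ?pi_ge0// ler1n.
  rewrite -cos_norm normrM normfV (gtr0_norm (L0 n)).
  by rewrite ltr_cos ?in_itv//= ltr_pM2r// invr_gt0.
Unshelve. all: by end_near. Qed.

(** The half-line is the limit of the complements of the intervals [c, c + 2 n]. *)
Lemma multiplier_lt a c : multiplier (fun z => if lin a z < c then 1 else 0).
Proof.
apply: (@multiplier_lim (fun n z =>
  if n%:R < `|lin a z - (c + n%:R)| then 1 else 0)).
- by move=> n; exact: multiplier_far.
- by move=> n z; case: ifP; rewrite ?normr1 ?normr0.
- move=> z; apply: cvg_near_cst; near=> n.
  have nz : `|lin a z - c| <= n%:R.
    near: n; exact: nbhs_infty_ger.
  congr (if _ then _ else _).
  have [lc|lc] := ltrP (lin a z) c.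
    have h : n%:R < - (lin a z - (c + n%:R)) by lra.
    have n0 : 0 <= n%:R :> R by [].
    by rewrite ler0_norm ?h//; lra.
  have lc0 : 0 <= lin a z - c by lra.
  apply/negbTE; rewrite -leNgt ler_norml; move: nz; rewrite ger0_norm// => nz.
  by apply/andP; split; lra.
Unshelve. all: by end_near. Qed.

(** The boolean tells whether the strict inequality has to hold or to fail, so that one list mixes
    open half-spaces and closed ones. *)
Definition halfspaces (l : seq ((I -> R) * R * bool)) : set (I -> R) :=
  [set z | all (fun p => (lin p.1.1 z < p.1.2) == p.2) l].

Lemma tagree_halfspaces l :
  tagree (fun z => if `[< halfspaces l z >] then 1 else 0).
Proof.
elim: l => [|[[a c] b] l ih].
  have -> : (fun z => if `[< halfspaces [::] z >] then 1 else 0) = fun=> 1 :> R.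
    by apply/funext => z; rewrite asboolT.
  exact: tagree1.
have mb : multiplier (fun z => if (lin a z < c) == b then 1 else 0).
  case: b => /=.
    by under eq_fun do rewrite eqb_id; exact: multiplier_lt.
  have := multiplierD (- 1) multiplier1 (multiplier_lt a c).
  congr multiplier; apply/funext => z; rewrite eqbF_neg.
  by case: ifP => /= _; rewrite mulN1r ?subrr ?oppr0 ?addr0.
have := mb _ ih; congr tagree; apply/funext => z.
rewrite /halfspaces /=.
case: ifP => /= h; last by rewrite mul0r asboolF.
by rewrite mul1r; congr (if _ then _ else _); apply/idP/idP => /asboolP ?; apply/asboolP.
Qed.

(* Cramer-Wold: indicators of half-spaces are limits of trigonometric
   polynomials, whose integrals only involve laws of linear combinations. *)
Lemma halfspaces_probability l :
  P1 [set w | halfspaces l (xi ^~ w)] = P2 [set w | halfspaces l (eta ^~ w)].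
Proof.
have [_ m1 m2] := tagree_halfspaces l [::].
under eq_integral do rewrite /pcos big_nil mul1r.
under [in RHS]eq_integral do rewrite /pcos big_nil mul1r.
have key d (T : measurableType d) (P : probability T R) (z : T -> I -> R) :
  measurable_fun setT (fun w => pcos [::] (z w) * (if `[< halfspaces l (z w) >] then 1 else 0)) ->
  (\int[P]_w (if `[< halfspaces l (z w) >] then 1 else 0)%:E)%E = P [set w | halfspaces l (z w)].
  move=> mf.
  have mA : measurable [set w | halfspaces l (z w)].
    have := mf measurableT [set 1] (measurable_set1 1).
    rewrite setTI; congr measurable; apply/seteqP; split=> w /=; rewrite /pcos big_nil mul1r.
      by case: asboolP => // _ /esym/eqP; rewrite oner_eq0.
    by move=> h; rewrite asboolT.
  rewrite -(setIT [set w | _]) -integral_indic//; apply: eq_integral => w _.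
  rewrite indicE; case: asboolP => h.
    by rewrite mem_set.
  by rewrite memNset.
by rewrite !key.
Qed.

End equal_trigonometric_moments.

Lemma measure_bigsetU_seq_le d (T : measurableType d) (R : realType)
    (mu : {measure set T -> \bar R}) (J : Type) (s : seq J) (A : J -> set T) :
  (forall j, measurable (A j)) ->
  (mu (\big[setU/set0]_(j <- s) A j) <= \sum_(j <- s) mu (A j))%E.
Proof.
move=> mA; elim: s => [|j s ih]; first by rewrite !big_nil measure0.
rewrite !big_cons; apply: (@le_trans _ _ (mu (A j) + mu (\big[setU/set0]_(i <- s) A i))%E).
- by apply: measureU2 => //; exact: bigsetU_measurable.
- exact: leeD2l.
Qed.

Lemma measure_bigsetU_seq d (T : measurableType d) (R : realType)
    (mu : {measure set T -> \bar R}) (J : choiceType) (s : seq J) (A : J -> set T) :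
  (forall j, measurable (A j)) -> uniq s ->
  (forall i j, i != j -> A i `&` A j = set0) ->
  (mu (\big[setU/set0]_(j <- s) A j) = \sum_(j <- s) mu (A j))%E.
Proof.
move=> mA + dA; elim: s => [|j s ih]; first by rewrite !big_nil measure0.
rewrite !big_cons/= => /andP[js us]; rewrite measureU//.
- by congr (_ + _)%E; exact: ih.
- exact: bigsetU_measurable.
- apply/seteqP; split=> // w [Ajw].
  rewrite -bigcup_seq => -[k /= ks Akw].
  have jk : j != k by apply: contraNneq js => ->.
  by have : (A j `&` A k) w by []; rewrite dA.
Qed.

Lemma measurable_halfspaces d (T : measurableType d) (R : realType)
    (I : finType) (z : I -> T -> R) l :
  (forall i, measurable_fun [set: T] (z i)) ->
  measurable [set w | halfspaces l (z ^~ w)].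
Proof.
move=> mz; elim: l => [|[[a c] b] l ih].
  by rewrite (_ : [set w | _] = setT)//; apply/seteqP; split.
have mlin : measurable_fun [set: T] (fun w => \sum_i a i * z i w).
  by apply: measurable_sum => i; exact: measurable_funM.
have -> : [set w | halfspaces ((a, c, b) :: l) (z ^~ w)] =
    [set w | (\sum_i a i * z i w < c) == b] `&` [set w | halfspaces l (z ^~ w)].
  apply/seteqP; split=> w; rewrite /halfspaces/=.
    by move/andP.
  by move=> [? ?]; apply/andP.
apply: measurableI => //.
have mlt : measurable [set w | \sum_i a i * z i w < c].
  have := mlin measurableT `]-oo, c[%classic (measurable_itv _).
  by rewrite setTI; congr measurable; apply/seteqP; split => w /=; rewrite in_itv.
case: b => /=.
  by under eq_set do rewrite eqb_id.
have -> : [set w | (\sum_i a i * z i w < c) == false] =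
    ~` [set w | \sum_i a i * z i w < c].
  by apply/seteqP; split=> w /=; rewrite eqbF_neg => /negP.
exact: measurableC.
Qed.

(** * Concentration of the maximum of a Gaussian vector *)

Section gaussian_concentration.
Context d (T : measurableType d) (R : realType) (P : probability T R).
Variables (n : nat) (V : 'I_n -> T -> R) (C : 'I_n -> 'I_n -> R).
Hypothesis gV : forall a : 'I_n -> R,
  gaussian P (fun w => \sum_i a i * V i w) 0
    (\sum_i \sum_j a i * a j * C i j).

Local Notation I := (bool * 'I_n)%type.
Local Notation lin a z := (\sum_(p : I) a p * z p).
Local Notation Q := (P \x P)%E.

Let sum_boolE (F : I -> R) :
  \sum_p F p = \sum_i F (true, i) + \sum_i F (false, i).
Proof.
rewrite (eq_bigr (fun p => F (p.1, p.2))); last by case.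
by rewrite -(pair_bigA _ (fun b i => F (b, i)))/= big_bool.
Qed.

Lemma gaussian_coordinate a i : gaussian P (fun w => a * V i w) 0 (a ^+ 2 * C i i).
Proof.
have := gV (fun j => if j == i then a else 0).
congr (gaussian P _ _ _).
- apply/funext => w; rewrite (bigD1 i)//= eqxx big1 ?addr0// => j /negbTE ->.
  by rewrite mul0r.
- rewrite (bigD1 i)//= (bigD1 i)//= eqxx big1 ?addr0; last first.
    by move=> j /negbTE ->; rewrite mulr0 mul0r.
  rewrite big1 ?addr0// => j /negbTE ->; rewrite big1// => k _.
  by rewrite !mul0r.
Qed.

Let mV i : measurable_fun [set: T] (V i).
Proof.
have [m _ _] := gaussian_coordinate 1 i.
by move: m; congr measurable_fun; apply/funext => w; rewrite mul1r.
Qed.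

Let pr (b : bool) (w : T * T) := if b then w.1 else w.2.
Let eta (p : I) (w : T * T) : R := V p.2 (pr p.1 w).
(** [true] labels the normalized sum of the two independent copies, [false] their normalized
    difference; [eta] labels the copies before rotation. *)
Let xi (p : I) (w : T * T) : R :=
  (V p.2 w.1 + (-1) ^+ (~~ p.1) * V p.2 w.2) / Num.sqrt 2.

Let meta p : measurable_fun [set: T * T] (eta p).
Proof.
by case: p => -[] i; [exact: (measurableT_comp (mV i) measurable_fst)|
  exact: (measurableT_comp (mV i) measurable_snd)].
Qed.

Let mxi p : measurable_fun [set: T * T] (xi p).
Proof.
apply: measurable_funM => //; apply: measurable_funD.
  exact: (measurableT_comp (mV _) measurable_fst).
apply: measurable_funM => //.
exact: (measurableT_comp (mV _) measurable_snd).
Qed.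

(** The two families of weights enter only through the sum of their quadratic forms. The function
    [1 + cos] replaces the cosine because [gaussian_indep_integral] takes nonnegative functions; 1
    is subtracted at the end. *)
Let integral_cos_prod (a b : 'I_n -> R) (c : R) :
  (\int[Q]_w (cos (\sum_i a i * V i w.1 + \sum_i b i * V i w.2 + c))%:E =
   normal_mean 0 (\sum_i \sum_j (a i * a j + b i * b j) * C i j)
     (fun x => (1 + cos (x + c))%R) - 1)%E.
Proof.
pose g x := 1 + cos (x + c).
have cg : continuous g.
  move=> x; apply: cvgD; first exact: cvg_cst.
  apply: continuous_comp; last exact: continuous_cos.
  exact: cvgD cvg_id (cvg_cst _).
have gM x : 0 <= g x <= 2.
  by rewrite -lerBlDl sub0r cos_geN1/= /g; have := cos_le1 (x + c); lra.
have gE := gaussian_indep_integral (gV a) (gV b) cg gM.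
have vE : (\sum_i \sum_j (a i * a j + b i * b j) * C i j) =
   (\sum_i \sum_j a i * a j * C i j) + (\sum_i \sum_j b i * b j * C i j).
  rewrite -big_split; apply: eq_bigr => i _; rewrite -big_split.
  by apply: eq_bigr => j _; rewrite mulrDl.
rewrite vE -gE.
pose Z w := g (\sum_i a i * V i w.1 + \sum_i b i * V i w.2).
have mZ : measurable_fun [set: T * T] Z.
  apply: measurableT_comp; first exact: continuous_measurable_fun.
  apply: measurable_funD; apply: measurable_sum => i; apply: measurable_funM => //.
    exact: (measurableT_comp (mV _) measurable_fst).
  exact: (measurableT_comp (mV _) measurable_snd).
have iZ : Q.-integrable setT (EFin \o Z).
  apply: (@bounded_integrable _ _ _ Q Z 2) => // w.
  by case/andP: (gM (\sum_i a i * V i w.1 + \sum_i b i * V i w.2)) => h1 h2; rewrite ger0_norm.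
have Zfin : (\int[Q]_w (Z w)%:E)%E \is a fin_num by exact: integrable_fin_num.
have := @integral_affine _ _ _ Q Z (- 1) 1 (fine (\int[Q]_w (Z w)%:E)%E) iZ.
rewrite fineK// => /(_ erefl).
rewrite mul1r addrC EFinB fineK// => <-.
by apply: eq_integral => w _; rewrite /Z/g mul1r addKr.
Qed.

Let sq2 : Num.sqrt 2 * Num.sqrt 2 = 2 :> R.
Proof. by rewrite -expr2 sqr_sqrtr. Qed.

(** Replacing weights a, b by (a + b) / sqrt 2 and (a - b) / sqrt 2 preserves the sums a a' + b b',
    all that [integral_cos_prod] sees. *)
Let cos_eq (a : I -> R) (c : R) :
  (\int[Q]_w (cos (\sum_p a p * xi p w + c))%:E =
   \int[Q]_w (cos (\sum_p a p * eta p w + c))%:E)%E.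
Proof.
have sqN0 : Num.sqrt 2 != 0 :> R by rewrite gt_eqF.
have etaE w : \sum_p a p * eta p w =
  \sum_i a (true, i) * V i w.1 + \sum_i a (false, i) * V i w.2.
  by rewrite sum_boolE.
have xiE w : \sum_p a p * xi p w =
  \sum_i ((a (true, i) + a (false, i)) / Num.sqrt 2) * V i w.1 +
  \sum_i ((a (true, i) - a (false, i)) / Num.sqrt 2) * V i w.2.
  rewrite sum_boolE -!big_split; apply: eq_bigr => i _ /=.
  by rewrite /xi/= expr0 expr1; field.
under eq_integral do rewrite xiE.
under [RHS]eq_integral do rewrite etaE.
rewrite (integral_cos_prod
  (fun i => (a (true, i) + a (false, i)) / Num.sqrt 2)
  (fun i => (a (true, i) - a (false, i)) / Num.sqrt 2) c).
rewrite (integral_cos_prod (fun i => a (true, i)) (fun i => a (false, i)) c).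
have halves (x y z t : R) : (x + y) / Num.sqrt 2 * ((z + t) / Num.sqrt 2) +
   (x - y) / Num.sqrt 2 * ((z - t) / Num.sqrt 2) = x * z + y * t.
  transitivity ((2 * x * z + 2 * y * t) / (Num.sqrt 2 * Num.sqrt 2)).
    by field.
  by rewrite sq2; field.
rewrite [X in normal_mean _ X](_ : _ = \sum_i \sum_j
   (a (true, i) * a (true, j) + a (false, i) * a (false, j)) * C i j)//.
by apply: eq_bigr => i _; apply: eq_bigr => j _; rewrite halves.
Qed.

Let sg (b : bool) : R := (-1) ^+ b.

(* [j] is the first signed coordinate at which [max_i |u_i|] is attained. *)
Let amax (j : I) (u : 'I_n -> R) := forall k : I,
  if (enum_rank k < enum_rank j)%N then sg k.1 * u k.2 < sg j.1 * u j.2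
  else sg k.1 * u k.2 <= sg j.1 * u j.2.

Let amax_ex (j0 : I) u : exists j, amax j u.
Proof.
pose F (k : I) := sg k.1 * u k.2.
have [m _ mP] := @arg_maxP _ _ _ j0 xpredT F isT.
have [j /eqP jm jP] := @arg_minnP _ m (fun k => F k == F m) enum_rank (eqxx _).
exists j => k; rewrite -/(F k) -/(F j) jm; case: ifPn => kj; last exact: mP.
have kmF : F k <= F m := mP k isT.
rewrite lt_neqAle kmF andbT; apply: contraTN kj => /jP.
by rewrite -leqNgt.
Qed.

(** Ties are broken by the enumeration; as a consequence the probabilities of these events add up to
    at most 1. *)
Let amax_disj i j : i != j -> [set w | amax i (V ^~ w)] `&`
  [set w | amax j (V ^~ w)] = set0.
Proof.
move=> ij; apply/seteqP; split=> // w [/= Ai Aj].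
have /orP[h|h] : ((enum_rank i < enum_rank j) || (enum_rank j < enum_rank i))%N.
  by rewrite -neq_ltn; apply: contraNneq ij => /val_inj/enum_rank_inj ->.
- have := Aj i; have := Ai j; rewrite h ltnNge (ltnW h)/=.
  by move=> /le_lt_trans h1 /h1; rewrite ltxx.
- have := Ai j; have := Aj i; rewrite h ltnNge (ltnW h)/=.
  by move=> /le_lt_trans h1 /h1; rewrite ltxx.
Qed.

Let single (b : bool) (k : I) : I -> R :=
  fun p => if p == (b, k.2) then sg k.1 else 0.

Let singleE b k z : lin (single b k) z = sg k.1 * z (b, k.2).
Proof.
rewrite (bigD1 (b, k.2))//= /single eqxx big1 ?addr0// => p /negbTE ->.
by rewrite mul0r.
Qed.

(** [amax j] as constraints on the [true] block: a strict comparison is a half-space condition that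
    holds, a weak one is the failure of the reversed strict comparison. *)
Let conds (j : I) : seq ((I -> R) * R * bool) :=
  [seq (if (enum_rank k < enum_rank j)%N then
          ((fun p => single true k p - single true j p), 0, true)
        else ((fun p => single true j p - single true k p), 0, false))
   | k : I].

Let condsP j z : halfspaces (conds j) z <-> amax j (fun i => z (true, i)).
Proof.
have linB k l : lin (fun p => single true k p - single true l p) z =
    sg k.1 * z (true, k.2) - sg l.1 * z (true, l.2).
  by rewrite -!singleE -sumrB; apply: eq_bigr => p _; rewrite mulrBl.
rewrite /halfspaces/= /conds all_map; split.
- move=> /allP h k; have := h k; rewrite mem_enum => /(_ isT) /=.
  case: ifP => _ /=; rewrite linB subr_lt0; first by move/eqP.
  by rewrite eqbF_neg -leNgt.
- move=> h; apply/allP => k _ /=; have := h k.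
  case: ifP => _ /=; rewrite linB subr_lt0; first by move=> ->.
  by rewrite eqbF_neg -leNgt.
Qed.

(** If |U_i| > r and all |V_k| <= m, the signed maximum of U + V exceeds r - m; at the index j where
    it is attained, U - V with the same sign exceeds r - 3 m. After rotation the sum selects j and
    the difference is independent of it, so the bound is a sum over j of the probability that j is
    selected times a Gaussian tail at (r - 3 m) / sqrt 2. The selection events being disjoint, no
    factor depends on [n]. *)
Lemma fernique (s2 r m : R) : 0 < s2 -> (forall i, C i i <= s2) -> 3 * m <= r ->
  (P [set w | exists i, (r < `|V i w|)%R] *
   P [set w | forall i, (`|V i w| <= m)%R] <=
   (expR (- ((r - 3 * m) ^+ 2 / (4 * s2))))%:E)%E.
Proof.
move=> s2_gt0 Cs2 mr.
pose s := (r - 3 * m) / Num.sqrt 2.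
have s0 : 0 <= s by rewrite divr_ge0 ?subr_ge0// ltW.
have mA1 : measurable [set w | exists i, (r < `|V i w|)%R].
  have -> : [set w | exists i, (r < `|V i w|)%R] =
      \bigcup_i [set w | r < `|V i w|].
    by apply/seteqP; split=> w /= [i] => [h|_ h]; exists i.
  apply: fin_bigcup_measurable => [|i _]; first exact: finite_finset.
  have mN : measurable_fun [set: T] (fun w => `|V i w|) by exact: measurableT_comp.
  have := mN measurableT `]r, +oo[%classic (measurable_itv _).
  by rewrite setTI; congr measurable; apply/seteqP; split=> w /=; rewrite in_itv/= andbT.
have mA2 : measurable [set w | forall i, (`|V i w| <= m)%R].
  have -> : [set w | forall i, (`|V i w| <= m)%R] =
      \bigcap_i [set w | `|V i w| <= m].
    by apply/seteqP; split=> w /= h i => [_|]; exact: h.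
  apply: fin_bigcap_measurable => [|i _]; first exact: finite_finset.
  have mN : measurable_fun [set: T] (fun w => `|V i w|) by exact: measurableT_comp.
  have := mN measurableT `]-oo, m]%classic (measurable_itv _).
  by rewrite setTI; congr measurable; apply/seteqP; split=> w /=; rewrite in_itv.
rewrite -product_measure1E//.
(* Selection of [j] by the rotated sums, together with a rotated difference of at least [s] at [j],
   with its sign. *)
pose L j := rcons (conds j) (single false j, s, false).
have LP j z : halfspaces (L j) z <->
    amax j (fun i => z (true, i)) /\ s <= sg j.1 * z (false, j.2).
  rewrite -condsP /halfspaces/= /L all_rcons/= singleE eqbF_neg -leNgt.
  by split=> [/andP[]|[-> ->]].
have mxiL j : measurable [set w | halfspaces (L j) (xi ^~ w)].
  exact: measurable_halfspaces.
apply: (@le_trans _ _ (Q (\big[setU/set0]_(j <- enum [set: I])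
    [set w | halfspaces (L j) (xi ^~ w)]))).
  apply: le_measure; rewrite ?inE.
  - exact: measurableX.
  - exact: bigsetU_measurable.
  move=> [w1 w2] [/= [i ri] Vm].
  have [j Aj] := amax_ex (true, i) (fun i => xi (true, i) (w1, w2)).
  rewrite -bigcup_seq; exists j; first by rewrite /= mem_enum inE.
  apply/LP; split => //.
  have [b bE] : exists b, `|V i w1| = sg b * V i w1.
    have [h|h] := leP 0 (V i w1).
      by exists false; rewrite ger0_norm// /sg expr0 mul1r.
    by exists true; rewrite ltr0_norm// /sg expr1 mulN1r.
  have sgV c k : sg c * V k w2 <= m.
    rewrite (le_trans (ler_norm _))// normrM normrX normrN1 expr1n mul1r.
    exact: Vm.
  have sgVN c k : - m <= sg c * V k w2.
    rewrite lerNl -mulNr; have -> : - sg c = sg (~~ c).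
      by rewrite /sg; case: c; rewrite /= ?expr1 ?expr0 ?opprK.
    exact: sgV.
  have : sg b * xi (true, i) (w1, w2) <= sg j.1 * xi (true, j.2) (w1, w2).
    by have := Aj (b, i); case: ifP => _ // /ltW.
  rewrite /xi/= expr0 mul1r expr1 mulN1r !mulrA ler_pM2r ?invr_gt0//.
  rewrite ler_pM2r ?invr_gt0// !mulrDr -bE mulrN => h.
  by have := sgVN b i; have := sgV j.1 j.2; lra.
apply: le_trans.
  by apply: measure_bigsetU_seq_le.
(* Under the law of [eta] the two blocks are the two coordinates of the product space, so the
   probability factors. *)
have HE j : Q [set w | halfspaces (L j) (xi ^~ w)] =
    (P [set w | amax j (V ^~ w)] * P [set w | (s <= sg j.1 * V j.2 w)%R])%E.
  rewrite (halfspaces_probability mxi meta cos_eq).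
  have mam : measurable [set w | amax j (V ^~ w)].
    have := @measurable_halfspaces _ _ _ _ (fun p : I => V p.2) (conds j) (fun p => mV p.2).
    by congr measurable; apply/seteqP; split=> w /=;
      [move/(condsP j (fun p => V p.2 w)).1|move/(condsP j (fun p => V p.2 w)).2].
  have ms : measurable [set w | s <= sg j.1 * V j.2 w].
    have mN : measurable_fun [set: T] (fun w => sg j.1 * V j.2 w) by exact: measurable_funM.
    have := mN measurableT `[s, +oo[%classic (measurable_itv _).
    by rewrite setTI; congr measurable; apply/seteqP; split=> w /=; rewrite in_itv/= andbT.
  rewrite -product_measure1E//; congr (Q _).
  by apply/seteqP; split => -[w1 w2] h;
    have [h1 h2] := LP j (eta ^~ (w1, w2)); [exact: h1|exact: h2].
apply: (@le_trans _ _ (\sum_(j <- enum [set: I])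
   (P [set w | amax j (V ^~ w)] * (expR (- ((r - 3 * m) ^+ 2 / (4 * s2))))%:E))%E).
  apply: lee_sum => j _.
  apply: (@le_trans _ _ (P [set w | amax j (V ^~ w)] *
      P [set w | (s <= sg j.1 * V j.2 w)%R])%E).
    by rewrite -HE; exact: lexx.
  rewrite lee_wpmul2l//.
  apply: le_trans.
    apply: (gaussian_chernoff (gaussian_coordinate (sg j.1) j.2) s0 s2_gt0) => //.
    by rewrite /sg -exprM mulnC exprM sqrrN expr1n expr1n mul1r.
  rewrite lee_fin ler_expR lerN2 /s.
  rewrite expr_div_n sqr_sqrtr//.
  rewrite le_eqVlt; apply/orP; left; apply/eqP; field.
  by rewrite gt_eqF.
rewrite -ge0_sume_distrl; last by move=> *; exact: measure_ge0.
rewrite -[leRHS]mul1e lee_wpmul2r ?lee_fin ?expR_ge0//.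
have mam j : measurable [set w | amax j (V ^~ w)].
  have := @measurable_halfspaces _ _ _ _ (fun p : I => V p.2) (conds j) (fun p => mV p.2).
  by congr measurable; apply/seteqP; split=> w /=;
      [move/(condsP j (fun p => V p.2 w)).1|move/(condsP j (fun p => V p.2 w)).2].
rewrite -measure_bigsetU_seq//.
- by apply: probability_le1; exact: bigsetU_measurable.
- exact: enum_uniq.
Qed.

End gaussian_concentration.

(** * Finite linear combinations and quadratic forms *)

Section finite_combinations.
Variable R : realType.

Definition comb (I : Type) (s : seq (R * I)) (f : I -> R) : R :=
  \sum_(p <- s) p.1 * f p.2.

(** The bilinear form of the kernel on finitely supported signed measures; the first list feeds the
    second argument of [q]. *)
Definition quad (I : Type) (q : I -> I -> R) (s s' : seq (R * I)) : R :=
  comb s (fun u => comb s' (fun t => q t u)).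

Definition scal (I : Type) (a : R) (s : seq (R * I)) : seq (R * I) :=
  [seq (a * p.1, p.2) | p <- s].

Variable I : Type.
Implicit Types (s : seq (R * I)) (f g : I -> R) (q : I -> I -> R).

Lemma comb_cat s s' f : comb (s ++ s') f = comb s f + comb s' f.
Proof. by rewrite /comb big_cat. Qed.

Lemma comb_scal a s f : comb (scal a s) f = a * comb s f.
Proof.
by rewrite /comb big_map mulr_sumr; apply: eq_bigr => p _; rewrite mulrA.
Qed.

Lemma comb_cons a t s f : comb ((a, t) :: s) f = a * f t + comb s f.
Proof. by rewrite /comb big_cons. Qed.

Lemma comb_nil f : comb [::] f = 0.
Proof. by rewrite /comb big_nil. Qed.

Lemma comb1 a t f : comb [:: (a, t)] f = a * f t.
Proof. by rewrite comb_cons comb_nil addr0. Qed.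

Lemma eq_comb s f g : f =1 g -> comb s f = comb s g.
Proof. by move=> fg; apply: eq_bigr => p _; rewrite fg. Qed.

Lemma combD s f g : comb s (fun t => f t + g t) = comb s f + comb s g.
Proof. by rewrite /comb -big_split; apply: eq_bigr => p _; rewrite mulrDr. Qed.

Lemma combZ s a f : comb s (fun t => a * f t) = a * comb s f.
Proof. by rewrite /comb mulr_sumr; apply: eq_bigr => p _; rewrite mulrCA. Qed.

Lemma combB s f g : comb s (fun t => f t - g t) = comb s f - comb s g.
Proof. by rewrite /comb -sumrB; apply: eq_bigr => p _; rewrite mulrBr. Qed.

Lemma comb_exchange (J : Type) s (s' : seq (R * J)) (q : J -> I -> R) :
  comb s (fun u => comb s' (fun t => q t u)) =
  comb s' (fun t => comb s (fun u => q t u)).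
Proof.
rewrite /comb; under eq_bigr do rewrite mulr_sumr.
rewrite exchange_big; apply: eq_bigr => p _; rewrite mulr_sumr.
by apply: eq_bigr => p' _; rewrite mulrCA.
Qed.

Lemma quadC q s s' : (forall t u, q t u = q u t) -> quad q s s' = quad q s' s.
Proof.
move=> qC; rewrite /quad comb_exchange; apply: eq_comb => t.
by apply: eq_comb => u; rewrite qC.
Qed.

Lemma quad_cat q s s' : (forall t u, q t u = q u t) ->
  quad q (s ++ s') (s ++ s') = quad q s s + 2 * quad q s s' + quad q s' s'.
Proof.
move=> qC; rewrite /quad comb_cat.
under eq_comb do rewrite comb_cat.
under [X in _ + X]eq_comb do rewrite comb_cat.
rewrite !combD -!/(quad q _ _) (quadC s' s qC); ring.
Qed.

Lemma quadZ q a b s s' : quad q (scal a s) (scal b s') = a * b * quad q s s'.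
Proof.
rewrite /quad comb_scal; under eq_comb do rewrite comb_scal.
by rewrite combZ mulrA.
Qed.

Lemma quadZr q b s s' : quad q s (scal b s') = b * quad q s s'.
Proof. by rewrite /quad; under eq_comb do rewrite comb_scal; rewrite combZ. Qed.

Lemma norm_comb_le s f g (e : R) : (forall t, `|f t - g t| <= e) ->
  `|comb s f - comb s g| <= e * \sum_(p <- s) `|p.1|.
Proof.
move=> fg; rewrite -combB /comb mulr_sumr.
rewrite (le_trans (ler_norm_sum _ _ _))// ler_sum// => p _.
by rewrite normrM mulrC ler_wpM2r.
Qed.

Lemma cvg_comb (J : Type) (F : set_system J) {FF : Filter F}
    (fj : J -> I -> R) f s : (forall t, fj j t @[j --> F] --> f t) ->
  comb s (fj j) @[j --> F] --> comb s f.
Proof.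
move=> fjf; elim: s => [|[a t] s ih].
  rewrite comb_nil; under eq_fun do rewrite comb_nil; exact: cvg_cst.
rewrite comb_cons; under eq_fun do rewrite comb_cons.
by apply: cvgD => //; apply: cvgMr; exact: fjf.
Qed.

End finite_combinations.

(** * Uniform convergence, continuity and the unit interval *)

Lemma uniform_cvgP (R : realType) (U : choiceType) (A : set U) (F : set_system (U -> R))
    (FF : Filter F) (f : U -> R) :
  {uniform A, F --> f} <->
  forall e : R, 0 < e -> \forall g \near F, forall t, A t -> `|f t - g t| < e.
Proof.
split=> [Ff e e0|h].
  apply: Ff; apply/(@uniform_nbhs U A R f); exists [set xy : R * R | `|xy.1 - xy.2| < e].
  by split; [rewrite -(@entourage_ballE R R); exists e|move=> g].
move=> P /(@uniform_nbhs U A R f P)[E [entE EP]].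
have := entE; rewrite -(@entourage_ballE R R) => -[e /= e0 eE].
have := h _ e0; apply: filterS => g fg; apply: EP => t At.
by apply: eE => /=; rewrite /ball/=; exact: fg.
Qed.

Lemma unif_continuous_continuous (R : realType) (X : pseudoMetricType R) (f : X -> R) :
  (forall e, 0 < e -> exists2 d, 0 < d & forall x y, ball x d y -> `|f x - f y| < e) ->
  continuous f.
Proof.
move=> h x; apply/cvgrPdist_lt => e e0; have [d d0 fd] := h _ e0.
by near=> y; apply: fd; near: y; exact: nbhsx_ballx.
Unshelve. all: by end_near. Qed.

Section real_continuity.
Variables (R : realType) (T : topologicalType).
Implicit Types f g : T -> R.

Lemma continuous_add f g : continuous f -> continuous g ->
  continuous (fun t => f t + g t).
Proof. by move=> cf cg t; apply: cvgD; [exact: cf|exact: cg]. Qed.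

Lemma continuous_sub f g : continuous f -> continuous g ->
  continuous (fun t => f t - g t).
Proof. by move=> cf cg t; apply: cvgB; [exact: cf|exact: cg]. Qed.

Lemma continuous_mul f g : continuous f -> continuous g ->
  continuous (fun t => f t * g t).
Proof. by move=> cf cg t; apply: cvgM; [exact: cf|exact: cg]. Qed.

Lemma continuous_const (a : R) : continuous (fun _ : T => a).
Proof. by move=> t; exact: cvg_cst. Qed.

Lemma continuous_scale a f : continuous f -> continuous (fun t => a * f t).
Proof. by move=> cf; apply: continuous_mul => //; exact: continuous_const. Qed.

Lemma continuous_comb (I : Type) (s : seq (R * I)) (F : I -> T -> R) :
  (forall i, continuous (F i)) -> continuous (fun t => comb s (F ^~ t)).
Proof. by move=> cF t; apply: cvg_comb => i; exact: cF. Qed.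

End real_continuity.

Section unit_interval.
Variable R : realType.

Lemma ball01E (s t : I01 R) (e : R) : ball s e t <-> `|val01 s - val01 t| < e.
Proof. by []. Qed.

Lemma ballC01E (f g : C01 R) (e : R) :
  ball f e g <-> forall t, `|f t - g t| < e.
Proof. by []. Qed.

Lemma val01_itv (t : I01 R) : 0 <= val01 t <= 1.
Proof. by have := svalP t; rewrite inE /= in_itv. Qed.

Lemma mem01_clip (x : R) :
  Num.max 0 (Num.min 1 x) \in (`[0, 1]%classic : set R).
Proof. by rewrite inE/= in_itv/= le_max lexx/= ge_max ler01/= ge_min lexx. Qed.

(** The retraction of the line onto [0, 1], total so that grid points need no membership proof; its
    continuity gives the compactness of [I01]. *)
Definition mk01 (x : R) : I01 R := exist _ (Num.max 0 (Num.min 1 x)) (mem01_clip x).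

Lemma mk01E x : val01 (mk01 x) = Num.max 0 (Num.min 1 x). Proof. by []. Qed.

Lemma mk01K x : 0 <= x <= 1 -> val01 (mk01 x) = x.
Proof.
by move=> /andP[x0 x1]; rewrite mk01E min_r// max_r.
Qed.

Lemma val01_inj : injective (@val01 R).
Proof. exact: val_inj. Qed.

Lemma val01K t : mk01 (val01 t) = t.
Proof. by apply: val01_inj; rewrite mk01K// val01_itv. Qed.

Lemma val01_continuous : continuous (@val01 R).
Proof.
exact: initial_continuous.
Qed.

Lemma mk01_continuous : continuous mk01.
Proof.
move=> x; apply/cvg_ballP => e e0; near=> y; rewrite ball01E.
have xy : `|x - y| < e by near: y; exact: (@nbhsx_ballx _ _ x e).
have clip_le a b : a <= b -> 0 <= val01 (mk01 b) - val01 (mk01 a) <= b - a.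
  move=> ab; apply/andP.
  have clipP z : [\/ z <= 0 /\ val01 (mk01 z) = 0,
      (0 <= z /\ z <= 1) /\ val01 (mk01 z) = z | 1 <= z /\ val01 (mk01 z) = 1].
    have [z0|/ltW z0] := leP z 0; have [z1|/ltW z1] := leP z 1.
    - by apply: Or31; rewrite mk01E min_r// max_l.
    - by exfalso; lra.
    - by apply: Or32; rewrite mk01K ?z0.
    - by apply: Or33; rewrite mk01E min_l// max_r.
  by have [[? ->]|[[? ?] ->]|[? ->]] := clipP a;
    have [[? ->]|[[? ?] ->]|[? ->]] := clipP b; split; lra.
have [h|h] := leP x y.
  have /andP[h1 h2] := clip_le _ _ h; move: xy.
  by rewrite ler0_norm ?subr_le0// ler0_norm; lra.
have /andP[h1 h2] := clip_le _ _ (ltW h); move: xy.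
by rewrite gtr0_norm ?subr_gt0// ger0_norm; lra.
Unshelve. all: by end_near. Qed.

Lemma compact_I01 : compact [set: I01 R].
Proof.
have -> : [set: I01 R] = mk01 @` `[0, 1]%classic.
  apply/seteqP; split=> // t _; exists (val01 t); last exact: val01K.
  by rewrite /= in_itv/= val01_itv.
apply: continuous_compact; last exact: segment_compact.
by apply: continuous_subspaceT; exact: mk01_continuous.
Qed.

Lemma compact_unif_continuous (X : pseudoMetricType R) (f : X -> R) :
    compact [set: X] -> continuous f ->
  forall e, 0 < e -> exists2 d, 0 < d & forall x y, ball x d y -> `|f x - f y| < e.
Proof.
move=> /compact_near_coveringP cX cf e e0.
have := cX R (0^'+) (fun d x => forall y, ball x d y -> `|f x - f y| < e) _.
move=> /(_ _)[].
  move=> x _.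
  have e20 : 0 < e / 2 by rewrite divr_gt0.
  have /cvgrPdist_lt /(_ _ e20) := cf x.
  move=> /nbhs_ballP[eta /= eta0 h].
  exists (ball x (eta / 2), [set d | d < eta / 2]) => /=.
    split; first by apply: nbhsx_ballx; rewrite divr_gt0.
    by apply: nbhs_right_lt; rewrite divr_gt0.
  move=> [x' d] /= [xx' dlt] y x'y.
  have h1 : `|f x - f x'| < e / 2.
    by apply: h; apply: le_ball xx'; rewrite ler_pdivrMr// ler_peMr ?ler1n// ltW.
  have h2 : `|f x - f y| < e / 2.
    apply: h; rewrite [eta]splitr; apply: ball_triangle xx' _.
    exact: le_ball (ltW dlt) _ x'y.
  rewrite (_ : f x' - f y = (f x - f y) - (f x - f x')); last by ring.
  by rewrite (le_lt_trans (ler_normB _ _))// [e]splitr ltrD.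
move=> d /= d0 h.
exists (d / 2); first by rewrite divr_gt0.
move=> x y xy; apply: (h (d / 2)) => //=; last by rewrite divr_gt0.
rewrite sub0r normrN gtr0_norm ?divr_gt0// ltr_pdivrMr//.
by rewrite ltr_pMr// ltr1n.
Qed.

Lemma unif_continuous01 (f : I01 R -> R) : continuous f ->
  forall e, 0 < e -> exists2 d, 0 < d &
    forall s t, `|val01 s - val01 t| < d -> `|f s - f t| < e.
Proof. by move=> cf e e0; exact: (compact_unif_continuous compact_I01 cf e0). Qed.

Lemma unif_continuous01_2 (q : I01 R -> I01 R -> R) :
    continuous (fun p : I01 R * I01 R => q p.1 p.2) ->
  forall e, 0 < e -> exists2 d, 0 < d &
    forall s s' t t', `|val01 s - val01 s'| < d -> `|val01 t - val01 t'| < d ->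
      `|q s t - q s' t'| < e.
Proof.
move=> cq e e0.
have cI : compact [set: I01 R * I01 R].
  by rewrite -setXTT; apply: compact_setX; exact: compact_I01.
have [d d0 h] := compact_unif_continuous cI cq e0.
by exists d => // s s' t t' ss' tt'; apply: (h (s, t) (s', t')).
Qed.

Lemma bounded01 (f : I01 R -> R) : continuous f -> exists M, forall t, `|f t| <= M.
Proof.
move=> cf.
have : compact (f @` setT).
  by apply: continuous_compact compact_I01; exact: continuous_subspaceT.
move=> /compact_bounded[M [_ /(_ (M + 1))]] h.
exists (M + 1) => t; apply: h; first by rewrite ltrDl.
by exists t.
Qed.

Lemma borel_measurable (S : ptopologicalType) (f : S -> R) : continuous f ->
  measurable_fun [set: borel S] (f : borel S -> R).
Proof.
move=> /continuousP cf; apply: (measurability _ (RGenOpens.measurableE R)).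
move=> _ [_ [a [b ->] <-]]; apply: sub_sigma_algebra; rewrite setTI.
exact/cf/interval_open.
Qed.

End unit_interval.

(** * Riemann sums against signed measures *)

Section riemann_sums.
Variable R : realType.

(** Cells are half-open, so t = 1 lies in the cell of index N + 1 and [N.+2] cells are needed to
    cover the interval. *)
Definition cell (N i : nat) : set (borel (I01 R)) :=
  [set t | i%:R / N.+1%:R <= val01 (t : I01 R) < i.+1%:R / N.+1%:R].

Definition pt (N i : nat) : I01 R := mk01 (i%:R / N.+1%:R).

Lemma measurable_cell N i : measurable (cell N i).
Proof.
have := borel_measurable (@val01_continuous R).
move=> /(_ measurableT `[i%:R / N.+1%:R, i.+1%:R / N.+1%:R[%classic (measurable_itv _)).
rewrite setTI; congr measurable; apply/seteqP; split=> t /=; by rewrite in_itv.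
Qed.

Lemma cell_ex N (t : I01 R) : exists2 i, (i < N.+2)%N & cell N i t.
Proof.
have /andP[t0 t1] := val01_itv t.
have x0 : 0 <= N.+1%:R * val01 t by rewrite mulr_ge0.
have /andP[h1 h2] := truncn_itv x0.
exists (Num.truncn (N.+1%:R * val01 t)).
  by rewrite ltnS -(ler_nat R) (le_trans h1)// ler_piMr.
by rewrite /cell/= ler_pdivrMr// ltr_pdivlMr// (mulrC (val01 t)) h1.
Qed.

Lemma cell_uniq N i j (t : I01 R) : cell N i t -> cell N j t -> i = j.
Proof.
move=> /andP[i1 i2] /andP[j1 j2].
have h1 := le_lt_trans i1 j2; have h2 := le_lt_trans j1 i2.
move: h1 h2; rewrite !ltr_pM2r ?invr_gt0// !ltr_nat !ltnS => h1 h2.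
by apply/eqP; rewrite eqn_leq h1.
Qed.

Lemma cell_pt N i (t : I01 R) : cell N i t ->
  `|val01 t - val01 (pt N i)| < N.+1%:R^-1.
Proof.
move=> /andP[t1 t2]; have /andP[t0 tle1] := val01_itv t.
have i0 : 0 <= i%:R / N.+1%:R :> R by rewrite divr_ge0.
rewrite /pt mk01K; last by rewrite i0 (le_trans t1).
rewrite ger0_norm ?subr_ge0// ltrBlDl.
by move: t2; rewrite -natr1 mulrDl mul1r.
Qed.

Section finite_measure_sums.
Variable mu : {finite_measure set (borel (I01 R)) -> \bar R}.

Let mu_fin A : measurable A -> mu A \is a fin_num.
Proof. by move=> mA; exact: fin_num_measure. Qed.

Lemma Rintegral_step (n : nat) (c : nat -> R) (A : nat -> set (borel (I01 R))) :
    (forall i, measurable (A i)) ->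
  mu.-integrable setT (EFin \o (fun t => \sum_(i < n) c i * \1_(A i) t)) /\
  \int[mu]_t (\sum_(i < n) c i * \1_(A i) t) = \sum_(i < n) c i * fine (mu (A i)).
Proof.
move=> mA; elim: n => [|n [ih1 ih2]].
  split.
    have -> : (fun t => \sum_(i < 0) c i * \1_(A i) t) = cst 0.
      by apply/funext => t; rewrite big_ord0.
    exact: finite_measure_integrable_cst.
  rewrite big_ord0; under eq_Rintegral do rewrite big_ord0.
  by rewrite Rintegral_cst// mul0r.
have i1 : mu.-integrable setT (EFin \o (\1_(A n) : _ -> R)).
  by apply: integrable_indic => //; rewrite -ge0_fin_numE ?mu_fin.
have i2 : mu.-integrable setT (EFin \o (fun t => c n * \1_(A n) t)).
  have -> : EFin \o (fun t => c n * \1_(A n) t) =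
     (fun t => (c n)%:E * (EFin \o (\1_(A n) : _ -> R)) t)%E by [].
  exact: integrableZl.
have E : (fun t => \sum_(i < n.+1) c i * \1_(A i) t) =
    (fun t => \sum_(i < n) c i * \1_(A i) t + c n * \1_(A n) t).
  by apply/funext => t; rewrite big_ord_recr.
rewrite E; split.
  have -> : EFin \o (fun t => \sum_(i < n) c i * \1_(A i) t + c n * \1_(A n) t) =
    ((EFin \o (fun t => (\sum_(i < n) c i * \1_(A i) t)%R)) \+
     (EFin \o (fun t => (c n * \1_(A n) t)%R)))%E by [].
  exact: integrableD.
rewrite RintegralD// ih2 RintegralZl// big_ord_recr/=; congr (_ + _ * _).
by rewrite /Rintegral integral_indic// setIT.
Qed.

Lemma continuous_integrable (f : I01 R -> R) : continuous f ->
  mu.-integrable setT (EFin \o f).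
Proof.
move=> cf; have [M fM] := bounded01 cf.
apply: (@le_integrable _ _ _ mu setT measurableT _ (cst M%:E)) => //=.
- by apply/measurable_EFinP; exact: borel_measurable.
- by move=> t _; rewrite lee_fin (le_trans (fM t))// ler_norm.
- exact: finite_measure_integrable_cst.
Qed.

Lemma Rintegral_riemann (f : I01 R -> R) N e : continuous f ->
    (forall i t, cell N i t -> `|f t - f (pt N i)| <= e) ->
  `|\int[mu]_t f t - \sum_(i < N.+2) f (pt N i) * fine (mu (cell N i))| <=
    e * fine (mu setT).
Proof.
move=> cf fe.
have [i1 <-] := Rintegral_step N.+2 (fun i => f (pt N i)) (measurable_cell N).
have if1 := continuous_integrable cf.
rewrite -RintegralB//.
have gE t : exists2 i, cell N i t &
    \sum_(j < N.+2) f (pt N j) * \1_(cell N j) t = f (pt N i).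
  have [i iN it] := cell_ex N t; exists i => //.
  rewrite (bigD1 (Ordinal iN))//= indicE mem_set// mulr1 big1 ?addr0// => j ji.
  rewrite indicE memNset ?mulr0// => jt.
  by case/negP: ji; apply/eqP/val_inj => /=; exact: (cell_uniq jt it).
apply: (le_trans (le_normr_Rintegral _ _)) => //.
  have -> : EFin \o (fun t => f t - \sum_(j < N.+2) f (pt N j) * \1_(cell N j) t) =
    ((EFin \o f) \- (EFin \o (fun t => (\sum_(j < N.+2) f (pt N j) * \1_(cell N j) t)%R)))%E.
    by [].
  exact: integrableB.
rewrite -Rintegral_cst//; apply: le_Rintegral => //.
- have -> : EFin \o (fun t => `|f t - \sum_(j < N.+2) f (pt N j) * \1_(cell N j) t|) =
    (fun t => `|((EFin \o f) \- (EFin \o (fun t => (\sum_(j < N.+2) f (pt N j) * \1_(cell N j) t)%R))) t|)%E.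
    by [].
  by apply: integrable_abse; exact: integrableB.
- exact: finite_measure_integrable_cst.
- by move=> t _; have [i it ->] := gE t; exact: fe.
Qed.

End finite_measure_sums.

Variable l : signed01 R.

Definition riemann (N : nat) : seq (R * I01 R) :=
  [seq (fine (l (cell N i)), pt N i) | i <- iota 0 N.+2].

Lemma comb_riemann N f :
  comb (riemann N) f = \sum_(i < N.+2) fine (l (cell N i)) * f (pt N i).
Proof. by rewrite /comb big_map -(big_mkord xpredT (fun i => fine (l (cell N i)) * f (pt N i))) /index_iota subn0. Qed.

(** [charge_integral] rests on a chosen Hahn decomposition, while the weights of the Riemann sums
    only see the charge. This estimate, with [M] the total variation and hence uniform in [N],
    reduces the algebra of the integral to finite sums. *)
Lemma charge_riemann : exists2 M, 0 <= M & (forall N,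
  \sum_(p <- riemann N) `|p.1| <= M /\ forall f e, continuous f ->
    (forall i t, cell N i t -> `|f t - f (pt N i)| <= e) ->
    `|charge_integral l f - comb (riemann N) f| <= e * M).
Proof.
rewrite /charge_integral.
set h := (X in jordan_pos X).
pose mp : {finite_measure set (borel (I01 R)) -> \bar R} := jordan_pos h.
pose mn : {finite_measure set (borel (I01 R)) -> \bar R} := jordan_neg h.
have fp A : measurable A -> mp A \is a fin_num by exact: fin_num_measure.
have fn A : measurable A -> mn A \is a fin_num by exact: fin_num_measure.
have lE N i : fine (l (cell N i)) = fine (mp (cell N i)) - fine (mn (cell N i)).
  have mc := measurable_cell N i.
  rewrite (jordan_decomp h mc) /= /cadd/= cscaleN1 /copp/=.
  by rewrite fineB ?fp ?fn.
have tot (mu : {finite_measure set (borel (I01 R)) -> \bar R}) N :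
    \sum_(i < N.+2) fine (mu (cell N i)) = fine (mu setT).
  have c1 : continuous (cst 1 : I01 R -> R) by exact: cst_continuous.
  (* The constant 1 does not oscillate on cells, so its Riemann sum is exact. *)
  have := @Rintegral_riemann mu (cst 1) N 0 c1.
  rewrite mul0r => /(_ _)/wrap[|].
    by move=> i t _; rewrite subrr normr0.
  rewrite normr_le0 subr_eq0 Rintegral_cst// mul1r => /eqP ->.
  by apply: eq_bigr => i _; rewrite mul1r.
exists (fine (mp setT) + fine (mn setT)).
  by rewrite addr_ge0// fine_ge0.
move=> N; split.
  rewrite big_map -{1}(subn0 N.+2) -/(index_iota 0 N.+2) big_mkord.
  rewrite -(tot mp N) -(tot mn N) -big_split ler_sum// => i _ /=.
  rewrite lE (le_trans (ler_normB _ _))// !ger0_norm// fine_ge0//.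
move=> f e cf fe.
have -> : comb (riemann N) f = \sum_(i < N.+2) f (pt N i) * fine (mp (cell N i)) -
    \sum_(i < N.+2) f (pt N i) * fine (mn (cell N i)).
  rewrite comb_riemann -sumrB; apply: eq_bigr => i _.
  by rewrite lE mulrC mulrBr.
have sep (a b c d : R) : a - b - (c - d) = (a - c) - (b - d) by ring.
rewrite sep mulrDr.
rewrite (le_trans (ler_normB _ _))// lerD//; exact: Rintegral_riemann.
Qed.

End riemann_sums.

(** * Reproducing kernel Hilbert spaces *)

Section charge_integrals.
Variable R : realType.
Implicit Types (l m : signed01 R) (f g : I01 R -> R).

Lemma eq_seq_lim (u v : nat -> R) (a b : R) : (forall n, u n = v n) ->
  (u n @[n --> \oo] --> a) -> (v n @[n --> \oo] --> b) -> a = b.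
Proof.
move=> uv ua; have -> : v = u by apply/funext.
exact: cvg_unique.
Qed.

Lemma near_inv_lt (d : R) : 0 < d -> \forall N \near \oo, N.+1%:R^-1 < d.
Proof. by move=> d0; near=> N; near: N; exact: near_infty_natSinv_lt (PosNum d0).
Unshelve. all: by end_near. Qed.

Lemma charge_integral_cvg l f : continuous f ->
  comb (riemann l N) f @[N --> \oo] --> charge_integral l f.
Proof.
move=> cf; have [M M0 lM] := charge_riemann l.
apply/cvgrPdist_lt => e e0.
have e'0 : 0 < e / (2 * (M + 1)) by rewrite divr_gt0// mulr_gt0// ltr_wpDl.
have [d d0 fd] := unif_continuous01 cf e'0.
near=> N; have [_ /(_ f (e / (2 * (M + 1))) cf)] := lM N.
move=> /(_ _)/wrap[|].
  move=> i t it; apply/ltW/fd; apply: (lt_trans (cell_pt it)).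
  by near: N; exact: near_inv_lt.
move=> /le_lt_trans; apply.
rewrite -mulrA gtr_pMr// mulrC ltr_pdivrMr ?mulr_gt0 ?ltr_wpDl// mul1r; lra.
Unshelve. all: by end_near. Qed.

Lemma charge_integralD l f g : continuous f -> continuous g ->
  charge_integral l (fun t => f t + g t) = charge_integral l f + charge_integral l g.
Proof.
move=> cf cg.
have cfg : continuous (fun t => f t + g t) by exact: continuous_add.
have h1 : comb (riemann l N) f + comb (riemann l N) g @[N --> \oo] -->
    charge_integral l f + charge_integral l g.
  by apply: cvgD; exact: charge_integral_cvg.
have h2 := @charge_integral_cvg l _ cfg.
by apply: (eq_seq_lim _ h2 h1) => N /=; rewrite combD.
Qed.

Lemma charge_integralZ l a f : continuous f ->
  charge_integral l (fun t => a * f t) = a * charge_integral l f.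
Proof.
move=> cf.
have caf : continuous (fun t => a * f t) by exact: continuous_scale.
have h1 : a * comb (riemann l N) f @[N --> \oo] --> a * charge_integral l f.
  by apply: cvgMr; exact: charge_integral_cvg.
have h2 := @charge_integral_cvg l _ caf.
by apply: (eq_seq_lim _ h2 h1) => N /=; rewrite combZ.
Qed.

Lemma charge_integralB l f g : continuous f -> continuous g ->
  charge_integral l (fun t => f t - g t) = charge_integral l f - charge_integral l g.
Proof.
move=> cf cg; have cNg : continuous (fun t => -1 * g t).
  exact: continuous_scale.
rewrite -[X in _ = _ + X]mulN1r -charge_integralZ// -charge_integralD//.
by congr charge_integral; apply/funext => t; rewrite mulN1r.
Qed.

Lemma charge_integral_bound l : exists2 M, 0 <= M & forall f e, continuous f ->
  (forall t, `|f t| <= e) -> `|charge_integral l f| <= e * M.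
Proof.
have [M M0 lM] := charge_riemann l; exists M => // f e cf fe.
have h : `|comb (riemann l N) f| @[N --> \oo] --> `|charge_integral l f|.
  by apply: cvg_norm; exact: charge_integral_cvg.
apply: (ler_cvg_to h (cvg_cst _)); near=> N => /=.
have := @norm_comb_le _ _ (riemann l N) f (fun=> 0) e.
rewrite [comb _ (fun=> 0)]big1 ?subr0; last by move=> p _; rewrite mulr0.
move=> /(_ _)/wrap[|]; first by move=> t; rewrite subr0.
move=> /le_trans; apply; have [h1 _] := lM N.
by rewrite ler_wpM2l// (le_trans _ (fe (zero01 R))).
Unshelve. all: by end_near. Qed.

(** A Hahn decomposition of the sum is unrelated to those of the summands; the weights of the cells
    are additive. *)
Lemma charge_integral_cadd l m f : continuous f ->
  charge_integral (cadd l m) f = charge_integral l f + charge_integral m f.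
Proof.
move=> cf.
have h1 : comb (riemann l N) f + comb (riemann m N) f @[N --> \oo] -->
    charge_integral l f + charge_integral m f.
  by apply: cvgD; exact: charge_integral_cvg.
have h2 := @charge_integral_cvg (cadd l m) _ cf.
apply: (eq_seq_lim _ h2 h1) => N.
rewrite /= !comb_riemann -big_split/=; apply: eq_bigr => i _.
have mc := @measurable_cell R N i.
by rewrite /cadd/= fineD ?fin_num_measure// mulrDl.
Qed.

Lemma charge_integral_cscale l a f : continuous f ->
  charge_integral (cscale a l) f = a * charge_integral l f.
Proof.
move=> cf.
have h1 : a * comb (riemann l N) f @[N --> \oo] --> a * charge_integral l f.
  by apply: cvgMr; exact: charge_integral_cvg.
have h2 := @charge_integral_cvg (cscale a l) _ cf.
apply: (eq_seq_lim _ h2 h1) => N.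
rewrite /= !comb_riemann mulr_sumr; apply: eq_bigr => i _.
have mc := @measurable_cell R N i.
by rewrite /cscale/= fineM ?fin_num_measure// mulrA.
Qed.

Lemma charge_integral_copp l f : continuous f ->
  charge_integral (copp l) f = - charge_integral l f.
Proof.
move=> cf.
have h1 : - comb (riemann l N) f @[N --> \oo] --> - charge_integral l f.
  by apply: cvgN; exact: charge_integral_cvg.
have h2 := @charge_integral_cvg (copp l) _ cf.
apply: (eq_seq_lim _ h2 h1) => N.
rewrite /= !comb_riemann -sumrN; apply: eq_bigr => i _.
by rewrite /copp/= fineN mulNr.
Qed.

Definition point_charge (t : I01 R) : signed01 R :=
  charge_of_finite_measure (@dirac _ (borel (I01 R)) t R).

Definition discrete_charge (s : seq (R * I01 R)) : signed01 R :=
  foldr (fun p l => cadd (cscale p.1 (point_charge p.2)) l : signed01 R)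
    (@czero _ (borel (I01 R)) R : signed01 R) s.

Lemma charge_integral_point t f : continuous f ->
  charge_integral (point_charge t) f = f t.
Proof.
move=> cf; have h := @charge_integral_cvg (point_charge t) _ cf.
apply: (cvg_unique _ h) => //; apply/cvgrPdist_lt => e e0; have [d d0 fd] := unif_continuous01 cf e0.
near=> N; have [i iN it] := cell_ex N t.
have -> : comb (riemann (point_charge t) N) f = f (pt R N i).
  rewrite comb_riemann (bigD1 (Ordinal iN))//= big1 ?addr0.
    by rewrite indicE mem_set// mul1r.
  move=> j ji; rewrite indicE memNset ?mul0r// => jt.
  by case/negP: ji; apply/eqP/val_inj => /=; exact: (cell_uniq jt it).
apply: fd; apply: (lt_trans (cell_pt it)).
by near: N; exact: near_inv_lt.
Unshelve. all: by end_near. Qed.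

Lemma charge_integral0 f : continuous f ->
  charge_integral (@czero _ (borel (I01 R)) R : signed01 R) f = 0.
Proof.
move=> cf; have h := @charge_integral_cvg (@czero _ (borel (I01 R)) R : signed01 R) _ cf.
apply: (eq_seq_lim _ h (@cvg_cst _ (0 : R) _ _ _)) => N.
by rewrite comb_riemann big1// => i _; rewrite /= mul0r.
Qed.

Lemma charge_integral_discrete s f : continuous f ->
  charge_integral (discrete_charge s) f = comb s f.
Proof.
move=> cf; elim: s => [|[a t] s ih] /=.
  by rewrite comb_nil charge_integral0.
by rewrite charge_integral_cadd// ih charge_integral_cscale// charge_integral_point// comb_cons.
Qed.

End charge_integrals.

(* The concave functional whose supremum over finite combinations is half the
   squared norm of [g] in the reproducing kernel Hilbert space of [q]. *)
Definition dual (R : realType) (I : Type) (q : I -> I -> R) (g : I -> R)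
    (s : seq (R * I)) : R := comb s g - quad q s s / 2.

Section dual_bound.
Variables (R : realType) (I : Type) (q : I -> I -> R).
Hypothesis qC : forall t u, q t u = q u t.
Hypothesis q_ge0 : forall s, 0 <= quad q s s.
Variables (g : I -> R) (S : R).
Hypothesis dualS : forall s, dual q g s <= S.

(** The functional at the midpoint of [s] and [s'] is at most [S]; by the parallelogram identity the
    deficits of the two bound the energy of their difference. *)
Lemma dual_cauchy s s' :
  quad q (s ++ scal (-1) s') (s ++ scal (-1) s') <=
  4 * (S - dual q g s) + 4 * (S - dual q g s').
Proof.
have := dualS (scal 2^-1 (s ++ s')).
rewrite /dual comb_scal comb_cat quadZ !quad_cat// quadZr quadZ; lra.
Qed.

(** Adding a mass [a] at [t] cannot push the functional above [S]; optimizing over [a] bounds its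
    derivative [x] in that direction. *)
Lemma dual_gradient s t :
  (g t - comb s (fun u => q t u)) ^+ 2 <= 2 * q t t * (S - dual q g s).
Proof.
set x := g t - _.
have h a : a * x - a ^+ 2 * q t t / 2 <= S - dual q g s.
  have := dualS (s ++ [:: (a, t)]).
  rewrite /dual comb_cat quad_cat// comb1.
  have -> : quad q [:: (a, t)] [:: (a, t)] = a ^+ 2 * q t t.
    by rewrite /quad !comb1 expr2 mulrA.
  have -> : quad q s [:: (a, t)] = a * comb s (fun u => q t u).
    by rewrite /quad -combZ; apply: eq_comb => u; rewrite comb1.
  by rewrite /x mulrBr; lra.
have d0 : 0 <= S - dual q g s by have := h 0; rewrite mul0r expr0n mul0r mul0r subr0.
have [q0|q0] := ltP 0 (q t t).
  have := h (x / q t t); move=> h'.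
  have : 2 * q t t * (x / q t t * x - (x / q t t) ^+ 2 * q t t / 2) <=
      2 * q t t * (S - dual q g s).
    by rewrite ler_pM2l// mulr_gt0.
  suff -> : 2 * q t t * (x / q t t * x - (x / q t t) ^+ 2 * q t t / 2) = x ^+ 2 by [].
  by field; rewrite gt_eqF.
have qtt : q t t = 0.
  apply/eqP; rewrite eq_le q0/=.
  by have := q_ge0 [:: (1, t)]; rewrite /quad !comb1 !mul1r.
rewrite qtt mulr0 mul0r; have [->|xN0] := eqVneq x 0; first by rewrite expr0n.
(* Without quadratic cost, this mass gains one more than the deficit. *)
have := h ((S - dual q g s + 1) / x).
by rewrite qtt mulr0 mul0r subr0 divfK//; lra.
Qed.

End dual_bound.

Section rkhs_characterization.
Variables (R : realType) (q : I01 R -> I01 R -> R).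
Hypothesis cq : continuous (fun p : I01 R * I01 R => q p.1 p.2).
Hypothesis qC : forall t u, q t u = q u t.
Hypothesis q_ge0 : forall s, 0 <= quad q s s.
Implicit Types (l m : signed01 R) (g : I01 R -> R) (s : seq (R * I01 R)).

Lemma continuous_section t : continuous (fun u => q t u).
Proof.
apply: unif_continuous_continuous => e e0.
have [d d0 h] := unif_continuous01_2 cq e0.
by exists d => // x y xy; apply: h => //; rewrite subrr normr0.
Qed.

Lemma continuous_section' t : continuous (fun u => q u t).
Proof. by rewrite (_ : (fun u => q u t) = q t); [exact: continuous_section|apply/funext]. Qed.

Lemma potentialE l t : potential q l t = charge_integral l (fun u => q u t).
Proof. by rewrite /potential; congr charge_integral; apply/funext => u. Qed.

Lemma continuous_potential l : continuous (potential q l).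
Proof.
have [M M0 lM] := charge_integral_bound l.
apply: unif_continuous_continuous => e e0.
have e'0 : 0 < e / (M + 1) by rewrite divr_gt0// ltr_wpDl.
have [d d0 h] := unif_continuous01_2 cq e'0.
exists d => // x y xy.
rewrite /potential -charge_integralB; [|exact: continuous_section..].
apply: (@le_lt_trans _ _ (e / (M + 1) * M)).
  apply: lM; first by apply: continuous_sub; exact: continuous_section.
  by move=> t; apply/ltW/h => //; rewrite subrr normr0.
by rewrite -mulrA gtr_pMr// mulrC ltr_pdivrMr ?ltr_wpDl// mul1r ltrDl.
Qed.

(** The inner product that polarizes [energy]. *)
Definition cross l m : R := charge_integral l (potential q m).

Lemma energyE l : energy q l = cross l l.
Proof.
by rewrite /energy /cross; congr charge_integral; apply/funext => t; rewrite potentialE.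
Qed.

(** The outer integral is replaced by its Riemann sum, then the potential at each grid point by its
    own, with an error uniform in the point because [q] is uniformly continuous. Symmetry and
    positivity of the energy are inherited from the finite forms. *)
Lemma quad_cvg l m :
  quad q (riemann l N) (riemann m N) @[N --> \oo] --> cross l m.
Proof.
have [M M0 lM] := charge_riemann l.
have [M' M'0 mM] := charge_riemann m.
apply/cvgrPdist_lt => e e0.
pose K := 2 * (M + 1) * (M' + 1).
have K0 : 0 < K by rewrite !mulr_gt0// ltr_wpDl.
have e'0 : 0 < e / K by rewrite divr_gt0.
have [d d0 h] := unif_continuous01_2 cq e'0.
have e20 : 0 < e / 2 by rewrite divr_gt0.
have /cvgrPdist_lt /(_ _ e20) h1 := @charge_integral_cvg _ l _ (@continuous_potential m).
near=> N.
have h2 : `|cross l m - comb (riemann l N) (potential q m)| < e / 2.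
  by near: N; exact: h1.
have h3 : `|comb (riemann l N) (potential q m) - quad q (riemann l N) (riemann m N)| <= e / K * M' * M.
  have [lM1 _] := lM N.
  apply: (@le_trans _ _ (e / K * M' * \sum_(p <- riemann l N) `|p.1|)).
    apply: norm_comb_le => t; rewrite potentialE.
    have [_ ->] := mM N; [by []|exact: continuous_section'|].
    move=> i u iu; apply/ltW/h; last by rewrite subrr normr0.
    apply: (lt_trans (cell_pt iu)).
    by near: N; exact: near_inv_lt.
  by rewrite ler_wpM2l// mulr_ge0// ltW.
have : e / K * M' * M <= e / 2.
  have -> : e / 2 = e / K * ((M + 1) * (M' + 1)).
    by rewrite /K; field; rewrite !gt_eqF// ltr_wpDl.
  by rewrite -mulrA ler_pM2l//; nra.
move=> h4.
rewrite (_ : _ - quad _ _ _ = (cross l m - comb (riemann l N) (potential q m)) +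
  (comb (riemann l N) (potential q m) - quad q (riemann l N) (riemann m N))); last by ring.
by rewrite (le_lt_trans (ler_normD _ _))//; lra.
Unshelve. all: by end_near. Qed.

Lemma crossC l m : cross l m = cross m l.
Proof.
apply: (eq_seq_lim _ (@quad_cvg l m) (@quad_cvg m l)) => N.
exact: quadC.
Qed.

Lemma energy_ge0 l : 0 <= energy q l.
Proof.
by rewrite energyE; apply: (cvgr_to_ge (@quad_cvg l l)); near=> N.
Unshelve. all: by end_near. Qed.

Lemma crossDl l l' m : cross (cadd l l') m = cross l m + cross l' m.
Proof. by rewrite /cross charge_integral_cadd//; exact: continuous_potential. Qed.

Lemma crossNl l m : cross (copp l) m = - cross l m.
Proof. by rewrite /cross charge_integral_copp//; exact: continuous_potential. Qed.

Lemma crossDr l m m' : cross l (cadd m m') = cross l m + cross l m'.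
Proof. by rewrite crossC crossDl !(crossC _ l). Qed.

Lemma crossNr l m : cross l (copp m) = - cross l m.
Proof. by rewrite crossC crossNl crossC. Qed.

Lemma energyB l m :
  energy q (cadd l (copp m)) = energy q l + energy q m - 2 * cross l m.
Proof.
rewrite (energyE l) (energyE m) energyE crossDl crossDr (crossDr (copp m)).
rewrite crossNl !crossNr crossNl (crossC m l).
by move: (cross l l) (cross m m) (cross l m) => a b c; ring.
Qed.

Lemma cross_polar l m : 2 * cross l m =
  energy q l + energy q m - energy q (cadd l (copp m)).
Proof. by rewrite energyB opprB addrC subrK. Qed.

Lemma cross_le l m : 2 * cross l m <= energy q l + energy q m.
Proof. by rewrite cross_polar gerBl; exact: energy_ge0. Qed.

(** Positivity of the energy of l - 2 m. *)
Lemma energy_le_twice l m :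
  energy q l <= 2 * energy q (cadd l (copp m)) + 2 * energy q m.
Proof.
have := energy_ge0 (cadd l (copp (cadd m m))).
have -> : energy q (cadd l (copp (cadd m m))) =
    energy q l + 4 * energy q m - 4 * cross l m.
  rewrite energyB crossDr (energyE (cadd m m)) crossDl crossDr (energyE m).
  by move: (energy q l) (cross m m) (cross l m) => a b c; ring.
rewrite energyB.
by move: (energy q l) (energy q m) (cross l m) => a b c; lra.
Qed.

Lemma cross_discrete s l : cross (discrete_charge s) l = comb s (potential q l).
Proof. by rewrite /cross charge_integral_discrete//; exact: continuous_potential. Qed.

Lemma potential_discrete s t : potential q (discrete_charge s) t = comb s (fun u => q t u).
Proof. by rewrite /potential charge_integral_discrete//; exact: continuous_section. Qed.

Lemma cross_discrete2 s s' :
  cross (discrete_charge s) (discrete_charge s') = quad q s s'.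
Proof.
rewrite cross_discrete; apply: eq_comb => t; rewrite potential_discrete.
by apply: eq_comb => u; rewrite qC.
Qed.

(** Finite combinations exhaust the supremum over charges: the value at a charge is the limit of the
    values along its Riemann sums. *)
Lemma dual_charge_le (g : I01 R -> R) (S : R) l : continuous g ->
  (forall s, dual q g s <= S) -> charge_integral l g - energy q l / 2 <= S.
Proof.
move=> cg gS; rewrite energyE.
have h : dual q g (riemann l N) @[N --> \oo] --> charge_integral l g - cross l l / 2.
  apply: cvgB; first exact: charge_integral_cvg.
  by apply: cvgMl; exact: quad_cvg.
by apply: (cvgr_to_le h); near=> N.
Unshelve. all: by end_near. Qed.

(** That energies stay above comes from [cross_le], tested on a finite combination. That they stay
    below comes from the functional at a far term of the sequence, where the integral of [g] is
    nearly the cross energy with later terms. The limit is thus the same for all representing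
    sequences. *)
Lemma rkhs_repr_dual g (l : nat -> signed01 R) : continuous g ->
  rkhs_repr q l g -> exists S, [/\ forall s, dual q g s <= S,
    (forall c, (forall s, dual q g s <= c) -> S <= c) &
    energy q (l i) @[i --> \oo] --> 2 * S].
Proof.
move=> cg [cauchy /uniform_cvgP unif0].
have unif (e : R) : 0 < e ->
    \forall i \near \oo, forall t, `|g t - potential q (l i) t| < e.
  move=> e0; have h : \forall i \near \oo, forall t, [set: I01 R] t ->
      `|g t - potential q (l i) t| < e by exact: unif0.
  by apply: filterS h => i hi t; exact: hi.
have lpt t : potential q (l i) t @[i --> \oo] --> g t.
  apply/cvgrPdist_lt => e e0; have := unif _ e0.
  by apply: filterS => i /(_ t).
have [N hN] := cauchy 1 ltr01.
have Ebd i : (N <= i)%N -> energy q (l i) <= 2 + 2 * energy q (l N).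
  move=> Ni; rewrite (le_trans (energy_le_twice _ (l N)))// lerD2r.
  by rewrite -[leRHS]mulr1 ler_pM2l//; apply/ltW/hN.
have below s (e : R) : 0 < e -> \forall j \near \oo, dual q g s - e <= energy q (l j) / 2.
  move=> e0.
  have hc : comb s (potential q (l j)) @[j --> \oo] --> comb s g by exact: cvg_comb.
  have /cvgrPdist_lt /(_ _ e0) := hc.
  apply: filterS => j hj.
  have := cross_le (discrete_charge s) (l j).
  rewrite [energy q (discrete_charge s)]energyE cross_discrete2 cross_discrete.
  move: hj; rewrite /dual ltr_norml => /andP[h1 h2].
  move: (energy q (l j)) h1 h2 => E; move: (comb s g) => a.
  by move: (comb s (potential q (l j))) (quad q s s) => b c; lra.
have bd s : dual q g s <= 2 + energy q (l N).
  have [j [Nj]] : exists j, (N <= j)%N /\ dual q g s - 1 <= energy q (l j) / 2.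
    near \oo => j; exists j; split; near: j; first exact: nbhs_infty_ge.
    exact: below.
  have := Ebd j Nj; move: (energy q (l j)) (energy q (l N)) (dual q g s) => a b c.
  by lra.
pose A := range (dual q g).
have hA : has_sup A.
  split; first by exists (dual q g [::]); exists [::].
  by exists (2 + energy q (l N)) => _ [s _ <-].
have AS s : dual q g s <= sup A by apply: sup_ubound; [case: hA|exists s].
exists (sup A); split => //.
  by move=> c hc; apply: sup_le_ub; [case: hA|move=> _ [s _ <-]].
apply/cvgrPdist_lt => e e0.
have e80 : 0 < e / 8 by rewrite divr_gt0.
have [_ [s _ <-] hs] := sup_adherent e80 hA.
have [N' hN'] := cauchy (e / 8) e80.
(* [M] depends on [l N'], which is therefore fixed before [j] grows. *)
have [M M0 lM] := charge_integral_bound (l N').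
have eM0 : 0 < e / (8 * (M + 1)) by rewrite divr_gt0// mulr_gt0// ltr_wpDl.
near=> j.
have h1 : dual q g s - e / 8 <= energy q (l j) / 2 by near: j; exact: below.
have Nj : (N' <= j)%N by near: j; exact: nbhs_infty_ge.
have h2 := hN' _ _ (leqnn N') Nj; have h2' := cross_polar (l N') (l j).
have h3 := dual_charge_le (l N') cg AS.
have h4 : `|charge_integral (l N') g - cross (l N') (l j)| <= e / (8 * (M + 1)) * M.
  rewrite -charge_integralB//; last exact: continuous_potential.
  apply: lM; first by apply: continuous_sub => //; exact: continuous_potential.
  have hu : forall t, `|g t - potential q (l j) t| < e / (8 * (M + 1)).
    by near: j; exact: unif.
  by move=> t; exact/ltW/hu.
have h5 : e / (8 * (M + 1)) * M <= e / 8.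
  rewrite -mulrA ler_pM2l//= invfM -mulrA ler_piMr ?invr_ge0//.
  by rewrite mulrC ler_pdivrMr ?ltr_wpDl// mul1r lerDl.
move: h4; rewrite ler_norml => /andP[h6 h7].
rewrite ltr_norml; apply/andP.
move: h1 h2 h2' h3 h5 h6 h7 hs.
move: (energy q (l j)) (energy q (cadd _ _)) (energy q (l N')) (cross _ _).
move: (charge_integral _ _) (dual q g s) (sup A) (e / _ * M) => x1 x2 x3 x4 x5 x6 x7 x8.
by move=> h1 h2 h2' h3 h5 h6 h7 hs; split; lra.
Unshelve. all: by end_near. Qed.

(** Along a maximizing sequence, [dual_cauchy] controls the energy of differences, and
    [dual_gradient] turns near-maximality into a sup-norm bound between [g] and the potentials. *)
Lemma dual_rkhs_repr g S : continuous g -> (forall s, dual q g s <= S) ->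
  exists s : nat -> seq (R * I01 R),
    rkhs_repr q (fun n => discrete_charge (s n)) g.
Proof.
move=> cg gS.
pose A := range (dual q g).
have hA : has_sup A.
  split; first by exists (dual q g [::]); exists [::].
  by exists S => _ [s _ <-].
have AS s : dual q g s <= sup A by apply: sup_ubound; [case: hA|exists s].
have /choice [s sP] : forall n : nat, exists s, sup A - n.+1%:R^-1 < dual q g s.
  move=> n; have n0 : 0 < n.+1%:R^-1 :> R by rewrite invr_gt0.
  have [_ [s _ <-] hs] := sup_adherent n0 hA.
  by exists s.
exists s; split.
  move=> r r0; have r80 : 0 < r / 8 by rewrite divr_gt0.
  have [N _ hN] := near_inv_lt r80.
  exists N => i j Ni Nj.
  have := dual_cauchy qC AS (s i) (s j).
  rewrite quad_cat// quadZr quadZ energyB !energyE !cross_discrete2.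
  have /= := hN _ Ni; have /= := hN _ Nj; have := sP i; have := sP j.
  move: (quad q (s i) (s i)) (quad q (s j) (s j)) (quad q (s i) (s j)) => a b c.
  move: (dual q g (s i)) (dual q g (s j)) (sup A) => x y z h1 h2 h3 h4 h5.
  by move: h1 h2 h3 h4 h5; move: (i.+1%:R^-1) (j.+1%:R^-1) => u v; lra.
have [M qM] : exists M, forall t : I01 R, q t t <= M.
  have [d d0 h] := unif_continuous01_2 cq ltr01.
  have cd : continuous (fun t => q t t).
    apply: unif_continuous_continuous => e e0.
    have [d' d'0 h'] := unif_continuous01_2 cq e0.
    by exists d' => // x y xy; exact: h'.
  have [M hM] := bounded01 cd; exists M => t.
  exact: (le_trans (ler_norm _)).
apply/uniform_cvgP => e e0.
have M0 : 0 <= M.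
  apply: le_trans (qM (zero01 R)).
  by have := q_ge0 [:: (1, zero01 R)]; rewrite /quad !comb1 !mul1r.
have d0 : 0 < e ^+ 2 / (2 * (M + 1)) by rewrite divr_gt0 ?exprn_gt0// mulr_gt0// ltr_wpDl.
have := near_inv_lt d0; apply: filterS => n hn t _.
rewrite potential_discrete -(ltr_pXn2r (ltn0Sn 1)) ?nnegrE ?(ltW e0)// real_normK ?num_real//.
apply: (le_lt_trans (dual_gradient qC q_ge0 AS (s n) t)).
have h1 : sup A - dual q g (s n) < n.+1%:R^-1.
  by rewrite ltrBlDl -ltrBlDr.
have h2 : 0 <= sup A - dual q g (s n) by rewrite subr_ge0.
apply: (@le_lt_trans _ _ (2 * (M + 1) * (sup A - dual q g (s n)))).
  by rewrite ler_wpM2r// ler_wpM2l// (le_trans (qM t))// lerDl.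
have K0 : 0 < 2 * (M + 1) by rewrite mulr_gt0// ltr_wpDl.
by rewrite mulrC -ltr_pdivlMr// (lt_trans h1).
Qed.

Lemma dual_rkhs g S : continuous g -> (forall s, dual q g s <= S) -> rkhs q g.
Proof.
move=> cg gS; split => //; have [s sg] := dual_rkhs_repr cg gS.
by exists (fun n => discrete_charge (s n)).
Qed.

(** By [rkhs_repr_dual], every value that [xget] may return is twice the same supremum. *)
Lemma rkhs_sqnormE g : rkhs q g -> exists S, [/\ forall s, dual q g s <= S,
    (forall c, (forall s, dual q g s <= c) -> S <= c) &
    rkhs_sqnorm q g = 2 * S].
Proof.
move=> [cg [l lg]]; have [S [S1 S2 S3]] := rkhs_repr_dual cg lg.
exists S; split => //; rewrite /rkhs_sqnorm.
case: xgetP => [r -> [l' l'g El'r]|/(_ (2 * S))[]]; last by exists l.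
have [S' [S'1 S'2 S'3]] := rkhs_repr_dual cg l'g.
have -> : S = S' by apply/eqP; rewrite eq_le S2// S'2.
exact: (cvg_unique _ El'r S'3).
Qed.

Lemma rkhs_approx g (e : R) : rkhs q g -> 0 < e -> exists s,
  (forall t, `|g t - comb s (fun u => q t u)| < e) /\
  quad q s s <= rkhs_sqnorm q g + e.
Proof.
move=> rg e0; have [cg _] := rg; have [S [S1 S2 ->]] := rkhs_sqnormE rg.
have [s sg] := dual_rkhs_repr cg S1.
have [S' [S'1 S'2 S'3]] := rkhs_repr_dual cg sg.
have SS' : S = S' by apply/eqP; rewrite eq_le S2// S'2.
have [_ /uniform_cvgP /(_ _ e0) unif] := sg.
have unif' : \forall n \near \oo, forall t, [set: I01 R] t ->
    `|g t - potential q (discrete_charge (s n)) t| < e by exact: unif.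
have /cvgrPdist_lt /(_ _ e0) En := S'3.
near \oo => n; exists (s n); split.
  move=> t; rewrite -potential_discrete.
  have hu : forall t, [set: I01 R] t ->
    `|g t - potential q (discrete_charge (s n)) t| < e by near: n; exact: unif'.
  exact: hu.
have : `|2 * S' - energy q (discrete_charge (s n))| < e by near: n; exact: En.
rewrite energyE cross_discrete2 SS' ltr_norml => /andP[+ _].
by move: (quad q (s n) (s n)) => a; lra.
Unshelve. all: by end_near. Qed.

End rkhs_characterization.

(** * Ultrafilters and compactness in path space *)

Lemma ultra_fmap (T U : Type) (f : T -> U) (F : set_system T) :
  UltraFilter F -> UltraFilter (f @ F).
Proof.
move=> FU; have FP : ProperFilter F by exact: ultra_proper.
split; first exact: fmap_proper_filter.
move=> G GF FG; apply/seteqP; split; last exact: FG.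
move=> A GA; have [//|FnA] := in_ultra_setVsetC (f @^-1` A) FU.
have : G (A `&` ~` A) by apply: filterI => //; exact: FG.
by rewrite setICr => /filter_not_empty.
Qed.

Section continuous_paths.
Variable R : realType.

Lemma path_continuous (f : C01 R) : continuous (f : I01 R -> R).
Proof. by case: f => f [[]]. Qed.

Definition mkC01 (g : I01 R -> R) (cg : continuous g) : C01 R := mkcts cg.

Lemma mkC01E g (cg : continuous g) t : mkC01 cg t = g t. Proof. by []. Qed.

Lemma evaluation_continuous (t : I01 R) : continuous (fun f : C01 R => f t).
Proof.
apply: unif_continuous_continuous => e e0; exists e => // f g /ballC01E fg.
exact: fg.
Qed.

Lemma comb_continuous (s : seq (R * I01 R)) : continuous (fun f : C01 R => comb s f).
Proof. by apply: continuous_comb => t; exact: evaluation_continuous. Qed.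

Lemma path_modulus (f : C01 R) e : 0 < e -> exists2 r, 0 < r &
  forall s t, `|val01 s - val01 t| < r -> `|f s - f t| <= e.
Proof.
move=> e0; have [r r0 h] := unif_continuous01 (@path_continuous f) e0.
by exists r => // s t st; exact/ltW/h.
Qed.

(** One line of a modulus of continuity, non-strict so that the set is closed. *)
Definition steady (r e : R) : set (C01 R) :=
  [set f | forall s t, `|val01 s - val01 t| < r -> `|f s - f t| <= e].

(** Ascoli along an ultrafilter: compactness of segments gives pointwise limits, the modulus passes
    to them, and closeness at finitely many grid points then spreads to all times. *)
Lemma ultra_cvg (F : set_system (C01 R)) : UltraFilter F ->
    (forall e, 0 < e -> exists2 r, 0 < r & F (steady r e)) ->
    (forall t, exists M, F [set f : C01 R | `|f t| <= M]) ->
  exists h : C01 R, F --> h.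
Proof.
move=> FU equi bdd.
have FF : ProperFilter F by exact: ultra_proper.
have /choice [g gP] : forall t, exists y : R, (fun f : C01 R => f t) @ F --> y.
  move=> t; have [M FM] := bdd t.
  have := @segment_compact R (- M) M; rewrite compact_ultra.
  move=> /(_ _ (ultra_fmap (fun f : C01 R => f t) FU)).
  move=> /(_ _)/wrap[|[y [_ Fy]]]; last by exists y.
  apply: filterS FM => f fM; rewrite /= in_itv/= -ler_norml; exact: fM.
have gsteady e : 0 < e -> exists2 r, 0 < r & F (steady r e) /\
    forall s t, `|val01 s - val01 t| < r -> `|g s - g t| <= e.
  move=> e0; have [r r0 Fr] := equi e e0; exists r => //; split => // s t st.
  have h : `|(f : C01 R) s - f t| @[f --> F] --> `|g s - g t|.
    by apply: cvg_norm; apply: cvgB; exact: gP.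
  by apply: (cvgr_to_le h); apply: filterS Fr => f; exact.
have cg : continuous g.
  apply: unif_continuous_continuous => e e0.
  have e20 : 0 < e / 2 by rewrite divr_gt0.
  have [r r0 [_ gr]] := gsteady _ e20; exists r => // x y xy.
  by rewrite (le_lt_trans (gr _ _ xy))// ltr_pdivrMr// ltr_pMr// ltr1n.
exists (mkC01 cg); apply/cvg_ballP => e e0.
have e40 : 0 < e / 4 by rewrite divr_gt0.
have [r r0 [Fr gr]] := gsteady _ e40.
have [N _ hN] := near_inv_lt r0.
have Npt : \forall f \near F, forall i : 'I_N.+2, `|g (pt R N i) - (f : C01 R) (pt R N i)| < e / 4.
  by apply: filter_forall => i; have /cvgrPdist_lt := gP (pt R N i); exact.
near=> f; apply/ballC01E => t; rewrite mkC01E.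
have [i iN it] := cell_ex N t.
have tp : `|val01 t - val01 (pt R N i)| < r.
  by apply: (lt_trans (cell_pt it)); have /= := hN N (leqnn N).
have h1 := gr _ _ tp.
have h2 : `|g (pt R N i) - f (pt R N i)| < e / 4.
  have : forall i : 'I_N.+2, `|g (pt R N i) - f (pt R N i)| < e / 4 by near: f.
  by move=> /(_ (Ordinal iN)).
have h3 : `|f t - f (pt R N i)| <= e / 4.
  have : steady r (e / 4) f by near: f.
  by apply.
rewrite distrC in h3.
have -> : g t - f t = (g t - g (pt R N i)) + (g (pt R N i) - f (pt R N i)) +
  (f (pt R N i) - f t) by ring.
rewrite (le_lt_trans (ler_normD _ _))//.
have := ler_normD (g t - g (pt R N i)) (g (pt R N i) - f (pt R N i)); lra.
Unshelve. all: by end_near. Qed.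

Lemma compact_paths (A : set (C01 R)) : closed A ->
    (forall e, 0 < e -> exists2 r, 0 < r & A `<=` steady r e) ->
    (forall t, exists M, A `<=` [set f : C01 R | `|f t| <= M]) ->
  compact A.
Proof.
move=> clA equi bdd; rewrite compact_ultra => F FU FA.
have FF : ProperFilter F by exact: ultra_proper.
have [e e0|t|h Fh] := ultra_cvg FU.
- by have [r r0 Ar] := equi e e0; exists r => //; exact: filterS FA.
- by have [M AM] := bdd t; exists M; exact: filterS FA.
exists h; split => //; apply: clA => B /Fh FB.
exact: filter_ex (filterI FA FB).
Qed.

End continuous_paths.

(** * Large deviations of small Gaussian noises *)

Section exponential_scale.
Variables (R : realType) (gamma : R -> R).
Hypothesis gamma_gt0 : forall e, 0 < e -> 0 < gamma e.
Hypothesis gamma0 : gamma e @[e --> 0^'+] --> (0 : R).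

Lemma near_scale C : \forall e \near 0^'+, 0 < gamma e /\ C <= (gamma e ^+ 2)^-1.
Proof.
pose k := (`|C| + 1)^-1.
have k0 : 0 < k by rewrite invr_gt0 ltr_wpDl.
have k1 : k <= 1 by rewrite invf_le1 ?lerDr// ltr_wpDl.
have /cvgrPdist_lt /(_ _ k0) h := gamma0.
near=> e.
have g0 : 0 < gamma e by apply: gamma_gt0; near: e; exact: nbhs_right_gt.
split => //.
have : `|0 - gamma e| < k by near: e; exact: h.
rewrite sub0r normrN gtr0_norm// => gk.
rewrite (le_trans (ler_norm C))// (@le_trans _ _ k^-1)//.
  by rewrite invrK lerDl.
rewrite lef_pV2 ?posrE ?exprn_gt0// (le_trans _ (ltW gk))//.
by rewrite expr2 ler_piMr ?(ltW g0)// (le_trans (ltW gk)).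
Unshelve. all: by end_near. Qed.

Definition exp_small (a : R) (p : R -> \bar R) : Prop :=
  \forall e \near 0^'+, (p e <= (expR (- a / gamma e ^+ 2))%:E)%E.

Lemma exp_smallW a b p : b <= a -> exp_small a p -> exp_small b p.
Proof.
move=> ba pa; near=> e.
have [g0 _] : 0 < gamma e /\ 0 <= (gamma e ^+ 2)^-1 by near: e; exact: near_scale.
apply: (@le_trans _ _ (expR (- a / gamma e ^+ 2))%:E); first by near: e.
by rewrite lee_fin ler_expR ler_pM2r ?invr_gt0 ?exprn_gt0// lerN2.
Unshelve. all: by end_near. Qed.

(** The factor 2 is absorbed by exp ((a - b) / gamma^2), eventually at least 2. *)
Lemma exp_smallD a b p r : b < a -> exp_small a p -> exp_small a r ->
  exp_small b (fun e => p e + r e)%E.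
Proof.
move=> ba pa ra; near=> e.
have [g0 ge] : 0 < gamma e /\ (a - b)^-1 <= (gamma e ^+ 2)^-1.
  by near: e; exact: near_scale.
apply: (@le_trans _ _ ((expR (- a / gamma e ^+ 2))%:E + (expR (- a / gamma e ^+ 2))%:E)%E).
  by apply: leeD; near: e.
rewrite -EFinD lee_fin.
have -> : - b / gamma e ^+ 2 = (a - b) / gamma e ^+ 2 + (- a / gamma e ^+ 2) by ring.
rewrite expRD -mulr2n -mulr_natl ler_pM2r ?expR_gt0//.
rewrite (le_trans _ (expR_ge1Dx _))// -[leLHS]/(1 + 1) lerD2l.
by rewrite -ler_pdivrMl ?subr_gt0// mulr1.
Unshelve. all: by end_near. Qed.

End exponential_scale.

(** * Moduli of continuity seen at countably many times *)

Section path_sets.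
Variable R : realType.

Lemma measurable_open (S : ptopologicalType) (A : set S) : open A ->
  measurable (A : set (borel S)).
Proof. by move=> oA; apply: (@sub_sigma_algebra S setT open A). Qed.

Lemma measurable_closed (S : ptopologicalType) (A : set S) : closed A ->
  measurable (A : set (borel S)).
Proof.
move=> /closed_openC oA; rewrite -(setCK A).
exact: (@measurableC _ (borel S) _ (measurable_open oA)).
Qed.

Lemma open_gap (s t : I01 R) (e : R) : open [set f : C01 R | e < `|f s - f t|].
Proof.
have c : continuous (fun f : C01 R => f s - f t).
  by apply: continuous_sub; exact: evaluation_continuous.
apply: (@open_comp (C01 R) R (fun f => `|f s - f t|) [set x | e < x]); last exact: open_gt.
by move=> f _; apply: (@continuous_comp (C01 R) R R (fun f : C01 R => f s - f t) Num.norm); [exact: c|exact: norm_continuous].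
Qed.

(** All grid points of all meshes, enumerated through the countability of pairs; a code of no pair
    gives the point of indices (0, 0). *)
Definition dense_pt (k : nat) : I01 R :=
  let p := odflt (0, 0)%N (unpickle k) in pt R p.1 p.2.

Lemma dense_ptP (t : I01 R) (r : R) : 0 < r ->
  exists k, `|val01 t - val01 (dense_pt k)| < r.
Proof.
move=> r0; have [N _ hN] := near_inv_lt r0.
have [i _ it] := cell_ex N t.
exists (pickle (N, i)); rewrite /dense_pt pickleK/=.
by apply: (lt_trans (cell_pt it)); have /= := hN N (leqnn N).
Qed.

Definition close_pairs (r : R) (k : nat) : seq (I01 R * I01 R) :=
  [seq p <- [seq (dense_pt i, dense_pt j) | i <- iota 0 k, j <- iota 0 k]
     | `|val01 p.1 - val01 p.2| < r].

(** A violation of [steady r e] seen on the first [k] dense points: an open event that involves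
    finitely many times and increases with [k]. *)
Definition gap (r e : R) (k : nat) : set (C01 R) :=
  [set f | exists2 p, p \in close_pairs r k & e < `|f p.1 - f p.2|].

Lemma open_gaps r e k : open (gap r e k).
Proof.
have -> : gap r e k = \bigcup_(p in [set p | p \in close_pairs r k])
    [set f : C01 R | e < `|f p.1 - f p.2|].
  by apply/seteqP; split=> f [p] ? ?; exists p.
by apply: bigcup_open => p _; exact: open_gap.
Qed.

Lemma gap_mono r e k k' : (k <= k')%N -> gap r e k `<=` gap r e k'.
Proof.
move=> kk f [p pk pe]; exists p => //.
move: pk; rewrite !mem_filter => /andP[-> /=] /allpairsP[[i j] /= [ik jk ->]].
apply/allpairsP; exists (i, j); split => //=; move: ik jk; rewrite !mem_iota !add0n /=.
  by move=> /leq_trans h _; exact: h.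
by move=> _ /leq_trans h; exact: h.
Qed.

Lemma bigcup_gap r e : \bigcup_k gap r e k = ~` steady r e.
Proof.
apply/seteqP; split=> [f [k _ [p]]|f].
  rewrite mem_filter => /andP[pr _] pe /(_ _ _ pr); rewrite leNgt.
  by move/negP; exact.
move=> /existsNP[s /existsNP[t /not_implyP[st]]] /negP; rewrite -ltNge => fe.
(* A third of the excess: moving both times to dense points costs at most two thirds of it, which
   leaves a strict violation. *)
pose e' := (`|f s - f t| - e) / 3.
have e'0 : 0 < e' by rewrite divr_gt0// subr_gt0.
have [r' r'0 fr'] := path_modulus f e'0.
pose r2 := Num.min r' ((r - `|val01 s - val01 t|) / 2).
have r20 : 0 < r2 by rewrite lt_min r'0 divr_gt0// subr_gt0.
have [i si] := dense_ptP s r20; have [j tj] := dense_ptP t r20.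
have si' : `|val01 s - val01 (dense_pt i)| < r' by rewrite (lt_le_trans si)// ge_min lexx.
have tj' : `|val01 t - val01 (dense_pt j)| < r' by rewrite (lt_le_trans tj)// ge_min lexx.
have si2 : `|val01 s - val01 (dense_pt i)| < (r - `|val01 s - val01 t|) / 2.
  by rewrite (lt_le_trans si)// ge_min lexx orbT.
have tj2 : `|val01 t - val01 (dense_pt j)| < (r - `|val01 s - val01 t|) / 2.
  by rewrite (lt_le_trans tj)// ge_min lexx orbT.
exists (maxn i j).+1 => //; exists (dense_pt i, dense_pt j).
  rewrite mem_filter; apply/andP; split.
    rewrite [_.1]/= [_.2]/=.
    have -> : val01 (dense_pt i) - val01 (dense_pt j) =
      (val01 s - val01 t) - (val01 s - val01 (dense_pt i)) +
      (val01 t - val01 (dense_pt j)) by ring.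
    rewrite (le_lt_trans (ler_normD _ _))//.
    have := ler_normB (val01 s - val01 t) (val01 s - val01 (dense_pt i)).
    by lra.
  apply/allpairsP; exists (i, j); split => //; rewrite mem_iota add0n/= ltnS.
    exact: leq_maxl.
  exact: leq_maxr.
rewrite /=; have h1 := fr' _ _ si'; have h2 := fr' _ _ tj'.
have : `|f s - f t| <= `|f s - f (dense_pt i)| +
    `|f (dense_pt i) - f (dense_pt j)| + `|f t - f (dense_pt j)|.
  have -> : f s - f t = (f s - f (dense_pt i)) +
    (f (dense_pt i) - f (dense_pt j)) - (f t - f (dense_pt j)) by ring.
  rewrite (le_trans (ler_normB _ _))// lerD2r; exact: ler_normD.
have e'E : 3 * e' = `|f s - f t| - e by rewrite /e' mulrC divfK.
by lra.
Qed.

Lemma closed_steady r e : closed (steady r e : set (C01 R)).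
Proof.
rewrite -(setCK (steady r e)); apply: open_closedC; rewrite -bigcup_gap.
by apply: bigcup_open => k _; exact: open_gaps.
Qed.

End path_sets.

(** * Exponential equicontinuity *)

Section gaussian_family.
Variables (R : realType).
Variables (d : R -> measure_display) (T : forall e, measurableType (d e)).
Variables (Q : forall e, probability (T e) R).
Variables (U : forall e, {RV (Q e) >-> borel (C01 R)}).
Variables (gamma : R -> R).
Hypothesis gamma_gt0 : forall e : R, 0 < e -> 0 < gamma e.
Hypothesis gamma0 : gamma e @[e --> 0^'+] --> (0 : R).
Variables (me : R -> I01 R -> R) (K : R -> I01 R -> I01 R -> R).
Variables (m : I01 R -> R) (q : I01 R -> I01 R -> R).
Hypothesis cm : continuous m.
Hypothesis cq : continuous (fun p : I01 R * I01 R => q p.1 p.2).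

Definition centered e (t : I01 R) (w : T e) : R := (U e w : C01 R) t - me e t.

Hypothesis centered_gaussian : \forall e \near 0^'+, forall s : seq (R * I01 R),
  gaussian (Q e) (fun w => comb s (fun t => centered t w)) 0 (quad (K e) s s).
Hypothesis me_lim : forall x : R, 0 < x -> \forall e \near 0^'+,
  forall t, `|m t - me e t| < x.
Hypothesis K_lim : forall x : R, 0 < x -> \forall e \near 0^'+,
  forall t u, `|q t u - K e t u / gamma e ^+ 2| < x.
Hypothesis centered_small : forall x : R, 0 < x -> \forall e \near 0^'+,
  forall s : seq (I01 R),
    ((2^-1)%:E <= Q e [set w | forall t, t \in s -> (`|centered t w| <= x)%R])%E.

Lemma measurable_path_set e (A : set (C01 R)) : measurable (A : set (borel (C01 R))) ->
  measurable (U e @^-1` A).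
Proof. by move=> mA; rewrite -[X in measurable X]setTI; exact: measurable_funPT. Qed.

Let pairs_comb n (a : 'I_n -> R) (ps : 'I_n -> I01 R * I01 R) : seq (R * I01 R) :=
  flatten [seq [:: (a i, (ps i).1); (- a i, (ps i).2)] | i <- enum 'I_n].

Let pairs_combE n a (ps : 'I_n -> I01 R * I01 R) f :
  comb (pairs_comb a ps) f = \sum_i a i * (f (ps i).1 - f (ps i).2).
Proof.
rewrite /comb big_flatten big_map big_enum/=; apply: eq_bigr => i _.
by rewrite big_cons big_seq1/=; ring.
Qed.

(** Fernique's inequality for the increments across close pairs. Half of the threshold [2 * del] is
    left to the oscillation of the mean. Values at most x / 2 with probability at least 1/2 make all
    increments at most [x] with that probability, and dividing by it gives the factor 2. *)
Lemma gaps_fernique e k r (del s2 x : R) : 0 < s2 -> 3 * x <= del ->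
    (forall s : seq (R * I01 R),
      gaussian (Q e) (fun w => comb s (fun t => centered t w)) 0 (quad (K e) s s)) ->
    (forall t u, `|val01 t - val01 u| < r ->
      K e t t - K e t u - K e u t + K e u u <= s2) ->
    (forall t u, `|val01 t - val01 u| < r -> `|me e t - me e u| <= del) ->
    ((2^-1)%:E <= Q e [set w | forall t,
       t \in [seq p.1 | p <- close_pairs r k] ++ [seq p.2 | p <- close_pairs r k] ->
       (`|centered t w| <= x / 2)%R])%E ->
  (Q e (U e @^-1` gap r (2 * del) k) <=
   (2 * expR (- ((del - 3 * x) ^+ 2 / (4 * s2))))%:E)%E.
Proof.
move=> s20 xdel gQ Ks2 med Qx.
pose ps := close_pairs r k; pose p0 := (zero01 R, zero01 R).
pose n := size ps; pose p (i : 'I_n) := nth p0 ps i.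
have pps (i : 'I_n) : p i \in ps by rewrite mem_nth.
have pr (i : 'I_n) : `|val01 (p i).1 - val01 (p i).2| < r.
  by have := pps i; rewrite mem_filter => /andP[].
pose V (i : 'I_n) (w : T e) := centered (p i).1 w - centered (p i).2 w.
pose C (i j : 'I_n) := (K e (p j).1 (p i).1 - K e (p j).2 (p i).1) -
  (K e (p j).1 (p i).2 - K e (p j).2 (p i).2).
have gV (a : 'I_n -> R) : gaussian (Q e) (fun w => \sum_i a i * V i w) 0
    (\sum_i \sum_j a i * a j * C i j).
  have := gQ (pairs_comb a p); congr (gaussian _ _ _ _).
    by apply/funext => w; rewrite pairs_combE.
  rewrite /quad pairs_combE; apply: eq_bigr => i _.
  rewrite !pairs_combE -sumrB mulr_sumr; apply: eq_bigr => j _.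
  by rewrite /C; ring.
have Cs2 i : C i i <= s2.
  have := Ks2 _ _ (pr i); rewrite /C; lra.
have F := fernique gV s20 Cs2 xdel.
set A := [set w : T e | exists i, (del < `|V i w|)%R] in F.
set B := [set w : T e | forall i, (`|V i w| <= x)%R] in F.
have mV i : measurable_fun setT (V i).
  have [h _ _] := gQ [:: (1, (p i).1); (-1, (p i).2)].
  move: h; congr measurable_fun; apply/funext => w.
  by rewrite comb_cons comb1 mul1r mulN1r.
have mVn i : measurable_fun setT (fun w => `|V i w|) by exact: measurableT_comp.
have mA : measurable A.
  have -> : A = \bigcup_i [set w | del < `|V i w|].
    by apply/seteqP; split=> w /= [i] => [h|_ h]; exists i.
  apply: fin_bigcup_measurable => [|i _]; first exact: finite_finset.
  have := mVn i measurableT `]del, +oo[%classic (measurable_itv _).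
  by rewrite setTI; congr measurable; apply/seteqP; split=> w /=; rewrite in_itv/= andbT.
have mB : measurable B.
  have -> : B = \bigcap_i [set w | `|V i w| <= x].
    by apply/seteqP; split=> w /= h i => [_|]; exact: h.
  apply: fin_bigcap_measurable => [|i _]; first exact: finite_finset.
  have := mVn i measurableT `]-oo, x]%classic (measurable_itv _).
  by rewrite setTI; congr measurable; apply/seteqP; split=> w /=; rewrite in_itv.
have mgap : measurable (U e @^-1` gap r (2 * del) k).
  by apply: measurable_path_set; apply: measurable_open; exact: open_gaps.
have QA : (Q e (U e @^-1` gap r (2 * del) k) <= Q e A)%E.
  apply: le_measure; rewrite ?inE// => w [pp ppk ppd].
  have ipp : (index pp ps < n)%N by rewrite index_mem.
  exists (Ordinal ipp); rewrite /V /p/= nth_index// /centered.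
  have ppr : `|val01 pp.1 - val01 pp.2| < r by move: ppk; rewrite mem_filter => /andP[].
  have := med _ _ ppr; move: ppd => /=.
  have -> (a b c z : R) : a - b - (c - z) = (a - c) - (b - z) by ring.
  by move=> h1 h2; have := lerB_dist ((U e w : C01 R) pp.1 - (U e w : C01 R) pp.2)
    (me e pp.1 - me e pp.2); lra.
have QB : ((2^-1)%:E <= Q e B)%E.
  apply: (le_trans Qx); apply: le_measure; rewrite ?inE//.
    set l := _ ++ _.
    have -> : [set w : T e | forall t, t \in l -> `|centered t w| <= x / 2] =
       \bigcap_(t in [set` l]) [set w : T e | `|centered t w| <= x / 2].
      by apply/seteqP; split=> w /= h t; exact: h.
    apply: fin_bigcap_measurable => [|t _]; first exact: finite_seq.
    have [h _ _] := gQ [:: (1, t)].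
    have mt : measurable_fun setT (fun w : T e => `|centered t w|).
      apply: measurableT_comp => //.
      move: h; congr measurable_fun.
      by apply/funext => w; rewrite comb1 mul1r.
    have := mt measurableT `]-oo, x / 2]%classic (measurable_itv _).
    by rewrite setTI; congr measurable; apply/seteqP; split=> w /=; rewrite in_itv.
  move=> w /= h i; rewrite /V (le_trans (ler_normB _ _))//.
  have h1 : `|centered (p i).1 w| <= x / 2.
    by apply: h; rewrite mem_cat (map_f fst (pps i)).
  have h2 : `|centered (p i).2 w| <= x / 2.
    by apply: h; rewrite mem_cat (map_f snd (pps i)) orbT.
  lra.
have QA2 : (Q e A * (2^-1)%:E <= (expR (- ((del - 3 * x) ^+ 2 / (4 * s2))))%:E)%E.
  by apply: le_trans F; rewrite lee_wpmul2l.
apply: (le_trans QA).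
have QAfin : Q e A \is a fin_num by exact: fin_num_measure.
move: QA2; rewrite -(fineK QAfin) -EFinM !lee_fin => h; lra.
Qed.

(** The bound on [gap] does not depend on the number of dense points, so it survives the increasing
    union that exhausts the complement of [steady]. *)
Lemma exp_equicontinuous (a del : R) : 0 < del -> exists2 r : R, 0 < r &
  exp_small gamma a (fun e => Q e (U e @^-1` ~` steady r del)).
Proof.
move=> del0; pose de := del / 2; pose x := de / 6.
have de0 : 0 < de by rewrite divr_gt0.
have x0 : 0 < x by rewrite divr_gt0.
(* Since de - 3 x = de / 2, the exponent in Fernique's inequality is (de / 2)^2 / (4 gamma^2 sg),
   which this choice makes equal to (|a| + 1) / gamma^2. *)
pose sg := de ^+ 2 / (16 * (`|a| + 1)).
have a0 : 0 < `|a| + 1 by rewrite ltr_wpDl.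
have sg0 : 0 < sg by rewrite divr_gt0 ?exprn_gt0 ?mulr_gt0.
have sg4 : 0 < sg / 4 by rewrite divr_gt0.
have sg8 : 0 < sg / 8 by rewrite divr_gt0.
have de4 : 0 < de / 4 by rewrite divr_gt0.
have [r1 r10 qr] := unif_continuous01_2 cq sg4.
have [r2 r20 mr] := unif_continuous01 cm de4.
exists (Num.min r1 r2); first by rewrite lt_min r10.
set r := Num.min r1 r2.
have rr1 t u : `|val01 t - val01 u| < r -> `|val01 t - val01 u| < r1.
  by rewrite lt_min => /andP[].
have rr2 t u : `|val01 t - val01 u| < r -> `|val01 t - val01 u| < r2.
  by rewrite lt_min => /andP[].
pose E e := (expR (- (`|a| + 1) / gamma e ^+ 2))%:E.
have Ea : exp_small gamma (`|a| + 1) E by near=> e.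
have aa : a < `|a| + 1 by rewrite (le_lt_trans (ler_norm a))// ltrDl.
have := exp_smallD gamma_gt0 gamma0 aa Ea Ea.
have Ecmp : \forall e \near 0^'+, (Q e (U e @^-1` ~` steady r del) <= E e + E e)%E.
  near=> e.
  have [g0 _] : 0 < gamma e /\ 0 <= (gamma e ^+ 2)^-1 by near: e; exact: near_scale.
  have g20 : 0 < gamma e ^+ 2 by rewrite exprn_gt0.
  have hm : forall t, `|m t - me e t| < de / 4 by near: e; exact: me_lim.
  have hK : forall t u, `|q t u - K e t u / gamma e ^+ 2| < sg / 8.
    by near: e; exact: K_lim.
  have hG : forall s : seq (R * I01 R), gaussian (Q e)
      (fun w => comb s (fun t => centered t w)) 0 (quad (K e) s s) by near: e.
  have hS : forall s : seq (I01 R), ((2^-1)%:E <= Q e [set w : T e | forall t,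
      t \in s -> (`|centered t w| <= x / 2)%R])%E.
    by near: e; apply: centered_small; rewrite divr_gt0.
  have bound k : (Q e (U e @^-1` gap r del k) <= E e + E e)%E.
    have dE : del = 2 * de by rewrite /de mulrC divfK.
    rewrite dE; have s20 : 0 < gamma e ^+ 2 * sg by rewrite mulr_gt0.
    apply: (le_trans (gaps_fernique s20 _ hG _ _ (hS _))).
    - by rewrite /x; lra.
    - move=> t u tu.
      have vv v : `|val01 v - val01 v| < r1 by rewrite subrr normr0.
      have ut1 : `|val01 u - val01 t| < r1 by rewrite distrC; exact: rr1.
      have h1 := qr _ _ _ _ (vv t) (rr1 _ _ tu).
      have h2 := qr _ _ _ _ (vv u) ut1.
      have := hK t t; have := hK t u; have := hK u t; have := hK u u.
      set z := gamma e ^+ 2 in g20 *; move: h1 h2.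
      rewrite [leRHS]mulrC -ler_pdivrMr//.
      have -> : (K e t t - K e t u - K e u t + K e u u) / z =
        K e t t / z - K e t u / z - K e u t / z + K e u u / z by ring.
      move: (K e t t / z) (K e t u / z) (K e u t / z) (K e u u / z) => k1 k2 k3 k4.
      rewrite !ltr_norml => /andP[? ?] /andP[? ?] /andP[? ?] /andP[? ?] /andP[? ?] /andP[? ?].
      lra.
    - move=> t u tu; have := hm t; have := hm u; have := mr _ _ (rr2 _ _ tu).
      rewrite !ltr_norml ler_norml => /andP[? ?] /andP[? ?] /andP[? ?].
      by apply/andP; split; lra.
    rewrite -EFinD lee_fin -[leRHS]mulr2n -[leRHS]mulr_natl ler_pM2l//.
    rewrite ler_expR mulNr lerN2.
    have -> : de - 3 * x = de / 2 by rewrite /x; field.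
    have -> : (de / 2) ^+ 2 / (4 * (gamma e ^+ 2 * sg)) = (de ^+ 2 / (16 * sg)) / gamma e ^+ 2.
      by field; rewrite ?gt_eqF.
    rewrite ler_pM2r ?invr_gt0// /sg.
    have -> // : de ^+ 2 / (16 * (de ^+ 2 / (16 * (`|a| + 1)))) = `|a| + 1.
    by field; rewrite ?gt_eqF.
  have mg k : measurable (U e @^-1` gap r del k).
    by apply: measurable_path_set; apply: measurable_open; exact: open_gaps.
  rewrite -bigcup_gap preimage_bigcup.
  have cv : Q e (U e @^-1` gap r del k) @[k --> \oo] -->
      Q e (\bigcup_k (U e @^-1` gap r del k)).
    apply: nondecreasing_cvg_mu => //; first exact: bigcup_measurable.
    move=> i j ij; apply/subsetPset => w; exact: gap_mono.
  rewrite -(cvg_lim _ cv)//; apply: lime_le; first by apply/cvg_ex; eexists; exact: cv.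
  by apply: nearW.
by move=> h; near=> e; apply: (@le_trans _ _ (E e + E e)%E); near: e.
Unshelve. all: by end_near. Qed.

End gaussian_family.

Section rates.
Variables (R : realType) (gamma : R -> R).
Hypothesis gamma_gt0 : forall e : R, 0 < e -> 0 < gamma e.
Hypothesis gamma0 : gamma e @[e --> 0^'+] --> (0 : R).

(** The room between [a] and [b] absorbs the constants of finite sums. *)
Definition rate_gt (a : R) (p : R -> \bar R) := exists2 b : R, a < b & exp_small gamma b p.

Lemma rate_gt_le a (p r : R -> \bar R) : (\forall e \near 0^'+, (p e <= r e)%E) ->
  rate_gt a r -> rate_gt a p.
Proof.
move=> pr [b ab hb]; exists b => //; near=> e.
by apply: (@le_trans _ _ (r e)); near: e.
Unshelve. all: by end_near. Qed.

Lemma rate_gtD a (p r : R -> \bar R) : rate_gt a p -> rate_gt a r ->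
  rate_gt a (fun e => p e + r e)%E.
Proof.
move=> [b ab pb] [c ac rc]; pose d := Num.min b c.
have ad : a < d by rewrite lt_min ab.
exists ((a + d) / 2); first by rewrite midf_lt.
apply: (@exp_smallD _ _ gamma_gt0 gamma0 d); first by rewrite midf_lt.
  by apply: exp_smallW pb => //; rewrite ge_min lexx.
by apply: exp_smallW rc => //; rewrite ge_min lexx orbT.
Qed.

Lemma rate_gt0 a : rate_gt a (fun=> 0%E).
Proof.
by exists (a + 1); [rewrite ltrDl|near=> e; rewrite lee_fin expR_ge0].
Unshelve. all: by end_near. Qed.

Lemma rate_gt_sum (I : Type) (l : seq I) a (p : I -> R -> \bar R) :
  (forall i, rate_gt a (p i)) -> rate_gt a (fun e => \sum_(i <- l) p i e)%E.
Proof.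
move=> pa; elim: l => [|i l ih].
  by under eq_fun do rewrite big_nil; exact: rate_gt0.
by under eq_fun do rewrite big_cons; exact: rate_gtD.
Qed.

Lemma rate_gt_exp a b (f : R -> R) : a < b -> (\forall e \near 0^'+, f e <= - b) ->
  rate_gt a (fun e => (expR (f e / gamma e ^+ 2))%:E).
Proof.
move=> ab fb; exists b => //; near=> e.
have [g0 _] : 0 < gamma e /\ 0 <= (gamma e ^+ 2)^-1.
  by near: e; exact: near_scale.
rewrite lee_fin ler_expR ler_pM2r ?invr_gt0 ?exprn_gt0//; near: e; exact: fb.
Unshelve. all: by end_near. Qed.

End rates.

Lemma open_comb_gt (R : realType) (s : seq (R * I01 R)) (c : R) :
  open [set f : C01 R | c < comb s f].
Proof.
apply: (@open_comp (C01 R) R (fun f => comb s f) [set x | c < x]); last exact: open_gt.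
by move=> f _; exact: comb_continuous.
Qed.

Lemma open_eval_gt (R : realType) (t : I01 R) (c : R) :
  open [set f : C01 R | c < `|f t|].
Proof.
apply: (@open_comp (C01 R) R (fun f => `|f t|) [set x | c < x]); last exact: open_gt.
move=> f _; apply: (@continuous_comp (C01 R) R R (fun f : C01 R => f t) Num.norm).
  exact: evaluation_continuous.
exact: norm_continuous.
Qed.

(** * The upper bound for closed sets *)

Section upper_bound.
Variables (R : realType).
Variables (d : R -> measure_display) (T : forall e, measurableType (d e)).
Variables (Q : forall e, probability (T e) R).
Variables (U : forall e, {RV (Q e) >-> borel (C01 R)}).
Variables (gamma : R -> R).
Hypothesis gamma_gt0 : forall e : R, 0 < e -> 0 < gamma e.
Hypothesis gamma0 : gamma e @[e --> 0^'+] --> (0 : R).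
Variables (me : R -> I01 R -> R) (K : R -> I01 R -> I01 R -> R).
Variables (m : I01 R -> R) (q : I01 R -> I01 R -> R).
Hypothesis centered_gaussian : \forall e \near 0^'+, forall s : seq (R * I01 R),
  gaussian (Q e) (fun w => comb s (fun t => centered U me t w)) 0 (quad (K e) s s).
Hypothesis me_lim : forall x : R, 0 < x -> \forall e \near 0^'+,
  forall t, `|m t - me e t| < x.
Hypothesis K_lim : forall x : R, 0 < x -> \forall e \near 0^'+,
  forall t u, `|q t u - K e t u / gamma e ^+ 2| < x.
Hypothesis equicontinuous : forall a del : R, 0 < del -> exists2 r : R, 0 < r &
  exp_small gamma a (fun e => Q e (U e @^-1` ~` steady r del)).

Lemma comb_me_lim (s : seq (R * I01 R)) (x : R) : 0 < x -> \forall e \near 0^'+,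
  `|comb s m - comb s (me e)| < x.
Proof.
move=> x0; pose W := \sum_(p <- s) `|p.1| + 1.
have W0 : 0 < W by rewrite ltr_wpDl// sumr_ge0.
near=> e; have h : forall t, `|m t - me e t| < x / W.
  by near: e; apply: me_lim; rewrite divr_gt0.
apply: (@le_lt_trans _ _ (x / W * \sum_(p <- s) `|p.1|)).
  by apply: norm_comb_le => t; exact/ltW.
by rewrite mulrAC ltr_pdivrMr// ltr_pM2l// ltrDl.
Unshelve. all: by end_near. Qed.

Lemma quad_K_lim (s s' : seq (R * I01 R)) (x : R) : 0 < x -> \forall e \near 0^'+,
  `|quad q s s' - quad (K e) s s' / gamma e ^+ 2| < x.
Proof.
move=> x0; pose W := (\sum_(p <- s') `|p.1|) * (\sum_(p <- s) `|p.1|) + 1.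
have W0 : 0 < W by rewrite ltr_wpDl// mulr_ge0// sumr_ge0.
near=> e; have h : forall t u, `|q t u - K e t u / gamma e ^+ 2| < x / W.
  by near: e; apply: K_lim; rewrite divr_gt0.
have -> : quad (K e) s s' / gamma e ^+ 2 = quad (fun t u => K e t u / gamma e ^+ 2) s s'.
  rewrite /quad mulrC -combZ; apply: eq_comb => u.
  by rewrite -combZ; apply: eq_comb => t; rewrite mulrC.
apply: (@le_lt_trans _ _ (x / W * ((\sum_(p <- s') `|p.1|) * (\sum_(p <- s) `|p.1|)))).
  rewrite mulrA; apply: norm_comb_le => u; apply: norm_comb_le => t; exact/ltW/h.
by rewrite mulrAC ltr_pdivrMr// ltr_pM2l// ltrDl.
Unshelve. all: by end_near. Qed.

(** Exponential Markov inequality at slope gamma^-2; there is no slope to optimize, as [s] ranges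
    over all its multiples. *)
Lemma comb_small (s : seq (R * I01 R)) (a c : R) : a < c - comb s m - quad q s s / 2 ->
  rate_gt gamma a (fun e => Q e (U e @^-1` [set f : C01 R | c < comb s f])).
Proof.
set D := c - comb s m - quad q s s / 2 => aD.
pose x := (D - a) / 4; have x0 : 0 < x by rewrite divr_gt0// subr_gt0.
apply: (@rate_gt_le _ _ _ _ (fun e => (expR ((quad (K e) s s / gamma e ^+ 2 / 2
   - (c - comb s (me e))) / gamma e ^+ 2))%:E)); last first.
  apply: (@rate_gt_exp _ _ gamma_gt0 gamma0 _ (D - 2 * x)); first by rewrite /x; lra.
  near=> e.
  have h1 : `|comb s m - comb s (me e)| < x by near: e; exact: comb_me_lim.
  have h2 : `|quad q s s - quad (K e) s s / gamma e ^+ 2| < x.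
    by near: e; exact: quad_K_lim.
  move: h1 h2; rewrite !ltr_norml /D.
  move: (quad (K e) s s / _) => k /andP[? ?] /andP[? ?].
  lra.
near=> e.
have [g0 _] : 0 < gamma e /\ 0 <= (gamma e ^+ 2)^-1.
  by near: e; exact: near_scale.
have hG : forall s : seq (R * I01 R),
  gaussian (Q e) (fun w => comb s (fun t => centered U me t w)) 0 (quad (K e) s s).
  by near: e.
have g20 : 0 < (gamma e ^+ 2)^-1 by rewrite invr_gt0 exprn_gt0.
have := gaussian_exp_markov (hG s) (c - comb s (me e)) g20.
have -> : (gamma e ^+ 2)^-1 * 0 + (gamma e ^+ 2)^-1 ^+ 2 * quad (K e) s s / 2
  - (gamma e ^+ 2)^-1 * (c - comb s (me e)) =
  (quad (K e) s s / gamma e ^+ 2 / 2 - (c - comb s (me e))) / gamma e ^+ 2 by ring.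
apply: le_trans; apply: le_measure; rewrite ?inE.
- by apply: measurable_path_set; apply: measurable_open; exact: open_comb_gt.
- have [mZ _ _] := hG s.
  have := mZ measurableT `[c - comb s (me e), +oo[%classic (measurable_itv _).
  by rewrite setTI; congr measurable; apply/seteqP; split=> w /=; rewrite in_itv/= andbT.
- by move=> w /=; rewrite /centered combB lerD2r => /ltW.
Unshelve. all: by end_near. Qed.

Lemma closed_bound (F : set (C01 R)) (a : R) : closed F ->
    (forall h : C01 R, F h -> exists s, a < dual q (fun t => h t - m t) s) ->
  rate_gt gamma a (fun e => Q e (U e @^-1` F)).
Proof.
move=> clF aF; apply: contrapT => nF.
pose small (B : set (C01 R)) := measurable (B : set (borel (C01 R))) /\
  rate_gt gamma a (fun e => Q e (U e @^-1` B)).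
have smallU B B' : small B -> small B' -> small (B `|` B').
  move=> [mB rB] [mB' rB']; split; first exact: (@measurableU _ (borel (C01 R))).
  have := rate_gtD gamma_gt0 gamma0 rB rB'; apply: rate_gt_le; apply: nearW => e.
  by rewrite preimage_setU; apply: measureU2; exact: measurable_path_set.
(* A member contains [F] up to a set of rate above [a]; the filter is proper because the claim is
   assumed to fail. *)
pose FF := [set A : set (C01 R) | exists2 B, small B & F `&` ~` A `<=` B].
have small0 : small set0.
  split; first exact: (@measurable0 _ (borel (C01 R))).
  by under eq_fun do rewrite preimage_set0 measure0; exact: rate_gt0.
have FFsmall B : small B -> FF (~` B).
  by move=> sB; exists B => // f []; rewrite setCK.
have FFF : Filter FF.
  split.
  - by exists set0 => //; rewrite setCT setI0.
  - move=> A A' [B sB AB] [B' sB' AB']; exists (B `|` B'); first exact: smallU.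
    by rewrite setCI setIUr; exact: setUSS.
  - move=> A A' AA' [B sB AB]; exists B => //; apply: subset_trans AB.
    by apply: setIS; exact: subsetC.
have FFP : ProperFilter FF.
  apply: Build_ProperFilter_ex => A; apply: contraPP => A0 [B [mB rB] FB].
  apply: nF; apply: rate_gt_le rB; apply: nearW => e.
  apply: le_measure; rewrite ?inE.
  - by apply: measurable_path_set; exact: measurable_closed.
  - exact: measurable_path_set.
  - move=> w Fw; apply: FB; split => // Aw; apply: A0; by exists (U e w).
have [G [GU FG]] := ultraFilterLemma FFP.
have [h Gh] : exists h : C01 R, G --> h.
  apply: ultra_cvg => [e e0|t].
    have [r r0 hr] := equicontinuous (a + 1) e0; exists r => //; apply: FG.
    rewrite -(setCK (steady r e)); apply: FFsmall; split.
      apply: (@measurableC _ (borel (C01 R))).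
      by apply: measurable_closed; exact: closed_steady.
    by exists (a + 1) => //; rewrite ltrDl.
  (* Large enough for the masses 1 and -1 at [t] to give the event |f t| > M a rate above [a]. *)
  pose M := `|a| + 1 + `|m t| + `|q t t|.
  exists M; apply: FG.
  rewrite (_ : [set f : C01 R | _] = ~` [set f : C01 R | M < `|f t|]); last first.
    by apply/seteqP; split=> f /=; rewrite leNgt => /negP.
  apply: FFsmall; split.
    by apply: measurable_open; exact: open_eval_gt.
  have aM : a < M - `|m t| - `|q t t| / 2.
    rewrite /M; have := ler_norm a; have := normr_ge0 (q t t); lra.
  have r1 : rate_gt gamma a
      (fun e => Q e (U e @^-1` [set f : C01 R | M < comb [:: (1, t)] f])).
    apply: comb_small; rewrite /quad !comb1 !mul1r.
    by have := ler_norm (m t); have := ler_norm (q t t); lra.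
  have r2 : rate_gt gamma a
      (fun e => Q e (U e @^-1` [set f : C01 R | M < comb [:: (-1, t)] f])).
    apply: comb_small; rewrite /quad !comb1 !mulN1r opprK.
    by have := ler_norm (- m t); rewrite normrN; have := ler_norm (q t t); lra.
  have mc s : measurable ([set f : C01 R | M < comb s f] : set (borel (C01 R))).
    by apply: measurable_open; exact: open_comb_gt.
  have [_] := smallU _ _ (conj (mc _) r1) (conj (mc _) r2).
  apply: rate_gt_le; apply: nearW => e; apply: le_measure; rewrite ?inE.
  - by apply: measurable_path_set; apply: measurable_open; exact: open_eval_gt.
  - by apply: measurable_path_set; apply: (@measurableU _ (borel (C01 R))).
  - move=> w /=; rewrite lter_normr !comb1 mul1r mulN1r => /orP[|] ?; [by left|by right].
have GP : ProperFilter G by exact: ultra_proper.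
have GF : G F by apply: FG; exists set0 => //; rewrite setICr.
have Fh : F h.
  apply: clF => A Ah; have /filter_ex [f [Ff Af]] : G (F `&` A).
    by apply: filterI => //; exact: Gh.
  by exists f.
have [s ash] := aF _ Fh.
(* Half the excess of the functional over [a]: lowering the threshold by [eta] makes the half-space
   [V] a neighbourhood of [h] while its rate stays above [a]. *)
pose eta := (dual q (fun t => h t - m t) s - a) / 2.
have eta0 : 0 < eta by rewrite divr_gt0// subr_gt0.
pose V := [set f : C01 R | comb s h - eta < comb s f].
have oV : open V by exact: open_comb_gt.
have sV : small V.
  split; first exact: measurable_open.
  apply: comb_small; move: eta0 ash; rewrite /eta /dual combB.
  move: (quad q s s) => k; lra.
have /filter_ex [f [Vf]] : G (V `&` ~` V).
  apply: filterI; last exact/FG/FFsmall.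
  by apply: Gh; apply: open_nbhs_nbhs; split => //; rewrite /V/= ltrBlDr ltrDl.
by apply.
Qed.

End upper_bound.

(** * Level sets of the rate function *)

Section rate_function.
Variables (R : realType) (q : I01 R -> I01 R -> R).
Hypothesis cq : continuous (fun p : I01 R * I01 R => q p.1 p.2).
Hypothesis qC : forall t u, q t u = q u t.
Hypothesis q_ge0 : forall s, 0 <= quad q s s.

(** A point mass where the kernel vanishes costs no energy, so a nonzero value of [g] there would
    make the functional unbounded. The endpoint values of the bridge are obtained this way. *)
Lemma rkhs_zero g t : rkhs q g -> q t t = 0 -> g t = 0.
Proof.
move=> rg qt; have [S [gS _ _]] := rkhs_sqnormE cq qC q_ge0 rg.
apply/eqP/negPn/negP => gt0.
have := gS [:: ((`|S| + 1) / g t, t)].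
rewrite /dual /quad !comb1 qt !mulr0 mul0r subr0 divfK// leNgt => /negP; apply.
by rewrite (le_lt_trans (ler_norm S))// ltrDl.
Qed.

Lemma rkhs_dual_le g (a : R) : continuous g ->
  (rkhs q g /\ 2^-1 * rkhs_sqnorm q g <= a) <-> (forall s, dual q g s <= a).
Proof.
move=> cg; split=> [[rg ga] s|ga].
  have [S [gS _ nE]] := rkhs_sqnormE cq qC q_ge0 rg.
  by apply: (le_trans (gS s)); move: ga; rewrite nE mulKf.
have rg := dual_rkhs cq qC q_ge0 cg ga; split => //.
by have [S [_ Sa ->]] := rkhs_sqnormE cq qC q_ge0 rg; rewrite mulKf// Sa.
Qed.

Lemma compact_level (m : I01 R -> R) (a : R) : continuous m ->
  compact [set h : C01 R | forall s, dual q (fun t => h t - m t) s <= a].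
Proof.
move=> cm; apply: compact_paths.
- have -> : [set h : C01 R | forall s, dual q (fun t => h t - m t) s <= a] =
      \bigcap_s ~` [set h : C01 R | a + quad q s s / 2 + comb s m < comb s h].
    apply/seteqP; split=> h /= ha s => [_|].
      by rewrite /= ltNge; apply/negP; rewrite negbK; have := ha s;
        rewrite /dual combB lerBlDr lerBlDr.
    have := ha s Logic.I; rewrite /= ltNge => /negP; rewrite negbK.
    by rewrite /dual combB lerBlDr lerBlDr.
  by apply: closed_bigI => s _; apply: open_closedC; exact: open_comb_gt.
(* Equicontinuity is tested on [x] times a difference of two point masses. This [x] makes a / x at
   most e / 4; the uniform continuity of [q] is used at a precision that brings the quadratic term
   to e / 4, and e / 2 goes to [m]. *)
- move=> e e0; pose x := 4 * (`|a| + 1) / e.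
  have a0 : 0 < `|a| + 1 by rewrite ltr_wpDl.
  have x0 : 0 < x by rewrite divr_gt0 ?mulr_gt0.
  have e8 : 0 < e / (4 * x) by apply: divr_gt0 => //; apply: mulr_gt0.
  have [r1 r10 qr] := unif_continuous01_2 cq e8.
  have e2 : 0 < e / 2 by rewrite divr_gt0.
  have [r2 r20 mr] := unif_continuous01 cm e2.
  exists (Num.min r1 r2); first by rewrite lt_min r10.
  move=> h ha.
  have up t u : `|val01 t - val01 u| < Num.min r1 r2 -> h t - h u <= e.
    rewrite lt_min => /andP[tu1 tu2].
    have vv v : `|val01 v - val01 v| < r1 by rewrite subrr normr0.
    have ut1 : `|val01 u - val01 t| < r1 by rewrite distrC.
    have h1 := qr _ _ _ _ (vv t) tu1.
    have h2 := qr _ _ _ _ (vv u) ut1.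
    have h3 := mr _ _ tu2.
    have := ha [:: (x, t); (- x, u)].
    rewrite /dual /quad !comb_cons !comb_nil !addr0.
    have -> : x * (h t - m t) + - x * (h u - m u) -
      (x * (x * q t t + - x * q u t) + - x * (x * q t u + - x * q u u)) / 2 =
      x * ((h t - m t) - (h u - m u) -
           x * ((q t t - q t u) + (q u u - q u t)) / 2) by field.
    rewrite -ler_pdivlMl// => h4.
    have xa : x^-1 * a <= e / 4.
      rewrite (@le_trans _ _ (x^-1 * (`|a| + 1)))//.
        by rewrite ler_wpM2l// ?invr_ge0 ?(ltW x0)// (le_trans (ler_norm a))// lerDl.
      have -> // : x^-1 * (`|a| + 1) = e / 4.
      by rewrite /x; field; rewrite ?gt_eqF.
    have xq : x * ((q t t - q t u) + (q u u - q u t)) <= e / 2.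
      have -> : e / 2 = x * (e / (4 * x) + e / (4 * x)) by field; rewrite gt_eqF.
      rewrite ler_wpM2l ?(ltW x0)// lerD//.
        by rewrite (le_trans (ler_norm _))// ltW.
      by rewrite (le_trans (ler_norm _))// ltW.
    move: h3; rewrite ltr_norml => /andP[? ?].
    by move: h4 xa xq; move: (x * _) (x^-1 * a) => z1 z2; lra.
  move=> t u tu; rewrite ler_norml; apply/andP; split; last exact: up.
  by rewrite lerNl opprB; apply: up; rewrite distrC.
- move=> t; exists (`|a| + `|m t| + `|q t t|) => h ha.
  have := ha [:: (1, t)]; have := ha [:: (-1, t)].
  rewrite /dual /quad !comb1 !mulN1r !mul1r opprK /=.
  have := ler_norm a; have := ler_norm (m t); have := ler_norm (- m t).
  have := ler_norm (q t t); have := ler_norm (- (q t t)).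
  rewrite !normrN; have := normr_ge0 (q t t).
  move=> *; rewrite ler_norml; apply/andP; split; lra.
Qed.

End rate_function.

(* Where [G] fails, [expR Z] is dominated either on [O], by splitting
   according to the sign of [Z - b], or by [expR (Z + W i)]. *)
Lemma tilting_inequality (R : realType) (d : measure_display) (T : measurableType d)
    (P : probability T R) (I : eqType) (l : seq I) (Z : T -> R) (W : I -> T -> R)
    (G O : set T) (g b : R) :
    measurable_fun setT Z -> (forall i, measurable_fun setT (W i)) ->
    measurable G -> measurable O ->
    (forall w, G w -> Z w <= g) ->
    (forall w, [\/ G w, O w | exists2 i, i \in l & 0 <= W i w]) ->
  (\int[P]_w (expR (Z w))%:E <=
   (expR g)%:E * P G + ((expR b)%:E * P O +
     (expR (- b))%:E * \int[P]_w (expR (2 * Z w))%:E) +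
   \sum_(i <- l) \int[P]_w (expR (Z w + W i w))%:E)%E.
Proof.
move=> mZ mW mG mO Gg cover.
have mE (f : T -> R) : measurable_fun setT f ->
    measurable_fun setT (fun w => (expR (f w))%:E).
  by move=> mf; apply/measurable_EFinP; exact: measurableT_comp.
have m2Z : measurable_fun setT (fun w => (expR (2 * Z w))%:E).
  by apply: mE; exact: measurable_funM.
have mI (A : set T) : measurable A -> measurable_fun setT (fun w => (\1_A w)%:E : \bar R).
  by move=> mA; apply/measurable_EFinP; exact: measurable_indic.
have mcI (c : R) (A : set T) : measurable A ->
    measurable_fun setT (fun w => c%:E * (\1_A w)%:E)%E.
  by move=> mA; apply: measurable_funeM; exact: mI.
have mb2Z : measurable_fun setT (fun w => (expR (- b))%:E * (expR (2 * Z w))%:E)%E.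
  exact: measurable_funeM.
have mS : measurable_fun setT (fun w => \sum_(i <- l) (expR (Z w + W i w))%:E)%E.
  apply: emeasurable_sum => i; apply: (mE (fun w => Z w + W i w)).
  exact: (measurable_funD mZ (mW i)).
have cIE c (A : set T) : 0 <= c -> measurable A ->
    (c%:E * P A = \int[P]_w (c%:E * (\1_A w)%:E))%E.
  move=> c0 mA; rewrite ge0_integralZl//; last exact: mI.
  by rewrite (@integral_indic _ _ _ P setT measurableT A mA) setIT.
rewrite !cIE ?expR_ge0// -ge0_integralZl ?lee_fin ?expR_ge0//.
rewrite -ge0_integral_sum//; last first.
  move=> i; apply: (mE (fun w => Z w + W i w)).
  exact: (measurable_funD mZ (mW i)).
have mOZ : measurable_fun setT (fun w => (expR b)%:E * (\1_O w)%:E +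
    (expR (- b))%:E * (expR (2 * Z w))%:E)%E.
  by apply: emeasurable_funD => //; exact: mcI.
have OZ0 w : (0 <= (expR b)%:E * (\1_O w)%:E +
    (expR (- b))%:E * (expR (2 * Z w))%:E)%E.
  by rewrite -!EFinM -EFinD lee_fin addr_ge0// mulr_ge0 ?expR_ge0.
have mGOZ : measurable_fun setT (fun w => (expR g)%:E * (\1_G w)%:E +
    ((expR b)%:E * (\1_O w)%:E + (expR (- b))%:E * (expR (2 * Z w))%:E))%E.
  by apply: emeasurable_funD => //; exact: mcI.
have GOZ0 w : (0 <= (expR g)%:E * (\1_G w)%:E +
    ((expR b)%:E * (\1_O w)%:E + (expR (- b))%:E * (expR (2 * Z w))%:E))%E.
  by apply: adde_ge0 => //; rewrite -EFinM lee_fin mulr_ge0 ?expR_ge0.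
have S0 w : (0 <= \sum_(i <- l) (expR (Z w + W i w))%:E)%E.
  by apply: sume_ge0 => i _; rewrite lee_fin expR_ge0.
rewrite -!ge0_integralD//; [|exact: mcI|exact: mcI].
apply: ge0_le_integral => //.
- exact: mE.
- exact: emeasurable_funD.
move=> w _; rewrite -!EFinM sumEFin -!EFinD lee_fin.
have s0 : 0 <= \sum_(i <- l) expR (Z w + W i w) by rewrite sumr_ge0// => i _; rewrite expR_ge0.
have z0 : 0 <= expR (- b) * expR (2 * Z w) by rewrite mulr_ge0 ?expR_ge0.
have g0 : 0 <= expR g * \1_G w by rewrite mulr_ge0 ?expR_ge0.
have b0 : 0 <= expR b * \1_O w by rewrite mulr_ge0 ?expR_ge0.
case: (cover w) => [Gw|Ow|[i il Wi]].
- have : expR (Z w) <= expR g * \1_G w by rewrite indicE mem_set// mulr1 ler_expR Gg.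
  by lra.
- have [Zb|bZ] := leP (Z w) b.
    have : expR (Z w) <= expR b * \1_O w by rewrite indicE mem_set// mulr1 ler_expR.
    by lra.
  have : expR (Z w) <= expR (- b) * expR (2 * Z w).
    by rewrite -expRD ler_expR; lra.
  by lra.
- have : expR (Z w) <= \sum_(i <- l) expR (Z w + W i w).
    rewrite (big_rem i)//= ler_wpDr//.
      by rewrite sumr_ge0// => k _; rewrite expR_ge0.
    by rewrite ler_expR lerDl.
  by lra.
Qed.

Lemma near_all_seq (T : Type) (F : set_system T) {FF : Filter F} (I : eqType)
    (l : seq I) (P : I -> T -> Prop) : (forall i, \forall e \near F, P i e) ->
  \forall e \near F, forall i, i \in l -> P i e.
Proof.
move=> FP; elim: l => [|i l ih]; first by apply: nearW => e i; rewrite in_nil.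
near=> e => j; rewrite inE => /orP[/eqP ->|jl].
  by near: e; exact: FP.
by have : forall i, i \in l -> P i e; [near: e; exact: ih|exact].
Unshelve. all: by end_near. Qed.

(** * The lower bound for open sets *)

Section lower_bound.
Variables (R : realType).
Variables (d : R -> measure_display) (T : forall e, measurableType (d e)).
Variables (Q : forall e, probability (T e) R).
Variables (U : forall e, {RV (Q e) >-> borel (C01 R)}).
Variables (gamma : R -> R).
Hypothesis gamma_gt0 : forall e : R, 0 < e -> 0 < gamma e.
Hypothesis gamma0 : gamma e @[e --> 0^'+] --> (0 : R).
Variables (me : R -> I01 R -> R) (K : R -> I01 R -> I01 R -> R).
Variables (m : I01 R -> R) (q : I01 R -> I01 R -> R).
Hypothesis cm : continuous m.
Hypothesis cq : continuous (fun p : I01 R * I01 R => q p.1 p.2).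
Hypothesis qC : forall t u, q t u = q u t.
Hypothesis q_ge0 : forall s, 0 <= quad q s s.
Hypothesis centered_gaussian : \forall e \near 0^'+, forall s : seq (R * I01 R),
  gaussian (Q e) (fun w => comb s (fun t => centered U me t w)) 0 (quad (K e) s s).
Hypothesis me_lim : forall x : R, 0 < x -> \forall e \near 0^'+,
  forall t, `|m t - me e t| < x.
Hypothesis K_lim : forall x : R, 0 < x -> \forall e \near 0^'+,
  forall t u, `|q t u - K e t u / gamma e ^+ 2| < x.
Hypothesis equicontinuous : forall a del : R, 0 < del -> exists2 r : R, 0 < r &
  exp_small gamma a (fun e => Q e (U e @^-1` ~` steady r del)).

Let shift (s : seq (R * I01 R)) (t : I01 R) : R := comb s (fun u => q t u).

Let continuous_shift s : continuous (shift s).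
Proof.
by apply: (@continuous_comb _ _ _ s (fun u t => q t u)) => u; exact: continuous_section'.
Qed.

(* Under the measure with density proportional to
   [expR (comb s centered / gamma ^ 2)], the variable [comb p centered]
   concentrates at [quad q p s]. *)
Let tilt (x : R) (s p : seq (R * I01 R)) (e : R) (w : T e) : R :=
  x / (quad q p p + 1) *
  (comb p (fun t => centered U me t w) - quad q p s - x) / gamma e ^+ 2.

(** The logarithm of the tilting density before normalization. *)
Let pot (s : seq (R * I01 R)) (e : R) (w : T e) : R :=
  comb s (fun t => centered U me t w) / gamma e ^+ 2.

(** The rate - quad q s s / 2 is that of the total mass of the unnormalized tilted measure, so this
    term is negligible against it. The slope x / (quad q p p + 1) keeps the quadratic cost below
    half of the linear gain. *)
Lemma tilt_small (x : R) (s p : seq (R * I01 R)) : 0 < x ->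
  rate_gt gamma (- (quad q s s / 2))
    (fun e => \int[Q e]_w (expR (pot s w + tilt x s p w))%:E)%E.
Proof.
move=> x0; have p1 : 0 < quad q p p + 1 by rewrite ltr_wpDl.
pose th := x / (quad q p p + 1); have th0 : 0 < th by rewrite divr_gt0.
pose l := s ++ scal th p.
pose f e := quad (K e) l l / gamma e ^+ 2 / 2 - th * (quad q p s + x).
apply: (@rate_gt_le _ _ _ _ (fun e => (expR (f e / gamma e ^+ 2))%:E)).
  near=> e.
  have hG : forall s : seq (R * I01 R), gaussian (Q e)
    (fun w => comb s (fun t => centered U me t w)) 0 (quad (K e) s s) by near: e.
  under eq_integral => w _.
    have -> : pot s w + tilt x s p w =
        (gamma e ^+ 2)^-1 * comb l (fun t => centered U me t w) +
        (- (th * (quad q p s + x) / gamma e ^+ 2)).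
      by rewrite /pot /tilt comb_cat comb_scal -/th; ring.
    rewrite expRD EFinM muleC.
    over.
  rewrite ge0_integralZl//=; first last.
  - apply/measurable_EFinP; apply: measurableT_comp => //.
    by apply: measurable_funM => //; have [] := hG l.
  rewrite (gaussian_mgf (hG l)) -EFinM -expRD lee_fin ler_expR le_eqVlt.
  by apply/orP; left; apply/eqP; rewrite /f; ring.
have QE : quad q l l = quad q s s + 2 * (th * quad q p s) + th ^+ 2 * quad q p p.
  by rewrite quad_cat// quadZ quadZr (quadC _ _ qC); ring.
have thq : th * quad q p p <= x.
  by rewrite /th mulrAC ler_pdivrMr// ler_pM2l// lerDl.
have thx : 0 < th * x by rewrite mulr_gt0.
(* Gain th x, cost at most th x / 2, covariance error at most th x / 4: a quarter remains. *)
apply: (@rate_gt_exp _ _ gamma_gt0 gamma0 _ (- (quad q s s / 2) + th * x / 4)).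
  by lra.
near=> e.
have : `|quad q l l - quad (K e) l l / gamma e ^+ 2| < th * x / 2.
  near: e; apply: (quad_K_lim K_lim); lra.
rewrite /f QE ltr_norml; move: (quad (K e) l l / _) => k /andP[h _].
have h2 : th ^+ 2 * quad q p p <= th * x by rewrite expr2 -mulrA ler_pM2l.
move: h h2 (thx); rewrite [th * (_ + _)]mulrDr.
move: (th * x) (th ^+ 2 * _) (th * quad q p s) (quad q s s) => a1 a2 a3 a4; lra.
Unshelve. all: by end_near. Qed.

(** [A] asks for a modulus of continuity and for finitely many combinations to stay below their
    tilted means plus 2 x. Off [A] the tilted mass is negligible; on [A] the density is at most exp
    ((quad q s s + 3 x) / gamma^2). Comparison with a total mass of about exp (quad q s s / (2
    gamma^2)) bounds the probability of [A] from below. *)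
Lemma tilted_bound (s : seq (R * I01 R)) (del eta : R) : 0 < del -> 0 < eta ->
  exists2 A : set (C01 R), measurable (A : set (borel (C01 R))) /\
    (forall f, A f -> forall t, `|f t - (m t + shift s t)| <= del) &
  \forall e \near 0^'+,
    ((expR (- (quad q s s / 2 + eta) / gamma e ^+ 2))%:E <= Q e (U e @^-1` A))%E.
Proof.
(* The deviation 2 x takes a third of [del], the two moduli of continuity the other thirds; the
   exponent loses 4 x in all, less than [eta]. *)
move=> del0 eta0; pose x := Num.min (del / 6) (eta / 5).
have x0 : 0 < x by rewrite lt_min; apply/andP; split; exact: divr_gt0.
have xdel : x <= del / 6 by rewrite ge_min lexx.
have xeta : x <= eta / 5 by rewrite ge_min lexx orbT.
have del3 : 0 < del / 3 by rewrite divr_gt0.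
pose Qs := quad q s s; have Qs0 : 0 <= Qs by exact: q_ge0.
(* The level at which the density is cut where the modulus fails: its second moment has exponent
   about 2 Qs, so both sides of the cut keep a positive rate. *)
pose B := 2 * Qs + 1.
have [r1 r10 osc] := equicontinuous (B + 1) del3.
have ch : continuous (fun t => m t + shift s t) by exact: continuous_add.
have [r2 r20 hmod] := unif_continuous01 ch del3.
have [N _ hN] : \forall N \near \oo, N.+1%:R^-1 < Num.min r1 r2.
  by apply: near_inv_lt; rewrite lt_min r10.
have {}hN : N.+1%:R^-1 < Num.min r1 r2 := hN N (leqnn N).
(* The entry [s] bounds the density on [A]; the masses 1 and -1 at the grid points confine the path
   from both sides. *)
pose l := s :: [seq [:: (1, pt R N i)] | i <- iota 0 N.+2] ++
               [seq [:: (-1, pt R N i)] | i <- iota 0 N.+2].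
pose A : set (C01 R) := steady r1 (del / 3) `&`
  \bigcap_(p in [set` l]) ~` [set f : C01 R | comb p m + quad q p s + 2 * x < comb p f].
have mst : measurable (steady r1 (del / 3) : set (borel (C01 R))).
  by apply: measurable_closed; exact: closed_steady.
have mA : measurable (A : set (borel (C01 R))).
  apply: measurable_closed; apply: closedI; first exact: closed_steady.
  by apply: closed_bigI => p _; apply: open_closedC; exact: open_comb_gt.
have AP f p : A f -> p \in l -> comb p f <= comb p m + quad q p s + 2 * x.
  by move=> [_ h] pl; have := h _ pl; rewrite /= ltNge => /negP; rewrite negbK.
exists A.
  split => // f Af t.
  have [i iN it] := cell_ex N t.
  have tp : `|val01 t - val01 (pt R N i)| < Num.min r1 r2.
    by rewrite (lt_trans (cell_pt it)).
  move: tp; rewrite lt_min => /andP[tp1 tp2].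
  have h1 := Af.1 _ _ tp1; have h2 := hmod _ _ tp2.
  have ii : i \in iota 0 N.+2 by rewrite mem_iota add0n.
  have qE c v : quad q [:: (c, v)] s = c * shift s v.
    by rewrite /quad comb1; congr (_ * _); apply: eq_comb => u; exact: qC.
  have p1 : [:: (1, pt R N i)] \in l.
    by rewrite inE mem_cat (map_f (fun i => [:: (1, pt R N i)]) ii) orbT.
  have p2 : [:: (-1, pt R N i)] \in l.
    by rewrite inE mem_cat (map_f (fun i => [:: (-1, pt R N i)]) ii) !orbT.
  have := AP _ _ Af p1; have := AP _ _ Af p2; rewrite !qE !comb1 !mul1r !mulN1r.
  move: h1 h2; rewrite ler_norml ltr_norml => /andP[? ?] /andP[? ?] ? ?.
  by rewrite ler_norml; apply/andP; split; lra.
pose rem e : \bar R := ((expR (B / gamma e ^+ 2))%:E * Q e (U e @^-1` ~` steady r1 (del / 3)) +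
  (expR (- (B / gamma e ^+ 2)))%:E * \int[Q e]_w (expR (2 * pot s w))%:E +
  \sum_(p <- l) \int[Q e]_w (expR (pot s w + tilt x s p w))%:E)%E.
have remS : rate_gt gamma (- (Qs / 2)) rem.
  apply: (rate_gtD gamma_gt0 gamma0); last first.
    by apply: (rate_gt_sum gamma_gt0 gamma0) => p; exact: tilt_small.
  apply: (rate_gtD gamma_gt0 gamma0).
    exists 1; first lra.
    near=> e; have [g0 _] : 0 < gamma e /\ 0 <= (gamma e ^+ 2)^-1.
      by near: e; exact: near_scale.
    have he : (Q e (U e @^-1` ~` steady r1 (del / 3)) <=
      (expR (- (B + 1) / gamma e ^+ 2))%:E)%E by near: e.
    have -> : - 1 / gamma e ^+ 2 = B / gamma e ^+ 2 + (- (B + 1) / gamma e ^+ 2) by ring.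
    by rewrite expRD EFinM lee_wpmul2l// lee_fin expR_ge0.
  pose f e := 2 * (quad (K e) s s / gamma e ^+ 2) - B.
  apply: (@rate_gt_le _ _ _ _ (fun e => (expR (f e / gamma e ^+ 2))%:E)).
    near=> e.
    have hG : forall s : seq (R * I01 R), gaussian (Q e)
      (fun w => comb s (fun t => centered U me t w)) 0 (quad (K e) s s) by near: e.
    have potE (w : T e) : 2 * pot s w =
        (2 / gamma e ^+ 2) * comb s (fun t => centered U me t w) by rewrite /pot; ring.
    under eq_integral do rewrite potE.
    rewrite (gaussian_mgf (hG s)) -EFinM -expRD lee_fin ler_expR le_eqVlt.
    by apply/orP; left; apply/eqP; rewrite /f mulr0; move: (quad (K e) s s) (gamma e ^+ 2)^-1 => k z; field.
  apply: (@rate_gt_exp _ _ gamma_gt0 gamma0 _ (1 / 2)); first lra.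
  near=> e; have : `|quad q s s - quad (K e) s s / gamma e ^+ 2| < 1 / 4.
    by near: e; apply: (quad_K_lim K_lim).
  rewrite /f /B -/Qs ltr_norml; move: (quad (K e) s s / _) => k /andP[? ?]; lra.
have [b0 b0Q /= remb0] := remS.
(* Capped near - Qs / 2, because exp (- b / gamma^2) also serves as lower bound for the mass left on
   [A]. *)
pose b := Num.min b0 (- (Qs / 2) + x).
have bQ : - (Qs / 2) < b by rewrite lt_min b0Q ltrDl.
have bx : b <= - (Qs / 2) + x by rewrite ge_min lexx orbT.
have remb : exp_small gamma b rem.
  by apply: (exp_smallW gamma_gt0 gamma0) remb0; rewrite ge_min lexx.
(* Strictly between, so that twice exp (- b / gamma^2) fits under the total mass: one copy cancels
   the remainder, the other is left for [A]. *)
pose y := (- (Qs / 2) + b) / 2.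
have yb : y < b by rewrite /y; lra.
have yQ : - (Qs / 2) < y by rewrite /y; lra.
pose E e := (expR (- b / gamma e ^+ 2))%:E.
have Eb : exp_small gamma b E by near=> e.
have E2 : exp_small gamma y (fun e => E e + E e)%E by exact: (exp_smallD gamma_gt0 gamma0 yb Eb Eb).
near=> e.
have [g0 _] : 0 < gamma e /\ 0 <= (gamma e ^+ 2)^-1.
  by near: e; exact: near_scale.
have g20 : 0 < (gamma e ^+ 2)^-1 by rewrite invr_gt0 exprn_gt0.
have hG : forall s : seq (R * I01 R), gaussian (Q e)
  (fun w => comb s (fun t => centered U me t w)) 0 (quad (K e) s s) by near: e.
have hm : forall p, p \in l -> `|comb p m - comb p (me e)| < x.
  near: e; apply: (@near_all_seq) => p; exact: comb_me_lim.
have mcomb p : measurable_fun setT (fun w : T e => comb p (fun t => centered U me t w)).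
  by have [] := hG p.
have mpot : measurable_fun setT (fun w : T e => pot s w).
  exact: measurable_funM.
have mtilt p : measurable_fun setT (fun w : T e => tilt x s p w).
  apply: measurable_funM => //; apply: measurable_funM => //.
  by apply: measurable_funB => //; apply: measurable_funB.
have mGA : measurable (U e @^-1` A) by exact: measurable_path_set.
have mO : measurable (U e @^-1` ~` steady r1 (del / 3)).
  by apply: measurable_path_set; exact: (@measurableC _ (borel (C01 R))).
have hGA w : (U e @^-1` A) w -> pot s w <= (Qs + 3 * x) / gamma e ^+ 2.
  move=> Aw; rewrite /pot ler_pM2r//.
  have := AP _ _ Aw (mem_head _ _); have := hm _ (mem_head _ _).
  by rewrite /centered combB -/Qs ltr_norml => /andP[? ?] ?; lra.
have cover w : [\/ (U e @^-1` A) w, (U e @^-1` ~` steady r1 (del / 3)) w |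
    exists2 p, p \in l & 0 <= tilt x s p w].
  have [st|nst] := pselect (steady r1 (del / 3) (U e w : C01 R)); last by constructor 2.
  have [//|nA] := pselect (A (U e w)); first by constructor 1.
  constructor 3; apply: contrapT => h; apply: nA; split => // p pl /= pw; apply: h.
  exists p => //; rewrite /tilt mulr_ge0 ?(ltW g20)// mulr_ge0//.
    by rewrite divr_ge0 ?(ltW x0)// addr_ge0.
  have := hm _ pl; rewrite /centered combB ltr_norml => /andP[? ?]; lra.
have := @tilting_inequality _ _ _ (Q e) _ l (fun w => pot s w)
  (fun p w => tilt x s p w) _ _ ((Qs + 3 * x) / gamma e ^+ 2) (B / gamma e ^+ 2)
  mpot mtilt mGA mO hGA cover.
rewrite -addeA -/(rem e).
have potE : (\int[Q e]_w (expR (pot s w))%:E =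
    (expR (quad (K e) s s / gamma e ^+ 2 / 2 / gamma e ^+ 2))%:E)%E.
  have potC (w : T e) : pot s w = (gamma e ^+ 2)^-1 * comb s (fun t => centered U me t w).
    exact: mulrC.
  under eq_integral do rewrite potC.
  by rewrite (gaussian_mgf (hG s)); congr (expR _)%:E; ring.
rewrite potE => main.
have hQ : `|quad q s s - quad (K e) s s / gamma e ^+ 2| < 2 * (y + Qs / 2).
  by near: e; apply: (quad_K_lim K_lim); lra.
have EE : (E e + E e <= (expR (- y / gamma e ^+ 2))%:E)%E by near: e.
have remE : (rem e <= E e)%E by near: e.
have low : ((expR (- y / gamma e ^+ 2))%:E <=
    (expR (quad (K e) s s / gamma e ^+ 2 / 2 / gamma e ^+ 2))%:E)%E.
  rewrite lee_fin ler_expR ler_pM2r//; move: hQ; rewrite -/Qs ltr_norml.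
  by move: (quad (K e) s s / _) => k /andP[? ?]; lra.
have : (E e + E e <= (expR ((Qs + 3 * x) / gamma e ^+ 2))%:E * Q e (U e @^-1` A) + E e)%E.
  by apply: (le_trans EE); apply: (le_trans low); apply: (le_trans main); exact: leeD2l.
rewrite leeD2rE// => fin.
have -> : - (Qs / 2 + eta) / gamma e ^+ 2 =
  - ((Qs + 3 * x) / gamma e ^+ 2) + (Qs / 2 + 3 * x - eta) / gamma e ^+ 2.
  by move: (gamma e ^+ 2)^-1 (Qs) (x) => z a c; field.
rewrite expRD EFinM.
apply: (@le_trans _ _ ((expR (- ((Qs + 3 * x) / gamma e ^+ 2)))%:E * E e)%E).
  rewrite lee_wpmul2l ?lee_fin ?expR_ge0// ler_expR ler_pM2r//; lra.
apply: (le_trans (lee_wpmul2l _ fin)); first by rewrite lee_fin expR_ge0.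
by rewrite muleA -EFinM -expRD addNr expR0 mul1e.
Unshelve. all: by end_near. Qed.

End lower_bound.

(** * The large deviation principle for a Gaussian family *)

Section gaussian_ldp.
Variables (R : realType).
Variables (d : R -> measure_display) (T : forall e, measurableType (d e)).
Variables (Q : forall e, probability (T e) R).
Variables (U : forall e, {RV (Q e) >-> borel (C01 R)}).
Variables (gamma : R -> R).
Hypothesis gamma_gt0 : forall e : R, 0 < e -> 0 < gamma e.
Hypothesis gamma0 : gamma e @[e --> 0^'+] --> (0 : R).
Variables (me : R -> I01 R -> R) (K : R -> I01 R -> I01 R -> R).
Variables (m : I01 R -> R) (q : I01 R -> I01 R -> R).
Hypothesis cm : continuous m.
Hypothesis cq : continuous (fun p : I01 R * I01 R => q p.1 p.2).
Hypothesis qC : forall t u, q t u = q u t.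
Hypothesis centered_gaussian : \forall e \near 0^'+, forall s : seq (R * I01 R),
  gaussian (Q e) (fun w => comb s (fun t => centered U me t w)) 0 (quad (K e) s s).
Hypothesis me_lim : forall x : R, 0 < x -> \forall e \near 0^'+,
  forall t, `|m t - me e t| < x.
Hypothesis K_lim : forall x : R, 0 < x -> \forall e \near 0^'+,
  forall t u, `|q t u - K e t u / gamma e ^+ 2| < x.
Hypothesis centered_small : forall x : R, 0 < x -> \forall e \near 0^'+,
  forall s : seq (I01 R),
    ((2^-1)%:E <= Q e [set w | forall t, t \in s -> (`|centered U me t w| <= x)%R])%E.

Lemma quad_lim_ge0 s : 0 <= quad q s s.
Proof.
rewrite leNgt; apply/negP => qs.
have /filter_ex[//] : \forall e \near (0 : R)^'+, False.
near=> e.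
have [g0 _] : 0 < gamma e /\ 0 <= (gamma e ^+ 2)^-1.
  by near: e; exact: near_scale.
have hG : forall s : seq (R * I01 R), gaussian (Q e)
  (fun w => comb s (fun t => centered U me t w)) 0 (quad (K e) s s) by near: e.
have [_ k0 _] := hG s.
have : `|quad q s s - quad (K e) s s / gamma e ^+ 2| < - quad q s s.
  by near: e; apply: (quad_K_lim K_lim); rewrite oppr_gt0.
have : 0 <= quad (K e) s s / gamma e ^+ 2 by rewrite divr_ge0// exprn_ge0// ltW.
move: (quad (K e) s s / _) => k ?; rewrite ltr_norml => /andP[? ?]; lra.
Unshelve. all: by end_near. Qed.

Let equicontinuous (a del : R) : 0 < del -> exists2 r : R, 0 < r &
  exp_small gamma a (fun e => Q e (U e @^-1` ~` steady r del)).
Proof.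
exact: (exp_equicontinuous gamma_gt0 gamma0 cm cq centered_gaussian me_lim K_lim
  centered_small).
Qed.

Lemma open_bound (G : set (C01 R)) (h : C01 R) (eps : R) : open G -> G h ->
    rkhs q (fun t => h t - m t) -> 0 < eps ->
  \forall e \near 0^'+,
    ((expR (- (2^-1 * rkhs_sqnorm q (fun t => h t - m t) + eps) / gamma e ^+ 2))%:E
       <= Q e (U e @^-1` G))%E.
Proof.
move=> oG Gh rh eps0.
have /nbhs_ballP [r /= r0 rG] : nbhs h G by exact: open_nbhs_nbhs.
have r4 : 0 < Num.min (r / 4) eps by rewrite lt_min eps0 divr_gt0.
have [s [hs qs]] := rkhs_approx cq qC quad_lim_ge0 rh r4.
have del0 : 0 < r / 4 by rewrite divr_gt0.
have eta0 : 0 < eps / 2 by rewrite divr_gt0.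
have [A [mA AG] low] := tilted_bound gamma_gt0 gamma0 cm cq qC quad_lim_ge0
  centered_gaussian me_lim K_lim equicontinuous s del0 eta0.
have A_G : A `<=` G.
  move=> f Af; apply: rG; apply/ballC01E => t.
  have := AG _ Af t; have := hs t; rewrite lt_min => /andP[+ _].
  rewrite ltr_norml !ler_norml => /andP[? ?] /andP[? ?].
  by rewrite ltr_norml; apply/andP; split; lra.
near=> e.
have [g0 _] : 0 < gamma e /\ 0 <= (gamma e ^+ 2)^-1.
  by near: e; exact: near_scale.
have g20 : 0 < (gamma e ^+ 2)^-1 by rewrite invr_gt0 exprn_gt0.
have lowe : ((expR (- (quad q s s / 2 + eps / 2) / gamma e ^+ 2))%:E <=
  Q e (U e @^-1` A))%E by near: e.
apply: (@le_trans _ _ (expR (- (quad q s s / 2 + eps / 2) / gamma e ^+ 2))%:E).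
  rewrite lee_fin ler_expR ler_pM2r// lerN2.
  have me' : Num.min (r / 4) eps <= eps by rewrite ge_min lexx orbT.
  by move: qs; move: (rkhs_sqnorm _ _) (quad _ _ _) => n1 n2; lra.
apply: (le_trans lowe); apply: le_measure; rewrite ?inE.
- exact: measurable_path_set.
- by apply: measurable_path_set; exact: measurable_open.
- by move=> w; exact: A_G.
Unshelve. all: by end_near. Qed.

(** Compactness and the upper bound go through [I_le], which reads a level set of the rate as a
    bound on the dual functional; the lower bound is [open_bound] at each path of finite rate. *)
Lemma gaussian_LDP (I : C01 R -> \bar R) :
    (forall h : C01 R, I h = if `[< rkhs q (fun t => h t - m t) >]
       then (2^-1 * rkhs_sqnorm q (fun t => h t - m t))%:E else +oo%E) ->
  LDP gamma U I.
Proof.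
move=> IE.
have cg (h : C01 R) : continuous (fun t => h t - m t).
  by apply: continuous_sub => //; exact: path_continuous.
have I_le (h : C01 R) (a : R) :
    (I h <= a%:E)%E <-> forall s, dual q (fun t => h t - m t) s <= a.
  split=> [|ha].
    rewrite IE; case: asboolP => // rh; rewrite lee_fin => Ia.
    by apply: (rkhs_dual_le cq qC quad_lim_ge0 a (cg h)).1.
  have [rh Ia] := (rkhs_dual_le cq qC quad_lim_ge0 a (cg h)).2 ha.
  by rewrite IE asboolT.
split=> //.
- move=> a; have -> : [set h | (I h <= a%:E)%E] =
      [set h : C01 R | forall s, dual q (fun t => h t - m t) s <= a].
    by apply/seteqP; split=> h /I_le.
  exact: compact_level.
- move=> G oG; rewrite leeNl; apply: le_ereal_inf_tmp => _ [h Gh <-].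
  rewrite IE; case: asboolP => [rh|_]; last by rewrite leey.
  apply/lee_addgt0Pr => eps eps0; rewrite leeNl -EFinD limf_einfE.
  set i := 2^-1 * _ + eps.
  pose V := [set e : R | ((- i)%:E <= (gamma e ^+ 2)%:E * lne (Q e (U e @^-1` G)))%E].
  have VF : (0 : R)^'+ V.
    have low := open_bound oG Gh rh eps0.
    near=> e; rewrite /V/=.
    have [g0 _] : 0 < gamma e /\ 0 <= (gamma e ^+ 2)^-1.
      by near: e; exact: near_scale.
    have g20 : 0 < gamma e ^+ 2 by rewrite exprn_gt0.
    have lowe : ((expR (- i / gamma e ^+ 2))%:E <= Q e (U e @^-1` G))%E by near: e.
    have : ((- i / gamma e ^+ 2)%:E <= lne (Q e (U e @^-1` G)))%E.
      rewrite -[X in (X <= _)%E](expeRK (- i / gamma e ^+ 2)%:E) lee_lne//.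
        by rewrite in_itv/= leey andbT lee_fin expR_ge0.
      by rewrite in_itv/= leey andbT.
    move=> /(@lee_wpmul2l _ (gamma e ^+ 2)%:E) h1.
    apply: le_trans (h1 _); last by rewrite lee_fin ltW.
    by rewrite -EFinM mulrC divfK// gt_eqF.
  apply: (@le_trans _ _ (ereal_inf
    ((fun e => (gamma e ^+ 2)%:E * lne (Q e (U e @^-1` G)))%E @` V))).
    by apply: le_ereal_inf_tmp => _ [e Ve <-].
  by apply: ereal_sup_ubound; exists V.
- move=> F clF; set L := limf_esup _ _; set J := ereal_inf _.
  have key (a : R) : (a%:E < J)%E ->
      (L <= - a%:E)%E.
    move=> aF.
    have [b ab hb] : rate_gt gamma a (fun e => Q e (U e @^-1` F)).
      apply: (closed_bound gamma_gt0 gamma0 centered_gaussian me_lim K_lim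
        equicontinuous clF) => h Fh.
      apply: contrapT => nh.
      have /I_le : forall s, dual q (fun t => h t - m t) s <= a.
        by move=> s; rewrite leNgt; apply/negP => ?; apply: nh; exists s.
      rewrite leNgt => /negP; apply; apply: (lt_le_trans aF).
      by apply: ereal_inf_lbound; exists h.
    pose V := [set e : R | ((gamma e ^+ 2)%:E * lne (Q e (U e @^-1` F)) <= (- a)%:E)%E].
    have VF : (0 : R)^'+ V.
      near=> e; rewrite /V/=.
      have [g0 _] : 0 < gamma e /\ 0 <= (gamma e ^+ 2)^-1.
        by near: e; exact: near_scale.
      have g20 : 0 < gamma e ^+ 2 by rewrite exprn_gt0.
      have upe : (Q e (U e @^-1` F) <= (expR (- b / gamma e ^+ 2))%:E)%E by near: e.
      have : (lne (Q e (U e @^-1` F)) <= (- b / gamma e ^+ 2)%:E)%E.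
        rewrite -[X in (_ <= X)%E](expeRK (- b / gamma e ^+ 2)%:E) lee_lne//.
          by rewrite in_itv/= leey andbT.
        by rewrite in_itv/= leey andbT lee_fin expR_ge0.
      move=> /(@lee_wpmul2l _ (gamma e ^+ 2)%:E) h1.
      apply: le_trans (h1 _) _; first by rewrite lee_fin ltW.
      by rewrite -EFinM mulrC divfK ?gt_eqF// lee_fin lerN2 ltW.
    rewrite /L limf_esupE; apply: (@le_trans _ _ (ereal_sup
      ((fun e => (gamma e ^+ 2)%:E * lne (Q e (U e @^-1` F)))%E @` V))).
      by apply: ereal_inf_lbound; exists V.
    by apply: ge_ereal_sup => _ [e Ve <-].
  move: key; case: J => [r||] key.
  + apply/lee_addgt0Pr => eps eps0; rewrite -EFinN -EFinD.
    have -> : - r + eps = - (r - eps) by ring.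
    by apply: key; rewrite lte_fin ltrBlDr ltrDl.
  (* With an infinite infimum, bounds by - a for every real [a] leave only -oo for the upper
     limit. *)
  + move: key; case: L => [r||] key; last by rewrite leNye.
      have := key (1 - r) (ltry _); rewrite -EFinN lee_fin => ?; exfalso; lra.
    by have := key 0 (ltry _).
  + by rewrite /= leey.
Unshelve. all: by end_near. Qed.

End gaussian_ldp.

(** * Finite-dimensional laws *)

Section finite_dimensional_laws.
Variable R : realType.

Let boxes n : set (set (n.-tuple R)) :=
  [set B | exists A : 'I_n -> set R, (forall i, measurable (A i)) /\
     B = [set x | forall i, A i (tnth x i)]].

Let measurable_tupleE n : (measurable : set (set (n.-tuple R))) = <<s @boxes n >>.
Proof.
apply/seteqP; split.
- apply: smallest_sub; first exact: smallest_sigma_algebra.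
  rewrite -bigcup_seq => B [i /= _ [Y mY <-]]; apply: sub_sigma_algebra.
  exists (fun j => if j == i then Y else setT); split.
    by move=> j; case: ifP.
  rewrite setTI; apply/seteqP; split=> x /= h.
    by move=> j; case: eqVneq => [->|].
  by have := h i; rewrite eqxx.
- apply: smallest_sub; first exact: sigma_algebra_measurable.
  move=> _ [A [mA ->]].
  have -> : [set x : n.-tuple R | forall i, A i (tnth x i)] =
      \bigcap_i [set x | A i (tnth x i)].
    by apply/seteqP; split=> x /= h i => [_|]; exact: h.
  apply: fin_bigcap_measurable => [|i _]; first exact: finite_finset.
  by have := measurable_tnth i measurableT (mA i); rewrite setTI.
Qed.

Variables (d1 d2 : measure_display) (T1 : measurableType d1) (T2 : measurableType d2).
Variables (P1 : probability T1 R) (P2 : probability T2 R).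

(** Measurable rectangles form a pi-system that generates the sigma-algebra of tuples. *)
Lemma eq_tuple_law n (U1 : 'I_n -> T1 -> R) (U2 : 'I_n -> T2 -> R) :
    (forall i, measurable_fun setT (U1 i)) -> (forall i, measurable_fun setT (U2 i)) ->
    (forall A : 'I_n -> set R, (forall i, measurable (A i)) ->
       P1 [set w | forall i, A i (U1 i w)] = P2 [set w | forall i, A i (U2 i w)]) ->
  forall B : set (n.-tuple R), measurable B ->
    P1 [set w | B [tuple U1 i w | i < n]] = P2 [set w | B [tuple U2 i w | i < n]].
Proof.
move=> m1 m2 eqB B mB.
have mt1 : measurable_fun setT (fun w => [tuple U1 i w | i < n]).
  apply/measurable_fun_tnthP => i; apply: eq_measurable_fun (m1 i) => w _ /=.
  by rewrite tnth_mktuple.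
have mt2 : measurable_fun setT (fun w => [tuple U2 i w | i < n]).
  apply/measurable_fun_tnthP => i; apply: eq_measurable_fun (m2 i) => w _ /=.
  by rewrite tnth_mktuple.
pose V1 : {RV P1 >-> n.-tuple R} := mfun_Sub (mem_set mt1).
pose V2 : {RV P2 >-> n.-tuple R} := mfun_Sub (mem_set mt2).
apply: (@measure_unique _ _ _ (@boxes n) (fun=> setT) _ _ _ _
  (distribution P1 V1) (distribution P2 V2)) => //.
- exact: measurable_tupleE.
- move=> _ _ [A [mA ->]] [A' [mA' ->]]; exists (fun i => A i `&` A' i); split.
    by move=> i; exact: measurableI.
  by apply/seteqP; split=> x /= => [[h h'] i|h]; [split|split=> i; have [] := h i].
- by move=> _; exists (fun=> setT); split => //; apply/seteqP; split.
- by rewrite bigcup_const//; exists 0%N.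
- move=> _ [A [mA ->]]; rewrite /distribution /pushforward /=.
  have := eqB _ mA; congr (_ = _); congr (_ _); apply/seteqP; split=> w /= h i;
    by have := h i; rewrite tnth_mktuple.
- by move=> _; apply: (@le_lt_trans _ _ 1%E); rewrite ?ltry// probability_le1.
Qed.

Variables (I : eqType) (U1 : I -> T1 -> R) (U2 : I -> T2 -> R).
Hypothesis mU1 : forall t, measurable_fun setT (U1 t).
Hypothesis mU2 : forall t, measurable_fun setT (U2 t).
Hypothesis U12 : same_fdd P1 P2 U1 U2.

(** The event is the preimage of a Borel set by an affine map, not a rectangle, hence the passage
    through the joint law. *)
Lemma same_fdd_gaussian (c : I -> R) (s : seq (R * I)) (mu v : R) :
  gaussian P2 (fun w => comb s (fun t => U2 t w - c t)) mu v ->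
  gaussian P1 (fun w => comb s (fun t => U1 t w - c t)) mu v.
Proof.
move=> [_ v0 law]; have mU (d : measure_display) (T : measurableType d) (U : I -> T -> R) :
    (forall t, measurable_fun setT (U t)) ->
    measurable_fun setT (fun w => comb s (fun t => U t w - c t)).
  move=> mU; rewrite /comb; apply: measurable_sum => p.
  by apply: measurable_funM => //; apply: measurable_funB.
split => //; first exact: mU.
move=> A mA; rewrite -law//.
pose p i := tnth (in_tuple s) i.
pose L (x : (size s).-tuple R) := \sum_i (p i).1 * (tnth x i - c (p i).2).
have mL : measurable_fun setT L.
  apply: measurable_sum => i; apply: measurable_funM => //.
  by apply: measurable_funB => //; exact: measurable_tnth.
have := @eq_tuple_law _ (fun i => U1 (p i).2) (fun i => U2 (p i).2)
  (fun i => mU1 _) (fun i => mU2 _) (fun A mA => U12 _ mA) (L @^-1` A).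
rewrite -[X in measurable X]setTI => /(_ (mL measurableT _ mA)).
have LE (T : Type) (U : I -> T -> R) w :
    L [tuple U (p i).2 w | i < size s] = comb s (fun t => U t w - c t).
  by rewrite /L /comb [RHS]big_tnth; apply: eq_bigr => i _; rewrite tnth_mktuple.
by congr (_ = _); congr (_ _); apply/seteqP; split=> w /=; rewrite LE.
Qed.

Lemma same_fdd_small (c : I -> R) (s : seq I) (x : R) :
  P1 [set w | forall t, t \in s -> `|U1 t w - c t| <= x] =
  P2 [set w | forall t, t \in s -> `|U2 t w - c t| <= x].
Proof.
pose p i := tnth (in_tuple s) i.
pose A i := [set z : R | `|z - c (p i)| <= x].
have mA i : measurable (A i).
  have -> : A i = `[c (p i) - x, c (p i) + x]%classic.
    by apply/seteqP; split=> z; rewrite /A/= in_itv/= ler_distl.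
  exact: measurable_itv.
have := U12 p mA.
have AE (T : Type) (U : I -> T -> R) : [set w | forall i, A i (U (p i) w)] =
    [set w | forall t, t \in s -> `|U t w - c t| <= x].
  apply/seteqP; split=> w /= h.
    by move=> t /seq_tnthP[i ->]; exact: h.
  by move=> i; apply: h; exact: mem_tnth.
by rewrite !AE.
Qed.

End finite_dimensional_laws.

(** |z| <= exp z + exp (- z), both integrable by the moment generating function. *)
Lemma gaussian_integrable (d : measure_display) (T : measurableType d) (R : realType)
    (P : probability T R) (Z : T -> R) (m v : R) :
  gaussian P Z m v -> P.-integrable setT (EFin \o Z).
Proof.
move=> gZ; have [mZ _ _] := gZ.
have iexp (t : R) : P.-integrable setT (fun w => (expR (t * Z w))%:E).
  apply/integrableP; split.
    by apply/measurable_EFinP/measurableT_comp => //; exact: measurable_funM.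
  under eq_integral do rewrite /= ger0_norm ?expR_ge0//.
  by rewrite (gaussian_mgf gZ) ltry.
apply: (@le_integrable _ _ _ P _ _ _
    (fun w => ((expR (1 * Z w))%:E + (expR (- 1 * Z w))%:E)%E)) => //.
- exact/measurable_EFinP.
- move=> w _ /=; rewrite lee_fin mul1r mulN1r.
  rewrite [leRHS]ger0_norm ?addr_ge0 ?expR_ge0//.
  have h1 := expR_ge1Dx (Z w); have h2 := expR_ge1Dx (- Z w).
  have h3 := expR_ge0 (Z w); have h4 := expR_ge0 (- Z w).
  by rewrite ler_norml; apply/andP; split; lra.
- exact: integrableD.
Qed.

Lemma integral_comb (d : measure_display) (T : measurableType d) (R : realType)
    (P : probability T R) (I : Type) (F : I -> T -> R) (f : I -> R) (s : seq (R * I)) :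
    (forall i, P.-integrable setT (EFin \o F i)) ->
    (forall i, \int[P]_w (F i w)%:E = (f i)%:E)%E ->
  P.-integrable setT (fun w => (comb s (fun i => F i w))%:E) /\
  (\int[P]_w (comb s (fun i => F i w))%:E = (comb s f)%:E)%E.
Proof.
move=> iF Ff; elim: s => [|[a i] s [ih1 ih2]].
  have E0 : (fun w => (comb [::] (fun i => F i w))%:E) = cst (0 : \bar R).
    by apply/funext => w; rewrite comb_nil.
  by rewrite E0 comb_nil integral0; split => //; exact: integrable0.
have iaF : P.-integrable setT (fun w => (a%:E * (F i w)%:E)%E).
  by apply: (@integrableZl _ _ _ P setT measurableT a (EFin \o F i)).
split.
  rewrite (_ : (fun w => _) = (fun w => (a%:E * (F i w)%:E)%E) \+
    (fun w => (comb s (fun i => F i w))%:E)); first exact: integrableD.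
  by apply/funext => w /=; rewrite comb_cons EFinD EFinM.
under eq_integral do rewrite comb_cons EFinD EFinM.
rewrite integralD// ih2 comb_cons EFinD EFinM; congr (_ + _)%E.
by rewrite (@integralZl _ _ _ P setT measurableT (EFin \o F i))// Ff.
Qed.

(** * Linear combinations of the process *)

Section process_combinations.
Variables (R : realType) (d : measure_display) (Omega : measurableType d).
Variables (P : probability Omega R) (X : R -> {RV P >-> R}) (k : R -> R -> R).
Hypothesis X_gaussian : gaussian_process P (fun t => X t).
Hypothesis X_centered : forall t : R, 0 <= t -> ('E_P[X t] = 0)%E.
Hypothesis k_cov : forall t s : R, 0 <= t -> 0 <= s ->
  covariance P (X t) (X s) = (k t s)%:E.

(* Times are read through their absolute value, so that the covariance below
   is symmetric without side conditions. *)
Definition absX (t : R) (w : Omega) : R := X `|t| w.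
Definition absk (t s : R) : R := k `|t| `|s|.

Let comb_gaussian (s : seq (R * R)) : exists m v,
  gaussian P (fun w => comb s (fun t => absX t w)) m v.
Proof.
pose p i := tnth (in_tuple s) i.
have [m [sg [sg0 law]]] := @X_gaussian (size s) (fun i => (p i).1)
  (fun i => `|(p i).2|) (fun i => normr_ge0 _).
exists m, (sg ^+ 2); split.
- apply: measurable_sum => i; exact: measurable_funM.
- exact: sqr_ge0.
- move=> A mA; rewrite sqrtr_sqr ger0_norm// -law//.
  rewrite (_ : (fun w => comb s _) = (fun w => \sum_i (p i).1 * X `|(p i).2| w))//.
  by apply/funext => w; rewrite /comb big_tnth.
Qed.

Let absX_gaussian t : exists m v, gaussian P (absX t) m v.
Proof.
have [m [v h]] := comb_gaussian [:: (1, t)]; exists m, v; move: h.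
by congr gaussian; apply/funext => w; rewrite comb1 mul1r.
Qed.

Let absX_integrable t : P.-integrable setT (EFin \o absX t).
Proof. by have [m [v h]] := absX_gaussian t; exact: gaussian_integrable h. Qed.

Let absX_mean t : (\int[P]_w (absX t w)%:E = 0%:E)%E.
Proof. by have := X_centered (normr_ge0 t); rewrite expectation_def. Qed.

Let comb_mean (s : seq (R * R)) :
  (\int[P]_w (comb s (fun t => absX t w))%:E = 0%:E)%E.
Proof.
have [_ ->] := @integral_comb _ _ _ P _ absX (fun=> 0) s absX_integrable absX_mean.
by rewrite /comb big1// => i _; rewrite mulr0.
Qed.

Let comb_centered s : exists v, gaussian P (fun w => comb s (fun t => absX t w)) 0 v.
Proof.
have [m [v h]] := comb_gaussian s.
have [i _] := @integral_comb _ _ _ P _ absX (fun=> 0) s absX_integrable absX_mean.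
by exists v; rewrite (gaussian_mean_eq h i (comb_mean s)).
Qed.

Let absX_sqr_integrable t : P.-integrable setT (fun w => (absX t w ^+ 2)%:E).
Proof.
have [v h] := comb_centered [:: (1, t)].
have {h} h : gaussian P (absX t) 0 v.
  by move: h; congr gaussian; apply/funext => w; rewrite comb1 mul1r.
have [mX _ _] := h.
apply/integrableP; split; first by apply/measurable_EFinP; exact: measurable_funX.
under eq_integral do rewrite /= ger0_norm ?sqr_ge0//.
by rewrite (gaussian_sqr h)// ltry.
Qed.

Let absX_mul_integrable t u : P.-integrable setT (fun w => (absX t w * absX u w)%:E).
Proof.
apply: (@le_integrable _ _ _ P _ _ _
    (fun w => ((absX t w ^+ 2)%:E + (absX u w ^+ 2)%:E)%E)) => //.
- by apply/measurable_EFinP; exact: measurable_funM.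
- move=> w _ /=; rewrite lee_fin [leRHS]ger0_norm ?addr_ge0 ?sqr_ge0//.
  rewrite ler_norml; apply/andP; split.
    by have := sqr_ge0 (absX t w + absX u w);
       have := sqr_ge0 (absX t w); have := sqr_ge0 (absX u w); nra.
  by have := sqr_ge0 (absX t w - absX u w);
     have := sqr_ge0 (absX t w); have := sqr_ge0 (absX u w); nra.
- exact: integrableD.
Qed.

Let absX_mul t u : (\int[P]_w (absX t w * absX u w)%:E = (absk t u)%:E)%E.
Proof.
rewrite -(k_cov (normr_ge0 t) (normr_ge0 u)) unlock unlock.
have E0 (v : R) : fine (\int[P]_w (X `|v| w)%:E) = 0.
  by have := absX_mean v; rewrite /absX => ->.
apply: eq_integral => w _ /=; rewrite !E0; congr EFin.
by rewrite -[RHS]/((X `|t| w - 0) * (X `|u| w - 0)) !subr0.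
Qed.

Lemma comb_mul (s s' : seq (R * R)) :
  P.-integrable setT
    (fun w => (comb s (fun t => absX t w) * comb s' (fun t => absX t w))%:E) /\
  (\int[P]_w (comb s (fun t => absX t w) * comb s' (fun t => absX t w))%:E
   = (quad absk s s')%:E)%E.
Proof.
have E w : comb s (fun u => comb s' (fun t => absX t w * absX u w)) =
    comb s (fun t => absX t w) * comb s' (fun t => absX t w).
  rewrite [RHS]mulrC -combZ; apply: eq_comb => u.
  by rewrite [RHS]mulrC -combZ; apply: eq_comb => t; rewrite mulrC.
have h u := @integral_comb _ _ _ P _ (fun t w => absX t w * absX u w)
  (fun t => absk t u) s' (fun t => absX_mul_integrable t u) (fun t => absX_mul t u).
have [h1 h2] := @integral_comb _ _ _ P _
  (fun u w => comb s' (fun t => absX t w * absX u w))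
  (fun u => comb s' (fun t => absk t u)) s (fun u => (h u).1) (fun u => (h u).2).
split; first by move: h1; congr integrable; apply/funext => w; rewrite E.
by rewrite -h2; apply: eq_integral => w _; rewrite E.
Qed.

Lemma abskC t u : absk t u = absk u t.
Proof.
apply: EFin_inj; rewrite -!absX_mul.
by apply: eq_integral => w _; rewrite mulrC.
Qed.

(** [gaussian_process] leaves the parameters of each combination unspecified: the mean is identified
    by [gaussian_mean_eq], the variance by the second moment, computed from the covariance. *)
Lemma comb_process_gaussian (s : seq (R * R)) :
  gaussian P (fun w => comb s (fun t => absX t w)) 0 (quad absk s s).
Proof.
have [v h] := comb_centered s; suff -> : quad absk s s = v by [].
apply: EFin_inj; rewrite -(comb_mul s s).2 -(gaussian_sqr h)//.
Qed.

Lemma covariance_increments (a b c : R) : 0 <= a -> 0 <= b -> 0 <= c ->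
  fine (covariance P (X a \- X c) (X b \- X c)) = k a b - k a c - k c b + k c c.
Proof.
move=> a0 b0 c0.
have incE (u : R) w : 0 <= u -> (X u \- X c) w = comb [:: (1, u); (-1, c)] (fun t => absX t w).
  by move=> u0; rewrite comb_cons comb1 mul1r mulN1r /absX /= !ger0_norm.
have inc0 (u : R) : 0 <= u -> fine (\int[P]_w ((X u \- X c) w)%:E) = 0.
  move=> u0; rewrite (_ : (\int[P]_w _)%E = 0%:E)//.
  rewrite -(comb_mean [:: (1, u); (-1, c)]).
  by apply: eq_integral => w _; rewrite incE.
rewrite unlock unlock.
rewrite (_ : (\int[P]_w _)%E = (quad absk [:: (1, a); (-1, c)] [:: (1, b); (-1, c)])%:E).
  rewrite /= /quad !comb_cons !comb_nil /absk !ger0_norm//.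
  have kC (t u : R) : 0 <= t -> 0 <= u -> k t u = k u t.
    by move=> t0 u0; have := abskC t u; rewrite /absk !ger0_norm.
  by rewrite (kC b a)// (kC c a)// (kC b c)//; ring.
rewrite -(comb_mul _ _).2; apply: eq_integral => w _.
rewrite !inc0// -!incE//; congr EFin.
by rewrite -[LHS]/(((X a \- X c) w - 0) * ((X b \- X c) w - 0)) !subr0.
Qed.

End process_combinations.

(** * Limits of the conditional covariances *)

Section uniform_limits.
Variable R : realType.

(** Uniform convergence as the parameter decreases to 0, over any index type, so that times, pairs
    of times and constants are treated alike. *)
Definition ulim (J : Type) (f : R -> J -> R) (g : J -> R) : Prop :=
  forall x : R, 0 < x -> \forall e \near 0^'+, forall j, `|g j - f e j| < x.

Lemma ulim_ext (J : Type) (f f' : R -> J -> R) g :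
  (\forall e \near 0^'+, forall j, f e j = f' e j) -> ulim f g -> ulim f' g.
Proof.
move=> ff' fg x x0; near=> e => j.
have <- : f e j = f' e j by move: j; near: e.
by move: j; near: e; exact: fg.
Unshelve. all: by end_near. Qed.

Lemma eq_ulim (J : Type) (f : R -> J -> R) g g' : ulim f g -> g =1 g' -> ulim f g'.
Proof. by move=> fg /funext <-. Qed.

Lemma ulim_comp (J J' : Type) (p : J' -> J) f g :
  ulim f g -> ulim (fun e j => f e (p j)) (fun j => g (p j)).
Proof.
by move=> fg x x0; near=> e => j; move: (p j); near: e; exact: fg.
Unshelve. all: by end_near. Qed.

Section algebra.
Variable J : Type.
Implicit Types (f : R -> J -> R) (g : J -> R).

Lemma ulim_cst g : ulim (fun=> g) g.
Proof. by move=> x x0; near=> e => j; rewrite subrr normr0.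
Unshelve. all: by end_near. Qed.

Lemma ulim_scalar (c : R -> R) (l : R) : c e @[e --> 0^'+] --> l ->
  ulim (fun e (_ : J) => c e) (fun=> l).
Proof.
move=> /cvgrPdist_lt cl x x0; have := cl x x0.
by apply: filterS => e ce j.
Qed.

Lemma ulimD f f' g g' : ulim f g -> ulim f' g' ->
  ulim (fun e j => f e j + f' e j) (fun j => g j + g' j).
Proof.
move=> fg fg' x x0; have x2 : 0 < x / 2 by rewrite divr_gt0.
near=> e.
have hf : forall j, `|g j - f e j| < x / 2 by near: e; exact: fg.
have hf' : forall j, `|g' j - f' e j| < x / 2 by near: e; exact: fg'.
move=> j; have h := hf j; have h' := hf' j.
rewrite (_ : _ - _ = (g j - f e j) + (g' j - f' e j)); last by ring.
by rewrite (le_lt_trans (ler_normD _ _))//; lra.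
Unshelve. all: by end_near. Qed.

Lemma ulimZ a f g : ulim f g -> ulim (fun e j => a * f e j) (fun j => a * g j).
Proof.
move=> fg x x0; have a0 : 0 < `|a| + 1 by rewrite ltr_wpDl.
near=> e => j.
have h : `|g j - f e j| < x / (`|a| + 1).
  by move: j; near: e; apply: fg; rewrite divr_gt0.
rewrite -mulrBr normrM (@le_lt_trans _ _ (`|a| * (x / (`|a| + 1))))//.
  by rewrite ler_wpM2l// ltW.
by rewrite mulrCA gtr_pMr// ltr_pdivrMr// mul1r ltrDl.
Unshelve. all: by end_near. Qed.

Lemma ulimB f f' g g' : ulim f g -> ulim f' g' ->
  ulim (fun e j => f e j - f' e j) (fun j => g j - g' j).
Proof.
move=> fg /(@ulimZ (-1)) fg'; have := ulimD fg fg'; congr ulim.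
  by apply/funext => e; apply/funext => j; rewrite mulN1r.
by apply/funext => j; rewrite mulN1r.
Qed.

Definition bounded_by_some g := exists M : R, forall j, `|g j| <= M.

Lemma ulimM f f' g g' : bounded_by_some g -> bounded_by_some g' ->
  ulim f g -> ulim f' g' -> ulim (fun e j => f e j * f' e j) (fun j => g j * g' j).
Proof.
move=> [M gM] [M' gM'] fg fg' x x0.
pose W := `|M| + `|M'| + 2; have W0 : 0 < W by rewrite ltr_wpDl// addr_ge0.
pose z := Num.min 1 (x / W).
have z0 : 0 < z by rewrite lt_min ltr01 divr_gt0.
have z1 : z <= 1 by rewrite ge_min lexx.
have zW : z * W <= x by rewrite -ler_pdivlMr// ge_min lexx orbT.
near=> e.
have hf : forall j, `|g j - f e j| < z by near: e; exact: fg.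
have hf' : forall j, `|g' j - f' e j| < z by near: e; exact: fg'.
move=> j; have h := hf j; have h' := hf' j.
rewrite (_ : _ - _ = g j * (g' j - f' e j) + g' j * (g j - f e j)
  - (g j - f e j) * (g' j - f' e j)); last by ring.
rewrite (le_lt_trans (ler_normB _ _))//.
have h1 : `|g j * (g' j - f' e j)| <= `|M| * z.
  by rewrite normrM; apply: ler_pM => //; [exact: le_trans (gM j) (ler_norm M)|exact: ltW].
have h2 : `|g' j * (g j - f e j)| <= `|M'| * z.
  by rewrite normrM; apply: ler_pM => //; [exact: le_trans (gM' j) (ler_norm M')|exact: ltW].
have h3 : `|(g j - f e j) * (g' j - f' e j)| <= 1 * z.
  by rewrite normrM; apply: ler_pM => //; [exact: le_trans (ltW h) z1|exact: ltW].
have h4 := ler_normD (g j * (g' j - f' e j)) (g' j * (g j - f e j)).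
by move: zW; rewrite /W; nra.
Unshelve. all: by end_near. Qed.

Lemma ulim_unique f g g' : ulim f g -> ulim f g' -> g =1 g'.
Proof.
move=> fg fg' i; apply/eqP; rewrite -subr_eq0 -normr_le0 leNgt; apply/negP => gg'.
have h := fg _ (divr_gt0 gg' (ltr0n R 2)); have h' := fg' _ (divr_gt0 gg' (ltr0n R 2)).
have hE : \forall e \near (0 : R)^'+,
    (forall j, `|g j - f e j| < `|g i - g' i| / 2) /\
    (forall j, `|g' j - f e j| < `|g i - g' i| / 2).
  by apply: filterS2 h h' => e he he'; split.
have [e he2] := @filter_ex _ _ (at_right_proper_filter (0 : R)) _ hE; case: he2 => he he'.
have := ler_normB (g i - f e i) (g' i - f e i).
rewrite (_ : _ - _ - _ = g i - g' i); last by ring.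
by have := he i; have := he' i; lra.
Qed.

Lemma ulim_inv (b : R -> R) (l : R) (j0 : J) : l != 0 ->
  ulim (fun e (_ : J) => b e) (fun=> l) ->
  ulim (fun e (_ : J) => (b e)^-1) (fun=> l^-1).
Proof.
move=> l0 bl; apply: ulim_scalar; apply: cvgV => //; apply/cvgrPdist_lt => x x0.
by have := bl x x0; apply: filterS => e; exact.
Qed.

End algebra.

(** The kernels built from [kbar] and [rhobar] are known only as limits; their continuity is
    inherited from that of [k] in this way. *)
Lemma ulim_continuous (J : topologicalType) (f : R -> J -> R) g : ulim f g ->
  (\forall e \near 0^'+, continuous (f e)) -> continuous g.
Proof.
move=> fg cf j; apply/cvgrPdist_lt => x x0; have x3 : 0 < x / 3 by rewrite divr_gt0.
have hE : \forall e \near (0 : R)^'+,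
    continuous (f e) /\ (forall j, `|g j - f e j| < x / 3).
  by apply: filterS2 cf (fg _ x3) => e ce he; split.
have [e he2] := @filter_ex _ _ (at_right_proper_filter (0 : R)) _ hE; case: he2 => ce he.
have /cvgrPdist_lt /(_ _ x3) := ce j; apply: filterS => i fi.
have h1 := he j; have h2 := he i.
rewrite (_ : _ - _ = (g j - f e j) + (f e j - f e i) - (g i - f e i)); last by ring.
rewrite (le_lt_trans (ler_normB _ _))//.
have := ler_normD (g j - f e j) (f e j - f e i); lra.
Qed.

End uniform_limits.

Lemma within_continuous_comp_in (S V W : topologicalType) (A : set V) (f : V -> W)
    (g : S -> V) : {within A, continuous f} -> continuous g -> (forall x, A (g x)) ->
  continuous (fun x => f (g x)).
Proof.
move=> cf cg Ag x B Bfx; have := cf (g x) B Bfx.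
rewrite /nbhs/= -nbhs_subspace_in// => h.
have := cg x _ h; rewrite /nbhs/=; apply: filterS => y; apply; exact: Ag.
Qed.

(** * Conditional covariances on the shrinking window *)

Section conditional_limits.
Variables (R : realType) (k : R -> R -> R) (n : nat) (T : nat -> R).
Hypothesis kC : forall t s : R, 0 <= t -> 0 <= s -> k t s = k s t.
Hypothesis k_continuous : {within `[0, +oo[ `*` `[0, +oo[,
  continuous (fun p : R * R => k p.1 p.2)}.
Hypothesis n_gt0 : (0 < n)%N.
Hypothesis T_gt0 : forall j, (1 <= j <= n)%N -> 0 < T j.
Hypothesis k_pos : forall j, (1 <= j <= n)%N -> 0 < cond_cov k T j.-1 (T j) (T j).
Variables (gamma : R -> R) (kbar rhobar : R -> R -> R).
Hypothesis gamma_gt0 : forall e : R, 0 < e -> 0 < gamma e.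
Hypothesis gamma_cvg0 : gamma e @[e --> 0^'+] --> (0 : R).

Definition time (e : R) (t : I01 R) : R := T n + e * val01 t.

Hypothesis kbar_lim : ulim
  (fun e (p : I01 R * I01 R) => (k (time e p.1) (time e p.2) - k (time e p.1) (T n)
     - k (T n) (time e p.2) + k (T n) (T n)) / gamma e ^+ 2)
  (fun p => kbar (val01 p.1) (val01 p.2)).
Hypothesis rhobar_lim : forall u : R, 0 < u -> ulim
  (fun e t => (k (time e t) u - k (T n) u) / gamma e) (fun t => rhobar (val01 t) u).
Hypothesis kbar_pos : 0 < kbar_cond k T kbar rhobar n 1 1.

Local Notation kc := (cond_cov k T).

Lemma Tn_gt0 : 0 < T n. Proof. by apply: T_gt0; rewrite n_gt0 leqnn. Qed.

Lemma time_ge0 e t : 0 < e -> 0 <= time e t.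
Proof.
move=> e0; have /andP[t0 _] := val01_itv t.
by rewrite /time addr_ge0 ?mulr_ge0// ltW// Tn_gt0.
Qed.

Lemma cond_covC j t s : (j <= n)%N -> 0 <= t -> 0 <= s -> kc j t s = kc j s t.
Proof.
elim: j t s => [|j ih] t s jn t0 s0 /=; first exact: kC.
by rewrite (ih t s (ltnW jn))//; congr (_ - _); rewrite mulrAC [in RHS]mulrAC (mulrC (kc j s _)).
Qed.

(** Once conditioned at [T n], the process is deterministic there. *)
Lemma cond_cov_end s : 0 <= s -> kc n (T n) s = 0.
Proof.
move=> s0; case: n n_gt0 T_gt0 k_pos (@cond_covC) => [//|j] _ T0 kp kcC /=.
have jj : (1 <= j.+1 <= j.+1)%N by rewrite leqnn.
rewrite divff ?mul1r; last by rewrite gt_eqF//; exact: (kp j.+1 jj).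
by rewrite kcC// ?subrr// ltW// T0.
Qed.

Lemma cond_cov_endr s : 0 <= s -> kc n s (T n) = 0.
Proof. by move=> s0; rewrite cond_covC// ?cond_cov_end// ltW// Tn_gt0. Qed.

Lemma cond_cov_continuous (S : topologicalType) (a b : S -> R) j : (j <= n)%N ->
    continuous a -> continuous b -> (forall p, 0 <= a p) -> (forall p, 0 <= b p) ->
  continuous (fun p => kc j (a p) (b p)).
Proof.
elim: j a b => [|j ih] a b jn ca cb a0 b0 /=.
  have cab : continuous (fun p => (a p, b p)).
    move=> p B [[B1 B2] [/= h1 h2] BB].
    have h : nbhs p (a @^-1` B1 `&` b @^-1` B2).
      by apply: filterI; [exact: ca h1|exact: cb h2].
    by apply: filterS h => y [? ?]; exact: BB.
  apply: (within_continuous_comp_in k_continuous cab) => p.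
  by split; rewrite /= in_itv/= andbT.
have Tj : 0 < T j.+1 by apply: T_gt0; rewrite jn.
have cT : continuous (fun _ : S => T j.+1) by exact: continuous_const.
apply: continuous_sub; first by apply: ih => //; exact: ltnW.
apply: continuous_mul; last by apply: (ih b (fun=> T j.+1)) => //; [exact: ltnW|move=> _; exact: ltW].
apply: continuous_mul; last exact: continuous_const.
by apply: (ih a (fun=> T j.+1)) => //; [exact: ltnW|move=> _; exact: ltW].
Qed.

Lemma rho_lim j (u : R) : (j <= n)%N -> 0 < u -> ulim
  (fun e t => (kc j (time e t) u - kc j (T n) u) / gamma e)
  (fun t => rhobar_cond k T rhobar j (val01 t) u).
Proof.
elim: j u => [|j ih] u jn u0 /=; first exact: rhobar_lim.
have Tj : 0 < T j.+1 by apply: T_gt0; rewrite jn.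
have := ulimB (ih u (ltnW jn) u0) (ulimZ (alpha k T j.+1 u) (ih _ (ltnW jn) Tj)).
by apply: ulim_ext; apply: nearW => e t; rewrite /alpha/=; ring.
Qed.

Lemma time_continuous e : continuous (time e).
Proof.
apply: continuous_add; first exact: continuous_const.
by apply: continuous_scale; exact: val01_continuous.
Qed.

Lemma rhobar_cond_bounded j (u : R) : (j <= n)%N -> 0 < u ->
  bounded_by_some (fun t : I01 R => rhobar_cond k T rhobar j (val01 t) u).
Proof.
move=> jn u0; apply: bounded01; apply: (ulim_continuous (rho_lim jn u0)).
near=> e; have e0 : 0 < e by near: e; exact: nbhs_right_gt.
apply: continuous_mul; last exact: continuous_const.
apply: continuous_sub; last exact: continuous_const.
apply: cond_cov_continuous => //; first exact: time_continuous.
- exact: continuous_const.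
- by move=> t; exact: time_ge0.
- by move=> _; exact: ltW.
Unshelve. all: by end_near. Qed.

(** The induction is on covariances of increments from [T n]: each step subtracts a product of two
    increments of order [gamma], whose limits are given by [rho_lim]. At j = n the row at [T n]
    vanishes, which turns increments into values in [cond_cov_lim]. *)
Lemma increment_lim j : (j <= n)%N -> ulim
  (fun e (p : I01 R * I01 R) =>
     (kc j (time e p.1) (time e p.2) - kc j (time e p.1) (T n)
      - kc j (T n) (time e p.2) + kc j (T n) (T n)) / gamma e ^+ 2)
  (fun p => kbar_cond k T kbar rhobar j (val01 p.1) (val01 p.2)).
Proof.
elim: j => [|j ih] jn.
  by apply: (eq_ulim kbar_lim) => p; rewrite /kbar_cond big_geq// subr0.
have Tj : 0 < T j.+1 by apply: T_gt0; rewrite jn.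
have kj : 0 < kc j (T j.+1) (T j.+1) by apply: (k_pos (j := j.+1)); rewrite jn.
have bj := rhobar_cond_bounded (ltnW jn) Tj.
have rj := rho_lim (ltnW jn) Tj.
have r1 := ulim_comp (fun p : I01 R * I01 R => p.1) rj.
have r2 := ulim_comp (fun p : I01 R * I01 R => p.2) rj.
have b1 : bounded_by_some (fun p : I01 R * I01 R =>
    rhobar_cond k T rhobar j (val01 p.1) (T j.+1)).
  by have [M hM] := bj; exists M => p; exact: hM.
have b2 : bounded_by_some (fun p : I01 R * I01 R =>
    rhobar_cond k T rhobar j (val01 p.2) (T j.+1)).
  by have [M hM] := bj; exists M => p; exact: hM.
have h := ulimB (ih (ltnW jn)) (ulimZ (kc j (T j.+1) (T j.+1))^-1 (ulimM b1 b2 r1 r2)).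
apply: (ulim_ext _ (eq_ulim h _)); last first.
  move=> p; rewrite /kbar_cond [in RHS]big_nat_recr//= /alphabar/=.
  by move: (\sum_(_ <= _ < _) _) => sm; field; rewrite gt_eqF.
near=> e => p.
have g0 : 0 < gamma e by apply: gamma_gt0; near: e; exact: nbhs_right_gt.
by rewrite /=; field; rewrite !gt_eqF.
Unshelve. all: by end_near. Qed.

Lemma cond_cov_lim : ulim
  (fun e (p : I01 R * I01 R) => kc n (time e p.1) (time e p.2) / gamma e ^+ 2)
  (fun p => kbar_cond k T kbar rhobar n (val01 p.1) (val01 p.2)).
Proof.
apply: ulim_ext (increment_lim (leqnn n)); near=> e => p.
have e0 : 0 < e by near: e; exact: nbhs_right_gt.
have Tn := ltW Tn_gt0.
rewrite cond_cov_endr ?time_ge0// (cond_cov_end (time_ge0 _ e0)) (cond_cov_end Tn).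
by rewrite !subr0 addr0.
Unshelve. all: by end_near. Qed.

Let kb (p : I01 R * I01 R) := kbar_cond k T kbar rhobar n (val01 p.1) (val01 p.2).

Lemma time_end e : time e (one01 R) = T n + e.
Proof. by rewrite /time /val01 /= mulr1. Qed.

Lemma kbar_cond_continuous : continuous kb.
Proof.
apply: (ulim_continuous cond_cov_lim); near=> e.
have e0 : 0 < e by near: e; exact: nbhs_right_gt.
apply: continuous_mul; last exact: continuous_const.
apply: cond_cov_continuous => //.
- by move=> p; apply: (@continuous_comp _ _ _ fst (time e)); [exact: cvg_fst|exact: time_continuous].
- by move=> p; apply: (@continuous_comp _ _ _ snd (time e)); [exact: cvg_snd|exact: time_continuous].
- by move=> p; exact: time_ge0.
- by move=> p; exact: time_ge0.
Unshelve. all: by end_near. Qed.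

Let end_lim : ulim (fun e (t : I01 R) => kc n (time e t) (T n + e) / gamma e ^+ 2)
  (fun t => kb (t, one01 R)).
Proof.
have := ulim_comp (fun t : I01 R => (t, one01 R)) cond_cov_lim.
by apply: ulim_ext; apply: nearW => e t; rewrite /= time_end.
Qed.

Let kb_end_continuous : continuous (fun t => kb (t, one01 R)).
Proof.
move=> t.
apply: (@continuous_comp _ _ _ (fun t => (t, one01 R)) kb); last exact: kbar_cond_continuous.
move=> B [[B1 B2] [/= h1 h2] BB]; apply: filterS h1 => y By; apply: BB; split => //=.
exact: nbhs_singleton h2.
Qed.

Let kb_end_bounded : bounded_by_some (fun t => kb (t, one01 R)).
Proof. exact: bounded01. Qed.

Lemma betabar_continuous :
  continuous (fun t : I01 R => betabar k T kbar rhobar n (val01 t)).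
Proof. by apply: continuous_mul => //; exact: continuous_const. Qed.

(** The factor gamma^2 cancels between numerator and denominator, and the limit of the denominator
    is nonzero by [kbar_pos]. *)
Lemma beta_lim : ulim (fun e (t : I01 R) => beta k T n e (time e t))
  (fun t => betabar k T kbar rhobar n (val01 t)).
Proof.
have b1 := ulim_comp (fun _ : I01 R => one01 R) end_lim.
have v := ulim_inv (one01 R) (lt0r_neq0 kbar_pos) b1.
have bv : bounded_by_some (fun _ : I01 R => (kb (one01 R, one01 R))^-1).
  by exists `|(kb (one01 R, one01 R))^-1|.
have := ulimM kb_end_bounded bv end_lim v; apply: ulim_ext.
near=> e => t; have g0 : 0 < gamma e by apply: gamma_gt0; near: e; exact: nbhs_right_gt.
have g2 : (gamma e ^+ 2)^-1 != 0 by rewrite invr_eq0 expf_eq0/= gt_eqF.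
rewrite /beta time_end (invfM (kc n _ _)) invrK.
by rewrite mulrACA [X in _ * X]mulVf ?mulr1// expf_eq0/= gt_eqF.
Unshelve. all: by end_near. Qed.

Lemma betabar_bounded : bounded_by_some (fun t : I01 R => betabar k T kbar rhobar n (val01 t)).
Proof.
have [M hM] := kb_end_bounded; exists (M / kbar_cond k T kbar rhobar n 1 1) => t.
rewrite /betabar normrM normfV (gtr0_norm kbar_pos) ler_pM2r ?invr_gt0//; exact: (hM t).
Qed.

Definition bridge_cov (e : R) (t u : I01 R) : R :=
  kc n (time e t) (time e u) - beta k T n e (time e t) * kc n (time e u) (T n + e).

Lemma bridge_cov_lim : ulim
  (fun e (p : I01 R * I01 R) => bridge_cov e p.1 p.2 / gamma e ^+ 2)
  (fun p => kbarY k T kbar rhobar n (val01 p.1) (val01 p.2)).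
Proof.
have b1 := ulim_comp (fun p : I01 R * I01 R => p.1) beta_lim.
have b2 := ulim_comp (fun p : I01 R * I01 R => p.2) end_lim.
have bb1 : bounded_by_some (fun p : I01 R * I01 R => betabar k T kbar rhobar n (val01 p.1)).
  by have [M hM] := betabar_bounded; exists M => p; exact: hM.
have bb2 : bounded_by_some (fun p : I01 R * I01 R => kb (p.2, one01 R)).
  by have [M hM] := kb_end_bounded; exists M => p; exact: hM.
have h := ulimB cond_cov_lim (ulimM bb1 bb2 b1 b2).
apply: (ulim_ext _ (eq_ulim h _)); last first.
  by move=> p; rewrite /kbarY /betabar /kb/=; ring.
by apply: nearW => e p; rewrite /bridge_cov; ring.
Qed.

Lemma bridge_covC e t u : 0 < e -> bridge_cov e t u = bridge_cov e u t.
Proof.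
move=> e0; rewrite /bridge_cov /beta cond_covC ?time_ge0//; congr (_ - _).
by rewrite mulrAC [RHS]mulrAC (mulrC (kc n (time e u) _)).
Qed.

(** Symmetry holds before the limit and passes to it by uniqueness. *)
Lemma kbarYC (t u : I01 R) :
  kbarY k T kbar rhobar n (val01 t) (val01 u) = kbarY k T kbar rhobar n (val01 u) (val01 t).
Proof.
have h := ulim_comp (fun p : I01 R * I01 R => (p.2, p.1)) bridge_cov_lim.
have h2 : ulim (fun e (p : I01 R * I01 R) => bridge_cov e p.1 p.2 / gamma e ^+ 2)
    (fun p => kbarY k T kbar rhobar n (val01 p.2) (val01 p.1)).
  apply: ulim_ext h; near=> e => p.
  by rewrite /= bridge_covC//; near: e; exact: nbhs_right_gt.
exact: (ulim_unique bridge_cov_lim h2 (t, u)).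
Unshelve. all: by end_near. Qed.

Lemma kbarY_continuous : continuous (fun p : I01 R * I01 R =>
  kbarY k T kbar rhobar n (val01 p.1) (val01 p.2)).
Proof.
have cb (g : I01 R * I01 R -> I01 R * I01 R) : continuous g -> continuous (fun p => kb (g p)).
  by move=> cg p; exact: (@continuous_comp _ _ _ g kb p (cg p) (@kbar_cond_continuous _)).
have c1 (f : I01 R * I01 R -> I01 R) : continuous f -> continuous (fun p => (f p, one01 R)).
  move=> cf p B [[B1 B2] [/= h1 h2] BB].
  have h : nbhs p (f @^-1` B1) by exact: cf h1.
  apply: filterS h => y By; apply: BB; split => //=.
  exact: nbhs_singleton h2.
have cfst : continuous (fst : I01 R * I01 R -> I01 R) by move=> p; exact: cvg_fst.
have csnd : continuous (snd : I01 R * I01 R -> I01 R) by move=> p; exact: cvg_snd.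
rewrite /kbarY /betabar.
apply: continuous_sub; first exact: kbar_cond_continuous.
apply: continuous_mul; last exact: (cb _ (c1 _ cfst)).
apply: continuous_mul; last exact: continuous_const.
exact: (cb _ (c1 _ csnd)).
Qed.

Lemma kbar_cond_start (t : I01 R) : kbar_cond k T kbar rhobar n 0 (val01 t) = 0.
Proof.
have h := ulim_comp (fun p : I01 R => (zero01 R, p)) cond_cov_lim.
have h2 := @ulim_cst R _ (fun _ : I01 R => 0 : R).
apply: (ulim_unique h (ulim_ext _ h2) t); near=> e => q /=.
have e0 : 0 < e by near: e; exact: nbhs_right_gt.
rewrite [time e (zero01 R)]/time [val01 (zero01 R)]/val01/= mulr0 addr0.
by rewrite cond_cov_end ?mul0r//; exact: time_ge0.
Unshelve. all: by end_near. Qed.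

Lemma betabar_start : betabar k T kbar rhobar n 0 = 0.
Proof. by rewrite /betabar (kbar_cond_start (one01 R)) mul0r. Qed.

Lemma kbarY_start : kbarY k T kbar rhobar n 0 0 = 0.
Proof. by rewrite /kbarY betabar_start mul0r subr0 (kbar_cond_start (zero01 R)). Qed.

Lemma kbarY_end : kbarY k T kbar rhobar n 1 1 = 0.
Proof. by rewrite /kbarY /betabar divff ?mul1r ?subrr// gt_eqF. Qed.

(** The increments of the coefficient from [T n] are of order [gamma], which tends to 0. *)
Lemma alpha_lim j : (1 <= j <= n)%N ->
  ulim (fun e (t : I01 R) => alpha k T j (time e t)) (fun=> alpha k T j (T n)).
Proof.
case: j => // j jn; have jn' : (j <= n)%N by exact: ltnW.
have Tj := T_gt0 jn.
have g0 : bounded_by_some (fun _ : I01 R => 0 : R) by exists 0 => _; rewrite normr0.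
have h := ulimM g0 (rhobar_cond_bounded jn' Tj) (@ulim_scalar R (I01 R) _ _ gamma_cvg0)
  (rho_lim jn' Tj).
have h1 := ulimZ (kc j (T j.+1) (T j.+1))^-1
  (ulimD (ulim_cst (fun _ : I01 R => kc j (T n) (T j.+1))) h).
apply: (ulim_ext _ (eq_ulim h1 _)); last first.
  by move=> t; rewrite /alpha/= mul0r addr0 mulrC.
near=> e => t.
have ge : 0 < gamma e by apply: gamma_gt0; near: e; exact: nbhs_right_gt.
have kj : 0 < kc j (T j.+1) (T j.+1) by apply: (k_pos (j := j.+1)).
by rewrite /alpha/=; field; rewrite !gt_eqF.
Unshelve. all: by end_near. Qed.

Lemma cond_proc_lim (W : Type) (X : R -> W -> R) (x : nat -> R) (w : W) j :
    (j <= n)%N -> ulim (fun e t => X (time e t) w) (fun=> X (T n) w) ->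
  ulim (fun e t => cond_proc k T X x j (time e t) w)
       (fun=> cond_proc k T X x j (T n) w).
Proof.
move=> jn Xlim; elim: j jn => [//|j ih] jn /=.
have h := ulimB (ih (ltnW jn))
  (ulimZ (cond_proc k T X x j (T j.+1) w - x j.+1) (alpha_lim (j := j.+1) jn)).
apply: (ulim_ext _ (eq_ulim h _)); last by move=> t; rewrite mulrC.
by apply: nearW => e t; rewrite mulrC.
Qed.

Lemma cond_proc_end (W : Type) (X : R -> W -> R) (x : nat -> R) (w : W) :
  cond_proc k T X x n (T n) w = x n.
Proof.
case: n n_gt0 k_pos => [//|j] _ kp /=; rewrite /alpha/= divff ?mul1r.
  by ring.
by rewrite gt_eqF//; apply: (kp j.+1); rewrite leqnn.
Qed.

(** [X] is any family of functions here: sample paths give the limit of the bridge itself, the zero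
    process that of its mean, and both limits are [mbar]. *)
Lemma bridge_lim (W : Type) (X : R -> W -> R) (x : nat -> R) (y : R) (w : W) :
    ulim (fun e t => X (time e t) w) (fun=> X (T n) w) ->
  ulim (fun e (t : I01 R) => bridge k T X x n y e (time e t) w)
       (fun t => mbar k T kbar rhobar (x n) n y (val01 t)).
Proof.
move=> Xlim; have c := cond_proc_lim x (leqnn n) Xlim.
have c1 := ulim_comp (fun _ : I01 R => one01 R) c.
have bx : bounded_by_some (fun _ : I01 R => cond_proc k T X x n (T n) w - y).
  by exists `|cond_proc k T X x n (T n) w - y|.
have h := ulimB c (ulimM betabar_bounded bx beta_lim (ulimB c1 (ulim_cst (fun=> y)))).
apply: (ulim_ext _ (eq_ulim h _)); last first.
  by move=> t; rewrite cond_proc_end /mbar; ring.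
by apply: nearW => e t; rewrite /bridge time_end.
Qed.

End conditional_limits.

Section substitution.
Variable R : realType.

Lemma quad_lincomb (I : Type) (q : I -> I -> R) (s r s' r' : seq (R * I)) (a b : R) :
  quad q (s ++ scal a r) (s' ++ scal b r') =
  quad q s s' + b * quad q s r' + a * quad q r s' + a * b * quad q r r'.
Proof.
rewrite /quad comb_cat comb_scal.
have E v : comb v (fun u => comb (s' ++ scal b r') (fun t => q t u)) =
    comb v (fun u => comb s' (fun t => q t u)) +
    b * comb v (fun u => comb r' (fun t => q t u)).
  by rewrite -combZ -combD; apply: eq_comb => u; rewrite comb_cat comb_scal.
by rewrite !E; ring.
Qed.

(** Substitution in linear combinations: each point is itself expanded as a finite combination. *)
Definition cbind (I J : Type) (s : seq (R * I)) (F : I -> seq (R * J)) : seq (R * J) :=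
  flatten [seq scal p.1 (F p.2) | p <- s].

Lemma comb_cbind (I J : Type) (s : seq (R * I)) (F : I -> seq (R * J)) f :
  comb (cbind s F) f = comb s (fun i => comb (F i) f).
Proof.
elim: s => [|[a i] s ih]; first by rewrite !comb_nil.
by rewrite /cbind/= comb_cat comb_scal comb_cons -ih.
Qed.

Lemma quad_cbind (I J : Type) (q : J -> J -> R) (s : seq (R * I)) (F : I -> seq (R * J)) :
  quad q (cbind s F) (cbind s F) = quad (fun i j => quad q (F j) (F i)) s s.
Proof.
rewrite /quad comb_cbind; apply: eq_comb => i.
rewrite [RHS]comb_exchange; apply: eq_comb => u; exact: comb_cbind.
Qed.

End substitution.

(** * The bridge as a linear image of the process *)

Section bridge_terms.
Variables (R : realType) (d : measure_display) (Omega : measurableType d).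
Variables (P : probability Omega R) (X : R -> {RV P >-> R}) (k : R -> R -> R).
Variables (n : nat) (T : nat -> R).
Hypothesis n_gt0 : (0 < n)%N.
Hypothesis T_gt0 : forall j, (1 <= j <= n)%N -> 0 < T j.
Hypothesis k_pos : forall j, (1 <= j <= n)%N -> 0 < cond_cov k T j.-1 (T j) (T j).
Hypothesis kC : forall t s : R, 0 <= t -> 0 <= s -> k t s = k s t.

Fixpoint cond_terms (j : nat) (t : R) : seq (R * R) :=
  if j is i.+1 then
    cond_terms i t ++ scal (- alpha k T j t) (cond_terms i (T j))
  else [:: (1, t)].

Definition bridge_terms (e t : R) : seq (R * R) :=
  cond_terms n t ++ scal (- beta k T n e t) (cond_terms n (T n + e)).

(** Conditioning and bridge are affine in the process; on the zero process they reduce to their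
    deterministic part, which is the mean of the bridge. *)
Definition zero_process (_ : R) (_ : unit) : R := 0.

Lemma cond_proc_terms (x : nat -> R) j t w : (j <= n)%N -> 0 <= t ->
  cond_proc k T (fun u => X u) x j t w =
  comb (cond_terms j t) (fun u => absX X u w) + cond_proc k T zero_process x j t tt.
Proof.
elim: j t => [|j ih] t jn t0 /=.
  by rewrite comb1 mul1r /absX ger0_norm// addr0.
have Tj : 0 <= T j.+1 by apply/ltW/T_gt0; rewrite jn.
by rewrite !ih ?(ltnW jn)// comb_cat comb_scal; ring.
Qed.

Lemma bridge_termsE (x : nat -> R) y e t w : 0 < e -> 0 <= t ->
  bridge k T (fun u => X u) x n y e t w =
  comb (bridge_terms e t) (fun u => absX X u w) + bridge k T zero_process x n y e t tt.
Proof.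
move=> e0 t0; have Te : 0 <= T n + e by rewrite addr_ge0// ltW// T_gt0// n_gt0 leqnn.
by rewrite /bridge !cond_proc_terms// comb_cat comb_scal; ring.
Qed.

Lemma quad_cond_terms j t s : (j <= n)%N -> 0 <= t -> 0 <= s ->
  quad (absk k) (cond_terms j t) (cond_terms j s) = cond_cov k T j t s.
Proof.
elim: j t s => [|j ih] t s jn t0 s0 /=.
  by rewrite /quad !comb1 !mul1r /absk !ger0_norm// kC.
have jn' := ltnW jn; have Tj : 0 <= T j.+1 by apply/ltW/T_gt0; rewrite jn.
have kj : cond_cov k T j (T j.+1) (T j.+1) != 0.
  by rewrite gt_eqF//; apply: (k_pos (j := j.+1)); rewrite jn.
rewrite quad_lincomb !ih// /alpha/= (cond_covC T kC jn' Tj s0).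
by field.
Qed.

Lemma quad_bridge_terms e (t u : I01 R) : 0 < e ->
  quad (absk k) (bridge_terms e (time n T e t)) (bridge_terms e (time n T e u)) =
  bridge_cov k n T e t u.
Proof.
move=> e0; have Te : 0 <= T n + e by rewrite addr_ge0// ltW// T_gt0// n_gt0 leqnn.
have tt0 v := time_ge0 n_gt0 T_gt0 v e0.
rewrite quad_lincomb !quad_cond_terms// /bridge_cov /beta.
rewrite (cond_covC T kC (leqnn n) Te (tt0 u)).
(* If the pivot vanishes, [beta] is 0 since division by 0 gives 0, and both sides reduce to the
   conditional covariance. *)
have [->|E0] := eqVneq (cond_cov k T n (T n + e) (T n + e)) 0.
  by rewrite invr0; ring.
by field.
Qed.

End bridge_terms.

(** * Smallness in probability from pathwise convergence *)

Section small_paths.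
Variables (R : realType) (d : measure_display) (Omega : measurableType d).
Variables (P : probability Omega R) (J : eqType) (D : R -> J -> Omega -> R).
Hypothesis mD : forall e t, 0 < e -> measurable_fun setT (D e t).
Hypothesis D0 : forall w, ulim (fun e t => D e t w) (fun=> 0).

(* Reverse Fatou along a sequence of finite sets of indices avoids the
   measurability of suprema over uncountable sets. *)
Lemma small_in_probability (x : R) : 0 < x -> \forall e \near 0^'+,
  forall s : seq J,
    ((2^-1)%:E <= P [set w | forall t, t \in s -> (`|D e t w| <= x)%R])%E.
Proof.
move=> x0; pose good e (s : seq J) := [set w | forall t, t \in s -> `|D e t w| <= x].
have mgood e s : 0 < e -> measurable (good e s).
  move=> e0; have -> : good e s = \bigcap_(t in [set` s]) [set w | `|D e t w| <= x].
    by apply/seteqP; split=> w /= h t; exact: h.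
  apply: fin_bigcap_measurable => [|t _]; first exact: finite_seq.
  have mt : measurable_fun setT (fun w => `|D e t w|).
    by apply: measurableT_comp => //; exact: mD.
  have := mt measurableT `]-oo, x]%classic (measurable_itv _).
  by rewrite setTI; congr measurable; apply/seteqP; split=> w /=; rewrite in_itv.
apply: contrapT => H.
(* If the claim fails, it fails along parameters tending to 0, with one finite set of indices for
   each: the bad events are measurable and countably many. *)
have /choice[f hf] : forall i : nat, exists p : R * seq J,
    [/\ 0 < p.1, p.1 < i.+1%:R^-1 & (P (good p.1 p.2) < (2^-1)%:E)%E].
  move=> i; apply: contrapT => H2; apply: H; near=> e.
  have e0 : 0 < e by near: e; exact: nbhs_right_gt.
  have ei : e < i.+1%:R^-1 by near: e; apply: nbhs_right_lt; rewrite invr_gt0.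
  by move=> s; rewrite leNgt; apply/negP => lt2; apply: H2; exists (e, s).
pose A i := ~` good (f i).1 (f i).2.
have mA i : measurable (A i).
  by apply: measurableC; apply: mgood; have [] := hf i.
pose F N := \bigcup_(i in [set i | (N <= i)%N]) A i.
have mF N : measurable (F N) by apply: bigcup_measurable => i _; exact: mA.
(* Every path is uniformly small for all small parameters, hence lies in finitely many bad
   events. *)
have F0 : \bigcap_N F N = set0.
  apply/seteqP; split => // w Fw.
  have [del /= del0 hdel] := D0 w x0.
  have [N _ hN] := near_inv_lt del0.
  have [i /= Ni Aiw] := Fw N Logic.I; apply: Aiw => t _.
  have [f0 f1 _] := hf i.
  have := hdel (f i).1; rewrite /= sub0r normrN gtr0_norm// => hf1.
  have := hf1 _ f0 t; rewrite sub0r normrN => h; apply/ltW/h.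
  rewrite (lt_le_trans f1)//.
  rewrite (@le_trans _ _ N.+1%:R^-1)//; last by have /= := hN N (leqnn N); exact: ltW.
  by rewrite lef_pV2 ?posrE// ler_nat.
have cv : P (F N) @[N --> \oo] --> P (\bigcap_N F N).
  apply: nonincreasing_cvg_mu => //.
  - by apply: (@le_lt_trans _ _ 1%E); [exact: probability_le1|exact: ltry].
  - exact: bigcap_measurable.
  - move=> i j ij; apply/subsetPset => w [l /= jl Al]; exists l => //=.
    exact: leq_trans jl.
rewrite F0 measure0 in cv.
have half N : ((2^-1)%:E <= P (F N))%E.
  apply: (@le_trans _ _ (P (A N))); last first.
    apply: le_measure; rewrite ?inE; [exact: mA|exact: mF|].
    by move=> w Aw; exists N => //=.
  have [f0 _ fP] := hf N.
  rewrite /A probability_setC; last exact: mgood.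
  have fin : P (good (f N).1 (f N).2) \is a fin_num by apply: fin_num_measure; exact: mgood.
  move: fP; rewrite -(fineK fin) -EFinB lte_fin lee_fin => ?; lra.
have : ((2^-1)%:E <= (0 : \bar R))%E.
  rewrite -(cvg_lim _ cv)//; apply: lime_ge; first by apply/cvg_ex; eexists; exact: cv.
  exact: nearW.
by rewrite lee_fin leNgt invr_gt0 ltr0n.
Unshelve. all: by end_near. Qed.

End small_paths.

Lemma path_ulim (R : realType) (f : R -> R) (a : R) : 0 < a ->
    {within `[0, +oo[, continuous f} ->
  ulim (fun e (t : I01 R) => f (a + e * val01 t)) (fun=> f a).
Proof.
move=> a0 cf x x0.
have := cf a _ (nbhsx_ballx (f a) _ x0); rewrite /nbhs/= -nbhs_subspace_in; last first.
  by rewrite /= in_itv/= andbT ltW.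
move=> /nbhs_ballP[del /= del0 hdel]; near=> e.
have e0 : 0 < e by near: e; exact: nbhs_right_gt.
have ed : e < del by near: e; exact: nbhs_right_lt.
move=> t; have /andP[t0 t1] := val01_itv t.
have et0 : 0 <= e * val01 t by rewrite mulr_ge0// ltW.
apply: hdel.
  rewrite /ball/= opprD addrA subrr add0r normrN ger0_norm// (le_lt_trans _ ed)//.
  by rewrite ler_piMr// ltW.
by rewrite /= in_itv/= andbT addr_ge0// ltW.
Unshelve. all: by end_near. Qed.

Lemma measurable_evaluation (R : realType) (d : measure_display) (T : measurableType d)
    (P : probability T R) (U : {RV P >-> borel (C01 R)}) (t : I01 R) :
  measurable_fun setT (fun w => (U w : C01 R) t).
Proof.
have mt := borel_measurable (@evaluation_continuous R t).
have mU : measurable_fun setT (U : T -> borel (C01 R)) by exact: measurable_funPT.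
exact: (measurableT_comp mt mU).
Qed.

(** * Large deviations of the bridge *)

Theorem theorem4p2 (R : realType)
  (d : measure_display) (Omega : measurableType d) (P : probability Omega R)
  (X : R -> {RV P >-> R}) (k : R -> R -> R)
  (X_gaussian : gaussian_process P (fun t => X t))
  (X_centered : forall t, 0 <= t -> ('E_P[X t] = 0)%E)
  (X_continuous : forall w, {within `[0, +oo[, continuous (fun t => X t w)})
  (k_cov : forall t s, 0 <= t -> 0 <= s ->
     covariance P (X t) (X s) = (k t s)%:E)
  (k_continuous : {within `[0, +oo[ `*` `[0, +oo[,
     continuous (fun p : R * R => k p.1 p.2)})
  (n : nat) (n_gt0 : (0 < n)%N) (T : nat -> R) (x : nat -> R) (y : R)
  (T1_gt0 : 0 < T 1%N)
  (T_incr : forall j, (1 <= j < n)%N -> T j < T j.+1)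
  (k_pos : forall j, (1 <= j <= n)%N -> 0 < cond_cov k T j.-1 (T j) (T j))
  (gamma : R -> R)
  (gamma_gt0 : forall e, 0 < e -> 0 < gamma e)
  (gamma_cvg0 : gamma e @[e --> 0^'+] --> (0 : R))
  (kbar rhobar : R -> R -> R)
  (kbar_lim : {uniform `[0, 1] `*` `[0, 1],
     (fun (e : R) (p : R * R) =>
        fine (covariance P (X (T n + e * p.1) \- X (T n))
                           (X (T n + e * p.2) \- X (T n)))
        / gamma e ^+ 2) @ 0^'+ --> (fun p : R * R => kbar p.1 p.2)})
  (rhobar_lim : forall u, 0 < u -> {uniform `[0, 1],
     (fun (e t : R) => (k (T n + e * t) u - k (T n) u) / gamma e) @ 0^'+
       --> (fun t : R => rhobar t u)})
  (kbar_pos : 0 < kbar_cond k T kbar rhobar n 1 1)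
  (d' : R -> measure_display) (Omega' : forall e, measurableType (d' e))
  (Q : forall e, probability (Omega' e) R)
  (Y : forall e, {RV (Q e) >-> borel (C01 R)})
  (Y_bridge : forall e, 0 < e ->
     same_fdd (Q e) P
       (fun (t : I01 R) w => (Y e w : C01 R) t)
       (fun (t : I01 R) w =>
          bridge k T (fun u => X u) x n y e (T n + e * val01 t) w)) :
  LDP gamma Y (rateY k T kbar rhobar (x n) n y).
Proof.
have T_gt0 j : (1 <= j <= n)%N -> 0 < T j.
  elim: j => [//|[//|j] ih] /andP[_ jn].
  apply: (@lt_trans _ _ (T j.+1)); first by apply: ih; exact: ltnW.
  by apply: T_incr; rewrite jn.
have Tn0 : 0 < T n by apply: T_gt0; rewrite n_gt0 leqnn.
have Xc (t : R) : 0 <= t -> ('E_P[X t] = 0)%E by exact: X_centered.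
have kcov (t s : R) : 0 <= t -> 0 <= s -> covariance P (X t) (X s) = (k t s)%:E.
  exact: k_cov.
have kC (t s : R) : 0 <= t -> 0 <= s -> k t s = k s t.
  move=> t0 s0; have := abskC Xc kcov t s.
  by rewrite /absk !ger0_norm.
have tau0 e (t : I01 R) : 0 < e -> 0 <= time n T e t by exact: time_ge0.
have kbarL : ulim (fun e (p : I01 R * I01 R) =>
    (k (time n T e p.1) (time n T e p.2) - k (time n T e p.1) (T n)
     - k (T n) (time n T e p.2) + k (T n) (T n)) / gamma e ^+ 2)
    (fun p => kbar (val01 p.1) (val01 p.2)).
  move/uniform_cvgP : kbar_lim => h x0 x00; near=> e.
  have e0 : 0 < e by near: e; exact: nbhs_right_gt.
  have he : forall p : R * R, (`[0, 1] `*` `[0, 1])%classic p ->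
    `|kbar p.1 p.2 - fine (covariance P (X (T n + e * p.1) \- X (T n))
       (X (T n + e * p.2) \- X (T n))) / gamma e ^+ 2| < x0.
    by near: e; exact: h.
  move=> p; have := he (val01 p.1, val01 p.2) => /=.
  rewrite (covariance_increments X_gaussian Xc kcov (tau0 e p.1 e0) (tau0 e p.2 e0) (ltW Tn0)).
  by apply; split; rewrite /= in_itv/= val01_itv.
have rhoL (u : R) : 0 < u -> ulim
    (fun e t => (k (time n T e t) u - k (T n) u) / gamma e) (fun t => rhobar (val01 t) u).
  move=> u0; have /uniform_cvgP h := rhobar_lim _ u0.
  move=> x0 x00; near=> e.
  have he : forall t : R, (`[0, 1])%classic t ->
    `|rhobar t u - (k (T n + e * t) u - k (T n) u) / gamma e| < x0.
    by near: e; exact: h.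
  by move=> t; apply: (he (val01 t)); rewrite /= in_itv/= val01_itv.
pose q (t u : I01 R) := kbarY k T kbar rhobar n (val01 t) (val01 u).
pose m (t : I01 R) := mbar k T kbar rhobar (x n) n y (val01 t).
pose me e (t : I01 R) := bridge k T (@zero_process R) x n y e (time n T e t) tt.
have cq : continuous (fun p : I01 R * I01 R => q p.1 p.2).
  exact: (kbarY_continuous kC k_continuous n_gt0 T_gt0 k_pos gamma_gt0 kbarL rhoL).
have qC t u : q t u = q u t.
  exact: (kbarYC kC k_continuous n_gt0 T_gt0 k_pos gamma_gt0 kbarL rhoL kbar_pos).
have blim (W : Type) (Z : R -> W -> R) w :
    ulim (fun e t => Z (time n T e t) w) (fun=> Z (T n) w) ->
    ulim (fun e (t : I01 R) => bridge k T Z x n y e (time n T e t) w) m.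
  exact: (bridge_lim kC k_continuous n_gt0 T_gt0 k_pos gamma_gt0 gamma_cvg0 kbarL rhoL).
have meL : ulim me m.
  exact: (blim unit (@zero_process R) tt (@ulim_cst R _ (fun _ : I01 R => 0 : R))).
have XL w : ulim (fun e t => bridge k T (fun u => X u) x n y e (time n T e t) w) m.
  apply: (blim Omega (fun u => X u) w).
  exact: (@path_ulim R (fun u => X u w) (T n) Tn0 (X_continuous w)).
have KL := bridge_cov_lim kC k_continuous n_gt0 T_gt0 k_pos gamma_gt0 kbarL rhoL kbar_pos.
have cm : continuous m.
  apply: continuous_add; first exact: continuous_const.
  apply: continuous_mul; last exact: continuous_const.
  exact: (betabar_continuous kC k_continuous n_gt0 T_gt0 k_pos gamma_gt0 kbarL rhoL).
(* The centered bridge, written as a finite combination of values of [X], hence Gaussian. *)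
pose D e (t : I01 R) w := comb (bridge_terms k n T e (time n T e t)) (fun u => absX X u w).
have bridgeD e (t : I01 R) w : 0 < e ->
    bridge k T (fun u => X u) x n y e (time n T e t) w - me e t = D e t w.
  by move=> e0; rewrite (bridge_termsE X k n_gt0 T_gt0)// ?tau0// addrK.
have mD e (t : I01 R) : 0 < e -> measurable_fun setT (D e t).
  by move=> e0; have [] := comb_process_gaussian X_gaussian Xc kcov
    (bridge_terms k n T e (time n T e t)).
have mbridge e (t : I01 R) : 0 < e -> measurable_fun setT
    (fun w => bridge k T (fun u => X u) x n y e (time n T e t) w).
  move=> e0; apply: (eq_measurable_fun (fun w => D e t w + me e t)).
    by move=> w _; rewrite -bridgeD// subrK.
  by apply: measurable_funD => //; exact: mD.
have DL w : ulim (fun e t => D e t w) (fun=> 0).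
  have h := ulimB (XL w) meL.
  apply: (ulim_ext _ (eq_ulim h _)); last by move=> t; rewrite subrr.
  near=> e => t; apply: bridgeD; near: e; exact: nbhs_right_gt.
have Dsmall := small_in_probability P mD DL.
have cgauss : \forall e \near 0^'+, forall s : seq (R * I01 R),
    gaussian (Q e) (fun w => comb s (fun t => centered Y me t w)) 0
      (quad (bridge_cov k n T e) s s).
  near=> e; have e0 : 0 < e by near: e; exact: nbhs_right_gt.
  (* Laws are carried from the space of [X] to that of [Y], which is tied to it by
     finite-dimensional laws only. *)
  move=> s; apply: (same_fdd_gaussian (measurable_evaluation (Y e)) (fun t => mbridge e t e0)
    (Y_bridge _ e0)).
  have := comb_process_gaussian X_gaussian Xc kcov
    (cbind s (fun t => bridge_terms k n T e (time n T e t))).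
  rewrite quad_cbind; congr gaussian.
    apply/funext => w; rewrite comb_cbind; apply: eq_comb => t.
    by rewrite -/(D e t w) -bridgeD.
  congr (quad _ s s); apply/funext => t; apply/funext => u.
  rewrite (quad_bridge_terms n_gt0 T_gt0 k_pos kC)//.
  exact: bridge_covC.
have csmall x0 : 0 < x0 -> \forall e \near 0^'+, forall s : seq (I01 R),
    ((2^-1)%:E <= Q e [set w | forall t, t \in s -> (`|centered Y me t w| <= x0)%R])%E.
  move=> x00; near=> e; have e0 : 0 < e by near: e; exact: nbhs_right_gt.
  have hD : forall s : seq (I01 R),
      ((2^-1)%:E <= P [set w | forall t, t \in s -> (`|D e t w| <= x0)%R])%E.
    by near: e; exact: Dsmall.
  move=> s; have := hD s; congr (_ <= _)%E.
  rewrite (same_fdd_small (Y_bridge _ e0) (me e) s x0).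
  by congr (P _); apply/seteqP; split=> w /= h t /h; rewrite bridgeD.
have KL' x0 : 0 < x0 -> \forall e \near 0^'+,
    forall t u, `|q t u - bridge_cov k n T e t u / gamma e ^+ 2| < x0.
  by move=> x00; have := KL _ x00; apply: filterS => e h t u; exact: (h (t, u)).
apply: (gaussian_LDP gamma_gt0 gamma_cvg0 cm cq qC cgauss meL KL' csmall) => h.
(* The endpoint conditions of [rateY] follow from membership in the Hilbert space: the kernel
   vanishes at (0, 0) and (1, 1), so the path agrees with [mbar] at times 0 and 1, where [mbar]
   takes the values [x n] and [y]. *)
rewrite /rateY; congr (if _ then _ else _); apply: asbool_equiv_eq.
split=> [[//]|rh].
have q_ge0 := quad_lim_ge0 gamma_gt0 gamma_cvg0 cgauss KL'.
have z t := @rkhs_zero _ _ cq qC q_ge0 _ t rh.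
split => //.
- have : h (zero01 R) - mbar k T kbar rhobar (x n) n y 0 = 0.
    exact: (z (zero01 R)
      (kbarY_start kC k_continuous n_gt0 T_gt0 k_pos gamma_gt0 kbarL rhoL)).
  rewrite /mbar (betabar_start kC k_continuous n_gt0 T_gt0 k_pos gamma_gt0 kbarL rhoL).
  by rewrite mul0r addr0 => /subr0_eq.
- have : h (one01 R) - mbar k T kbar rhobar (x n) n y 1 = 0.
    exact: (z (one01 R) (kbarY_end kbar_pos)).
  rewrite /mbar /betabar divff ?gt_eqF// mul1r => /subr0_eq ->.
  by rewrite addrC subrK.
Unshelve. all: by end_near. Qed.
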